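(* Let $d\in\{1,2,3\}$, $L_1,\dots,L_d>0$, $\nu_2>0$, $r\in(0,1)$, and let the boundary conditions be of bi-Dirichlet, bi-Neumann, or periodic type. Then $$\sup_{M\in\mathbb N_+}\frac{\overline\alpha_M}{\overline\alpha_{M_+}}<+\infty\qquad\text{and}\qquad\sup_{M\in\mathbb N_+}\bigl|P_{\mathcal E_M^\perp}^{\mathcal U_M}\bigr|_{\mathcal L(H)}<+\infty,$$ where $H=L^2(\Omega)$ and $P_{\mathcal E_M^\perp}^{\mathcal U_M}$ is the oblique projection in $H$ onto $\mathcal E_M^\perp$ along $\mathcal U_M$.
   Context: $\Omega=\prod_{n=1}^d(0,L_n)$ in the bi-Dirichlet and bi-Neumann cases; in the periodic case $\Omega$ is the torus $\mathbb T^d_L\sim\prod_{n=1}^d[0,L_n)$. Actuators. For $n\in\{1,\dots,d\}$, $j\in\{1,\dots,M\}$ let $c_{n,j}^M=\frac{(2j-1)L_n}{2M}$ and $\omega_{n,j}^M=(c_{n,j}^M-\frac{rL_n}{2M},c_{n,j}^M+\frac{rL_n}{2M})$. For $\mathbf j\in\{1,\dots,M\}^d$ let $\omega_{\mathbf j}^M=\prod_{n=1}^d\omega_{n,\mathbf j_n}^M$. $\mathcal U_M$ is the linear span of the $M^d$ indicator functions $1_{\omega_{\mathbf j}^M}$. Auxiliary eigenfunctions. For $i\in\mathbb N_+$: $e_{n,i}(x_n)=\sin(\frac{i\pi x_n}{L_n})$ (bi-Dirichlet); $e_{n,i}(x_n)=\cos(\frac{(i-1)\pi x_n}{L_n})$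 (bi-Neumann); $e_{n,i}(x_n)=\cos(\frac{(i-1)\pi x_n}{L_n})$ if $i$ is odd and $\sin(\frac{i\pi x_n}{L_n})$ if $i$ is even (periodic). $\mathcal E_M$ is the linear span of the $M^d$ functions $e_{\mathbf j}^M(x)=\prod_{n=1}^de_{n,\mathbf j_n}(x_n)$, $\mathbf j\in\{1,\dots,M\}^d$. $\mathcal E_M^\perp$ is its orthogonal complement in $H$. One has $H=\mathcal U_M\oplus\mathcal E_M^\perp$, so the oblique projection is well defined. Operator and eigenvalues. $A=\nu_2(-\Delta+\mathbf 1)^2=\nu_2\Delta^2-2\nu_2\Delta+\nu_2\mathbf 1$ in $H$, where $-\Delta+\mathbf 1$ is taken under Dirichlet, Neumann, or periodic boundary conditions, respectively (so that the bi-Dirichlet conditions $y|_{\partial\Omega}=\Delta y|_{\partial\Omega}=0$, or the bi-Neumann conditions $\mathbf n\cdot\nabla y|_{\partial\Omega}=\mathbf n\cdot\nabla\Delta y|_{\partial\Omega}=0$, hold in its domain). With $\alpha_i$ denoting the eigenvalues of $A$, $$\overline\alpha_M=\max\{\alpha_i: \text{there is a nonzero }\phi\in\mathcal E_M\text{ with }A\phi=\alpha_i\phi\},\qquad\overline\alpha_{M_+}=\min\{\alpha_i:\text{there is a nonzero }\phi\in\mathcal E_M^\perp\text{ with }A\phi=\alpha_i\phi\}.$$ *)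

(* Defs.v *)
From HB Require Import structures.
From mathcomp Require Import all_boot all_order all_algebra.
From mathcomp Require Import all_classical all_reals all_analysis.

Set Implicit Arguments.
Unset Strict Implicit.
Unset Printing Implicit Defensive.

Import Order.TTheory GRing.Theory Num.Theory.
Import numFieldNormedType.Exports.

Local Open Scope classical_set_scope.
Local Open Scope ring_scope.

Section measurable_rV.
Context {R : realType} (n : nat).

Definition rV_coord (i : 'I_n) (x : 'rV[R]_n) : measurableTypeR R := x ord0 i.

Let rV_set0 : g_sigma_preimage rV_coord set0.
Proof. exact: sigma_algebra0. Qed.

Let rV_setC A : g_sigma_preimage rV_coord A -> g_sigma_preimage rV_coord (~` A).
Proof. exact: sigma_algebraC. Qed.

Let rV_bigcup (F : (set 'rV[R]_n)^nat) :
  (forall i, g_sigma_preimage rV_coord (F i)) ->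
  g_sigma_preimage rV_coord (\bigcup_i (F i)).
Proof. exact: sigma_algebra_bigcup. Qed.

HB.instance Definition _ := @isMeasurable.Build default_measure_display
  'rV[R]_n (g_sigma_preimage rV_coord) rV_set0 rV_setC rV_bigcup.

End measurable_rV.

Lemma measurable_rV_coord (R : realType) n (i : 'I_n) :
  measurable_fun [set: 'rV[R]_n] (rV_coord i).
Proof.
move=> _ Y mY; rewrite setTI; apply: sub_sigma_algebra => /=.
rewrite -bigcup_seq/=; exists i => /=; first by rewrite mem_index_enum.
by exists Y => //; rewrite setTI.
Qed.

Lemma measurable_fun_rVP (R : realType) n d (T : measurableType d)
    (f : T -> 'rV[R]_n) :
  (forall i, measurable_fun [set: T] (rV_coord i \o f)) ->
  measurable_fun [set: T] f.
Proof.
move=> mf _ Y mY; rewrite setTI; move: Y mY.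
have := @smallest_sub _ (sigma_algebra [set: 'rV[R]_n])
  (\big[setU/set0]_(i < n) preimage_set_system setT (rV_coord i) measurable)
  [set Y | measurable (f @^-1` Y)].
apply.
  split => /= [|A mA|F mF].
  - by rewrite preimage_set0.
  - by rewrite setTD preimage_setC; exact: measurableC.
  - by rewrite preimage_bigcup; exact: bigcup_measurable.
move=> A; rewrite -bigcup_seq => -[i _ [B mB <-]] /=.
by rewrite setTI; have := mf i measurableT _ mB; rewrite setTI.
Qed.

Section lebesgue_rV.
Context {R : realType}.

Definition rV_cons n (p : measurableTypeR R * 'rV[R]_n) : 'rV[R]_n.+1 :=
  \row_i if unlift ord0 i is Some j then p.2 ord0 j else p.1.

Definition rV_uncons n (x : 'rV[R]_n.+1) : measurableTypeR R * 'rV[R]_n :=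
  (x ord0 ord0, \row_i x ord0 (lift ord0 i)).

Lemma rV_consK n : cancel (@rV_cons n) (@rV_uncons n).
Proof.
case=> a x; rewrite /rV_uncons mxE unlift_none; congr pair.
by apply/rowP => i; rewrite !mxE liftK.
Qed.

Lemma measurable_rV_cons n : measurable_fun setT (@rV_cons n).
Proof.
apply: measurable_fun_rVP => i.
case: (unliftP ord0 i) => [j ->|->].
  rewrite (_ : _ \o _ = rV_coord j \o snd).
    by apply: measurableT_comp => //; exact: measurable_rV_coord.
  by apply/funext => x /=; rewrite /rV_coord mxE liftK.
rewrite (_ : _ \o _ = fst)//.
by apply/funext => x /=; rewrite /rV_coord mxE unlift_none.
Qed.

Lemma measurable_rV_uncons n : measurable_fun setT (@rV_uncons n).
Proof.
apply/measurable_fun_pairP; split.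
  exact: (measurable_rV_coord ord0).
apply: measurable_fun_rVP => i.
rewrite (_ : _ \o _ = rV_coord (lift ord0 i)); first exact: measurable_rV_coord.
by apply/funext => x /=; rewrite /rV_coord mxE.
Qed.

HB.instance Definition _ n := isMeasurableFun.Build _ _ _ _
  (@rV_cons n) (@measurable_rV_cons n).

Section lebesgue_step.
Local Open Scope ereal_scope.
Variables (n : nat) (mu : {sigma_finite_measure set 'rV[R]_n -> \bar R}).

Definition lebesgue_step : set 'rV[R]_n.+1 -> \bar R :=
  pushforward (@lebesgue_measure R \x mu) (@rV_cons n).

Let lebesgue_step0 : lebesgue_step set0 = 0.
Proof. exact: measure0. Qed.

Let lebesgue_step_ge0 A : 0 <= lebesgue_step A.
Proof. exact: measure_ge0. Qed.

Let lebesgue_step_sigma_additive : semi_sigma_additive lebesgue_step.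
Proof. exact: measure_semi_sigma_additive. Qed.

HB.instance Definition _ := isMeasure.Build _ _ _ lebesgue_step
  lebesgue_step0 lebesgue_step_ge0 lebesgue_step_sigma_additive.

Let lebesgue_step_sigma_finite : sigma_finite setT lebesgue_step.
Proof.
have /sigma_finiteP[F [TF ndF Foo]] := sigma_finiteT (@lebesgue_measure R).
have /sigma_finiteP[G [TG ndG Goo]] := sigma_finiteT mu.
exists (fun k => @rV_uncons n @^-1` (F k `*` G k)).
  rewrite -preimage_bigcup -[LHS](preimage_setT (@rV_uncons n)).
  congr (_ @^-1` _).
  rewrite -setXTT TF TG predeqE => -[x y]; split.
    move=> [/= [i _ Fx] [j _ Gy]]; exists (maxn i j) => //; split.
    - by move: x Fx; exact/subsetPset/ndF/leq_maxl.
    - by move: y Gy; exact/subsetPset/ndG/leq_maxr.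
  by move=> [i _ []/= ? ?]; split; exists i.
move=> k; have [mF Fk] := Foo k; have [mG Gk] := Goo k; split.
  rewrite -[X in measurable X]setTI; apply: measurable_rV_uncons => //.
  exact: measurableX.
rewrite /lebesgue_step /pushforward -comp_preimage.
rewrite (_ : _ \o _ = id); last by apply/funext => x /=; rewrite rV_consK.
by rewrite preimage_id product_measure1E// lte_mul_pinfty// ge0_fin_numE.
Qed.

HB.instance Definition _ :=
  Measure_isSigmaFinite.Build _ _ _ lebesgue_step lebesgue_step_sigma_finite.

End lebesgue_step.

Fixpoint lebesgue_rV n : {sigma_finite_measure set 'rV[R]_n -> \bar R} :=
  match n with
  | 0 => \d_(0 : 'rV[R]_0)
  | m.+1 => lebesgue_step (lebesgue_rV m)
  end.

Lemma measurable_rV_box n (A : 'I_n -> set R) :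
  (forall i, measurable (A i)) ->
  measurable [set x : 'rV[R]_n | forall i, A i (x ord0 i)].
Proof.
move=> mA; rewrite (_ : mkset _ = \bigcap_(i in setT) (rV_coord i @^-1` A i)).
  apply: fin_bigcap_measurable => [|i _]; first by apply: finite_finset.
  rewrite -[X in measurable X]setTI.
  by apply: measurable_rV_coord => //; exact: mA.
by apply/seteqP; split => x /= h i; [move=> _|]; exact: h.
Qed.

Lemma lebesgue_rV_box n (A : 'I_n -> set R) : (forall i, measurable (A i)) ->
  lebesgue_rV n [set x | forall i, A i (x ord0 i)] =
  (\prod_(i < n) lebesgue_measure (A i))%E.
Proof.
elim: n => [|n IHn] in A *; move=> mA.
  rewrite big_ord0 /= diracE mem_set//=; by case.
rewrite big_ord_recl -IHn//= -product_measure1E//; last first.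
  exact: (@measurable_rV_box n (fun i => A (lift ord0 i))).
  exact: (mA ord0).
rewrite /lebesgue_step /pushforward; congr (_ _).
apply/seteqP; split => -[a x] /= h.
  split => [|i]; first by have := h ord0; rewrite mxE unlift_none.
  by have := h (lift ord0 i); rewrite mxE liftK.
move=> i; case: (unliftP ord0 i) => [j ->|->]; rewrite mxE.
  by rewrite liftK; exact: h.2.
by rewrite unlift_none; exact: h.1.
Qed.

End lebesgue_rV.

Section L2.
Context {R : realType} (d : nat).
Implicit Types (L : 'I_d -> R) (u v f g : 'rV[R]_d -> R).

Definition box L : set 'rV[R]_d :=
  [set x | forall n, x ord0 n \in `]0, L n[%R].

Lemma measurable_box L : measurable (box L).
Proof.
by apply: (@measurable_rV_box _ _ (fun n => [set` `]0, L n[%R])) => n.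
Qed.

Definition leb_box L : {measure set 'rV[R]_d -> \bar R} :=
  mrestr (lebesgue_rV d) (measurable_box L).

(* An element of H is represented by a function on R^d that is measurable and
   square integrable over [box L], up to equality a.e. in [box L]. Every set of
   such functions below is closed under this equality. *)
Definition L2 L : set ('rV[R]_d -> R) :=
  [set u | u \in Lfun (leb_box L) 2%:E].

Definition inner L u v : R := \int[leb_box L]_x (u x * v x).

Definition norm2 L u : \bar R := 'N[leb_box L]_2%:E[EFin \o u].

Definition orthogonal_complement L (S : set ('rV[R]_d -> R)) :=
  [set v | L2 L v /\ forall u, S u -> inner L u v = 0].

Definition span L (J : finType) (b : J -> 'rV[R]_d -> R) :=
  [set u | L2 L u /\ exists c : J -> R,
    u = (fun x => \sum_j c j * b j x) %[ae leb_box L]].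

(* Onto [V], along [U]; the second clause and the existence of [P] say that H is
   the direct sum of [U] and [V]. *)
Definition oblique_projection L (U V : set ('rV[R]_d -> R))
    (P : ('rV[R]_d -> R) -> ('rV[R]_d -> R)) :=
  (forall h, L2 L h -> V (P h) /\ U (h \- P h)) /\
  (forall w, U w -> V w -> w = cst 0 %[ae leb_box L]).

Definition operator_norm L (P : ('rV[R]_d -> R) -> ('rV[R]_d -> R)) : \bar R :=
  ereal_sup [set norm2 L (P h) | h in [set h | L2 L h /\ (norm2 L h <= 1)%E]].

End L2.

Inductive boundary_condition := BiDirichlet | BiNeumann | Periodic.

Section actuators.
Context {R : realType} (d : nat).
Implicit Types (L : 'I_d -> R) (r : R) (M : nat).

(* In [center] and [eigfun1] the indices j and i start at 1, whereas ['I_M]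
   starts at 0, whence the [.+1] in [actuator] and [eigfun]. *)

Definition center L M (n : 'I_d) (j : nat) : R :=
  (2 * j%:R - 1) * L n / (2 * M%:R).

Definition actuator L r M (j : {ffun 'I_d -> 'I_M}) : set 'rV[R]_d :=
  [set x | forall n, x ord0 n \in
     `]center L M n (j n).+1 - r * L n / (2 * M%:R),
       center L M n (j n).+1 + r * L n / (2 * M%:R)[%R].

Definition calU L r M : set ('rV[R]_d -> R) :=
  span L (fun j : {ffun 'I_d -> 'I_M} => \1_(actuator L r j)).

Definition eigfun1 (bc : boundary_condition) (l : R) (i : nat) (t : R) : R :=
  match bc with
  | BiDirichlet => sin (i%:R * pi * t / l)
  | BiNeumann => cos (i.-1%:R * pi * t / l)
  | Periodic => if odd i then cos (i.-1%:R * pi * t / l)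
                else sin (i%:R * pi * t / l)
  end.

Definition eigfun bc L M (j : {ffun 'I_d -> 'I_M}) (x : 'rV[R]_d) : R :=
  \prod_(n < d) eigfun1 bc (L n) (j n).+1 (x ord0 n).

Definition calE bc L M : set ('rV[R]_d -> R) := span L (@eigfun bc L M).

Definition calE_perp bc L M : set ('rV[R]_d -> R) :=
  orthogonal_complement L (calE bc L M).

End actuators.

Section operator.
Context {R : realType} (d : nat).
Implicit Types (bc : boundary_condition) (L : 'I_d -> R).
Implicit Types (u v f phi : 'rV[R]_d -> R) (g h : 'I_d -> 'rV[R]_d -> R).

Definition partial (n : 'I_d) u : 'rV[R]_d -> R :=
  fun x => 'D_(delta_mx ord0 n) u x.

Definition C1 : set ('rV[R]_d -> R) :=
  [set phi | continuous phi /\ forall n,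
    (forall x, derivable phi x (delta_mx ord0 n)) /\ continuous (partial n phi)].

Definition C1_compact L : set ('rV[R]_d -> R) :=
  [set phi | C1 phi /\ exists K : set 'rV[R]_d,
    [/\ compact K, K `<=` box L & forall x, ~ K x -> phi x = 0]].

Definition C1_periodic L : set ('rV[R]_d -> R) :=
  [set phi | C1 phi /\
    forall x n, phi (x + L n *: delta_mx ord0 n) = phi x].

Definition weak_gradient L (test : set ('rV[R]_d -> R)) u g :=
  [/\ L2 L u, forall n, L2 L (g n) &
    forall phi n, test phi -> inner L u (partial n phi) = - inner L (g n) phi].

(* [form_domain bc L u g]: [u], with gradient [g], belongs to the form domain
   of the Laplacian, i.e., to H^1_0(Omega), H^1(Omega) or H^1(torus). The
   Sobolev spaces are taken in their C^1 presentation (as in Brezis): weak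
   derivatives are tested against C^1_c(Omega), and H^1_0 is the closure of
   C^1_c(Omega) in H^1. On the torus the test functions are the periodic C^1
   functions, so that jumps across opposite faces are detected. *)
Definition form_domain bc L u g :=
  match bc with
  | BiDirichlet => weak_gradient L (C1_compact L) u g /\
      forall e : R, 0 < e -> exists phi,
        [/\ C1_compact L phi, (norm2 L (u \- phi)%R < e%:E)%E &
            forall n, (norm2 L (g n \- partial n phi)%R < e%:E)%E]
  | BiNeumann => weak_gradient L (C1_compact L) u g
  | Periodic => weak_gradient L (C1_periodic L) u g
  end.

(* Graph of the operator - Delta + 1 under the boundary conditions [bc]: the
   self-adjoint operator in H associated with the form
   (u, v) |-> (grad u, grad v) + (u, v). *)
Definition shifted_laplacian bc L u f :=
  L2 L f /\ exists2 g, form_domain bc L u g &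
    forall v h, form_domain bc L v h ->
      \sum_(n < d) inner L (g n) (h n) + inner L u v = inner L f v.

(* Graph of A = nu2 (- Delta + 1)^2, with the domain of the operator square. *)
Definition opA nu2 bc L u f :=
  L2 L f /\ exists w z, [/\ shifted_laplacian bc L u w,
    shifted_laplacian bc L w z & f = (fun x => nu2 * z x) %[ae leb_box L]].

Definition eigenvalues_on nu2 bc L (S : set ('rV[R]_d -> R)) : set R :=
  [set alpha | exists phi, [/\ S phi, ~ (phi = cst 0 %[ae leb_box L]) &
    opA nu2 bc L phi (fun x => alpha * phi x)]].

End operator.

Definition is_max (R : realType) (S : set R) (a : R) := S a /\ ubound S a.

Definition is_min (R : realType) (S : set R) (a : R) := S a /\ lbound S a.

(* Main.v *)
Require Import Defs.
From HB Require Import structures.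
From mathcomp Require Import all_boot all_order all_algebra.
From mathcomp Require Import all_classical all_reals all_analysis.
From mathcomp Require Import measurable_realfun.
From mathcomp Require Import ring lra zify.

(** Everything in sight is a product over the coordinates: the eigenfunctions
    e_j(x) = prod_n e_(n,j_n)(x_n), the actuators, and the measure of the box.
    Both bounds therefore come down to trigonometry on one interval.

    _Eigenvalues._ Index the products e_j by all j in N^d. Each is a weak
    eigenfunction of -Delta + 1, with eigenvalue
    lambda_j = 1 + sum_n k_(n,j_n)^2, where k_(n,i) is the wavenumber of
    e_(n,i). Since A is symmetric, pairing A phi = alpha phi with e_j gives
    (alpha - nu2 lambda_j^2) <phi, e_j> = 0 ([opA_inner]): as soon as phi is
    not orthogonal to e_j, its eigenvalue is nu2 lambda_j^2. An eigenfunction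
    in E_M is not orthogonal to some e_j with all j_n < M. An eigenfunction in
    E_M^perp is orthogonal to these, but the family (e_j) is complete
    ([eigtensor_complete]), so it sees some e_j with j_n >= M for some n.
    As lambda is monotone in j, the maximum on E_M is reached at
    j = (M-1, ..., M-1), and the minimum on E_M^perp at an index which is M in
    one coordinate and 0 elsewhere. Both values of lambda are comparable to
    M^2 ([shifted_eigenvalue_ratio]).

    That e_j is an eigenfunction in the form sense rests on integration by
    parts ([inner_parts]). The test functions of the Dirichlet and Neumann
    spaces have compact support in the open box, so e_j, or its derivative, is
    first multiplied by cutoffs; the cutoff costs nothing in the limit because
    the factor that is differentiated vanishes at both ends of its interval
    ([bounded_cvg_partial_cutoff]).

    For completeness, the one-dimensional span of the eigenfunctions is stable
    under multiplication by a function that is positive exactly on ]0,b[. If x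
    is 1/2 minus a small multiple of it, the polynomials (1 - x^n)^(n 2^n)
    converge boundedly to the indicator of ]0,b[. So a function orthogonal to
    all e_j has zero integral, against a positive weight, over every box
    prod_n ]0,b_n[, hence over every measurable set.

    _Projection._ Averaging a wave cos(k t - p) over an interval centred at c
    multiplies its value at c by a factor that depends on k only. So the matrix
    of the inner products of the actuators with the e_j is V D with D
    diagonal, V sampling the e_j at the centres. The columns of V are
    orthogonal ([eig_midpoint_orth], the orthogonality of the discrete sine,
    cosine and Fourier transforms at midpoints), which inverts V explicitly.
    The entries of D do not decay faster than the side of an actuator because
    r < 1 keeps the half-width below a quarter of the shortest wavelength
    ([attenuation1_ge]). Together with Bessel's inequality this bounds I - P,
    hence P, uniformly in M ([actuator_proj_bound]). *)

Set Implicit Arguments.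
Unset Strict Implicit.
Unset Printing Implicit Defensive.

Import Order.TTheory GRing.Theory Num.Theory.
Import numFieldNormedType.Exports.

Local Open Scope classical_set_scope.
Local Open Scope ring_scope.

(** * Measurability and Fubini on a box *)

Section measurability.
Context {R : realType}.

(** The sigma-algebra is generated by the coordinates; an open set is the union
    of the countably many rational boxes that it contains. *)
Lemma open_measurable_rV n (O : set 'rV[R]_n) : open O -> measurable O.
Proof.
move=> oO.
pose B (q : {ffun 'I_n -> rat * rat}) : set 'rV[R]_n :=
  [set x | forall i, x ord0 i \in `]ratr (q i).1, ratr (q i).2[%R].
have mB q : measurable (B q).
  by apply: (@measurable_rV_box _ _ (fun i => [set` `]ratr (q i).1,
    ratr (q i).2[%R])).
pose D := [set q | B q `<=` O].
rewrite (_ : O = \bigcup_(q in D) B q); last first.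
  apply/seteqP; split => [x Ox|x [q Dq /Dq]]//.
  have /nbhs_ballP[e /= e0 eO] : nbhs x O by exact: open_nbhs_nbhs.
  have H i : exists q : rat * rat, x ord0 i - e < ratr q.1 < x ord0 i /\
      x ord0 i < ratr q.2 < x ord0 i + e.
    have /rat_in_itvoo[p /itvP p1] : x ord0 i - e <
      x ord0 i by rewrite ltrBlDr ltrDl.
    have /rat_in_itvoo[q /itvP q1] : x ord0 i < x ord0 i + e by rewrite ltrDl.
    by exists (p, q); rewrite !p1 !q1.
  have [q qP] := choice H.
  exists (finfun q); rewrite /D /B /=.
    move=> y /= yq; apply: eO; split => // i j; rewrite (ord1 i).
    have := yq j; rewrite ffunE in_itv/= => /andP[a b].
    have [/andP[c c'] /andP[d d']] := qP j.
    rewrite /ball/= ltr_distlC; apply/andP; split.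
      exact: (lt_trans c).
    exact: (lt_trans _ d').
  move=> i; rewrite ffunE in_itv/=.
  by have [/andP[_ ->] /andP[->]] := qP i.
rewrite bigcup_mkcond; apply: countable_bigcupT_measurable => [|q].
  exact: countableP.
by case: ifPn => //.
Qed.

Lemma continuous_measurable_rV n (f : 'rV[R]_n -> R) :
  continuous f -> measurable_fun setT f.
Proof.
move=> /continuousP cf; apply: (measurability _ (RGenOpens.measurableE R)).
move=> _ [_ [a [b ->] <-]]; rewrite setTI; apply: open_measurable_rV.
exact/cf/interval_open.
Qed.

Definition box_bounded d (L : 'I_d -> R) (f : 'rV[R]_d -> R) :=
  measurable_fun setT f /\ exists C : R, forall x, box L x -> `|f x| <= C.

Lemma leb_box_lty d (L : 'I_d -> R) : (leb_box L setT < +oo)%E.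
Proof.
rewrite /leb_box /= /mrestr setTI.
rewrite (_ : box L = [set x | forall n, [set` `]0, L n[%R] (x ord0 n)])//.
rewrite (lebesgue_rV_box (fun n => measurable_itv _)).
suff : (\prod_(i < d) lebesgue_measure [set` `]0%R, L i[])%E \is a fin_num.
  by rewrite fin_numElt => /andP[].
elim/big_ind : _ => [//|x y xoo yoo|i _]; first exact: fin_numM.
by rewrite lebesgue_measure_itv; case: ifPn.
Qed.

Section restriction.
Context (d : nat) (L : 'I_d -> R).
Local Open Scope ereal_scope.

Lemma integral_leb_box (f : 'rV[R]_d -> \bar R) :
  measurable_fun [set: 'rV[R]_d] f ->
  \int[leb_box L]_x f x = \int[lebesgue_rV d]_(x in box L) f x.
Proof.
move=> mf; have mb := measurable_box L.
transitivity (\int[leb_box L]_(x in box L) f x).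
  rewrite [RHS]integral_mkcond; apply: ae_eq_integral => //.
    by apply/(measurable_restrictT _ _).1 => //; exact: measurable_funTS.
  exists (~` box L); split; first exact: measurableC.
    by rewrite /leb_box /= /mrestr setICl measure0.
  move=> x /= H Lx; apply: H => _.
  by rewrite /patch mem_set.
apply: eq_measure_integral => A mA AL; rewrite /leb_box /= /mrestr.
by rewrite setIidl.
Qed.

Lemma ae_in_box (P : 'rV[R]_d -> Prop) :
  (forall x, box L x -> P x) -> {ae leb_box L, forall x, P x}.
Proof.
move=> boxP; exists (~` box L); split.
- by apply: measurableC; exact: measurable_box.
- by rewrite /leb_box /= /mrestr setICl measure0.
- by move=> x /= Px Lx; apply: Px; exact: boxP.
Qed.

End restriction.

Section fubini.
Context (d : nat) (L : 'I_d.+1 -> R).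
Let L' := fun i => L (lift ord0 i).

Lemma box_cons t x : box L (rV_cons (t, x)) <-> (t \in `]0, L ord0[%R) /\
  box L' x.
Proof.
rewrite /box /=; split=> [h|[h1 h2] i].
  split => [|i]; first by have := h ord0; rewrite mxE unlift_none.
  by have := h (lift ord0 i); rewrite mxE liftK.
case: (unliftP ord0 i) => [j ->|->]; rewrite mxE.
  by rewrite liftK; exact: h2.
by rewrite unlift_none.
Qed.

Lemma box_bounded_integrable n (M : 'I_n -> R) (f : 'rV[R]_n -> R) :
  box_bounded M f -> (leb_box M).-integrable setT (EFin \o f).
Proof.
move=> [mf [C fC]].
have mb := measurable_box M.
apply/integrableP; split; first exact/measurable_EFinP.
rewrite integral_leb_box; last by apply: measurableT_comp => //;
  exact/measurable_EFinP.
apply: (@le_lt_trans _ _ (\int[lebesgue_rV n]_(x in box M) (cst C%:E x))%E).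
  apply: ge0_le_integral => //=.
  - by apply: measurable_funTS; apply: measurableT_comp => //;
    exact: measurableT_comp.
rewrite integral_cst//=.
have := leb_box_lty M; rewrite /leb_box /= /mrestr setTI => h.
rewrite ltey_eq; apply/orP; left; apply: fin_numM => //.
by rewrite ge0_fin_numE.
Qed.

Lemma box_bounded_cons (f : 'rV[R]_d.+1 -> R) t :
  box_bounded L f -> t \in `]0, L ord0[%R ->
  box_bounded L' (fun x => f (rV_cons (t, x))).
Proof.
move=> [mf [C fC]] t0; split.
  apply: (measurableT_comp mf).
  by apply: (measurableT_comp (@measurable_rV_cons _ _));
    exact: measurable_pair1.
by exists C => x Lx; apply: fC; apply/box_cons.
Qed.

Local Open Scope ereal_scope.

(** Both orders of integration are needed: the first for products, the second to
    integrate along lines parallel to the first axis. *)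
Lemma integral_leb_box_cons (f : 'rV[R]_d.+1 -> R) : box_bounded L f ->
  \int[leb_box L]_x (f x)%:E =
    \int[lebesgue_measure]_(t in `]0%R, L ord0[)
      \int[leb_box L']_x (f (rV_cons (t, x)))%:E /\
  \int[leb_box L]_x (f x)%:E =
    \int[lebesgue_rV d]_(x in box L')
      \int[lebesgue_measure]_(t in `]0%R, L ord0[) (f (rV_cons (t, x)))%:E.
Proof.
move=> bf; have [mf [C fC]] := bf.
have mF : measurable_fun [set: 'rV[R]_d.+1]
  (EFin \o f) by exact/measurable_EFinP.
have mFc t : measurable_fun [set: 'rV[R]_d] (fun x => (f (rV_cons (t, x)))%:E).
  apply: (measurableT_comp mF).
  by apply: (measurableT_comp (@measurable_rV_cons _ _));
    exact: measurable_pair1.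
have mb := measurable_box L; have mb' := measurable_box L'.
rewrite integral_leb_box//.
pose P := @lebesgue_measure R \x lebesgue_rV d.
pose A := @rV_cons R d @^-1` box L.
have mA : measurable A.
  by rewrite /A -[X in measurable X]setTI; exact: measurable_rV_cons.
have mfc : measurable_fun setT (EFin \o f \o @rV_cons R d).
  by apply: measurableT_comp => //; exact: measurable_rV_cons.
have iF : P.-integrable A (EFin \o f \o @rV_cons R d).
  apply: (@measurable_bounded_integrable _ _ _ P (f \o @rV_cons R d)) => //.
  - have := leb_box_lty L; rewrite /leb_box /= /mrestr setTI.
    by [].
  - by apply: measurable_funTS; apply: measurableT_comp.
  - exists C; split; first exact: num_real.
    move=> M CM x Ax; apply: le_trans (ltW CM); exact: fC.
(* the Lebesgue measure on R^(d+1) is by definition this image measure *)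
rewrite [LHS](_ : _ = \int[pushforward P (@rV_cons R d)]_(x in box L)
  (EFin \o f) x)//.
rewrite integral_pushforward//.
rewrite integral_mkcond.
have iF' : P.-integrable setT ((EFin \o f \o @rV_cons R d) \_ A).
  exact/(integrable_mkcond _ mA).
have AE t x : ((EFin \o f \o @rV_cons R d) \_ A) (t, x) =
    if (t \in `]0%R, L ord0[%R) && (x \in box L') then (f (rV_cons (t, x)))%:E
      else 0.
  rewrite /patch.
  case: ifPn => [|]; rewrite /A.
    by rewrite inE => /box_cons[-> Lx]; rewrite mem_set.
  rewrite notin_setE => h; case: ifPn => // /andP[t0]; rewrite inE => Lx.
  by exfalso; apply: h; apply/box_cons.
split.
  rewrite -integral12_prod_meas1//= [RHS]integral_mkcond.
  apply: eq_integral => t _; rewrite /fubini_F patchE.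
  under eq_integral do rewrite AE.
  rewrite mem_setE; case: (t \in _) => /=; last by rewrite integral0.
  rewrite integral_leb_box// [RHS]integral_mkcond.
  by apply: eq_integral => x _; rewrite patchE.
rewrite -integral21_prod_meas1//=.
rewrite [RHS]integral_mkcond.
apply: eq_integral => x _; rewrite /fubini_G patchE.
under eq_integral do rewrite AE.
case: ifPn => Lx; last by rewrite integral0_eq// => t _; rewrite andbF.
rewrite [RHS]integral_mkcond.
by apply: eq_integral => t _; rewrite patchE mem_setE andbT.
Qed.
End fubini.

End measurability.

(** * Integrals of bounded functions and of tensor products *)

Section box_integrals.
Context {R : realType}.

Lemma box_bounded_cst d (L : 'I_d -> R) c : box_bounded L (cst c).
Proof. by split => //; exists `|c|. Qed.

Lemma box_boundedM d (L : 'I_d -> R) f g : box_bounded L f -> box_bounded L g ->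
  box_bounded L (f \* g).
Proof.
move=> [mf [C fC]] [mg [D gD]]; split; first exact: measurable_funM.
by exists (C * D) => x Lx; rewrite normrM ler_pM// ?fC ?gD.
Qed.

(** Eigenfunctions, actuators and cutoffs are all of this form. *)
Definition tensor d (f : 'I_d -> R -> R) (x : 'rV[R]_d) : R :=
  \prod_(n < d) f n (x ord0 n).

Definition itv_bounded (l : R) (f : R -> R) :=
  measurable_fun setT f /\
  exists C : R, forall t, t \in `]0, l[%R -> `|f t| <= C.

Lemma box_bounded_tensor d (L : 'I_d -> R) f :
  (forall n, itv_bounded (L n) (f n)) ->
  box_bounded L (tensor f).
Proof.
move=> bf; split.
  apply: measurable_prod => n _; have [mf _] := bf n.
  by apply: (measurableT_comp mf); exact: measurable_rV_coord.
have [C CP] := choice (fun n => (bf n).2).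
exists (\prod_(n < d) C n) => x Lx; rewrite normr_prod; apply: ler_prod => n _.
by rewrite normr_ge0 CP//; exact: Lx.
Qed.

Lemma itv_bounded_integrable l f : itv_bounded l f ->
  lebesgue_measure.-integrable [set` `]0, l[%R] (EFin \o f).
Proof.
move=> [mf [C fC]]; apply: measurable_bounded_integrable => //.
- by rewrite /= lebesgue_measure_itv; case: ifPn => _ //=; rewrite ltry.
- exact: measurable_funTS.
- exists C; split; first exact: num_real.
  by move=> M CM x Ax; apply: le_trans (ltW CM); exact: fC.
Qed.

Lemma itv_bounded_cst l c : itv_bounded l (cst c).
Proof. by split => //; exists `|c|. Qed.

Lemma itv_boundedD l f g : itv_bounded l f -> itv_bounded l g ->
  itv_bounded l (f \+ g).
Proof.
move=> [mf [C fC]] [mg [D gD]]; split; first exact: measurable_funD.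
by exists (C + D) => x Lx; rewrite (le_trans (ler_normD _ _))// lerD// ?fC ?gD.
Qed.

Lemma itv_boundedM l f g : itv_bounded l f -> itv_bounded l g ->
  itv_bounded l (f \* g).
Proof.
move=> [mf [C fC]] [mg [D gD]]; split; first exact: measurable_funM.
by exists (C * D) => x Lx; rewrite normrM ler_pM// ?fC ?gD.
Qed.

Lemma itv_boundedZ l c (f : R -> R) : itv_bounded l f ->
  itv_bounded l (fun t => c * f t).
Proof. by move=> bf; apply: (itv_boundedM (itv_bounded_cst l c) bf). Qed.

Lemma Rintegral_cons d (L : 'I_d.+1 -> R) f : box_bounded L f ->
  \int[leb_box L]_x f x = \int[lebesgue_measure]_(t in `]0, L ord0[)
    \int[leb_box (fun i => L (lift ord0 i))]_x f (rV_cons (t, x)).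
Proof.
move=> bf; rewrite {1}/Rintegral (integral_leb_box_cons bf).1; congr fine.
apply: eq_integral => t; rewrite inE => tI; rewrite fineK//.
by apply: integrable_fin_num => //; apply: box_bounded_integrable;
  exact: box_bounded_cons.
Qed.

Definition set_coord d (x : 'rV[R]_d) (n : 'I_d) (t : R) : 'rV[R]_d :=
  \row_m if m == n then t else x ord0 m.

(** A form of Fubini in an arbitrary coordinate, which avoids reordering the
    coordinates: it suffices that the integral vanish on every segment parallel
    to the axis [n]. *)
Lemma Rintegral_slice0 d (L : 'I_d -> R) (n : 'I_d) f : box_bounded L f ->
  (forall x, box L x ->
     \int[lebesgue_measure]_(t in `]0, L n[) f (set_coord x n t) = 0) ->
  \int[leb_box L]_x f x = 0.
Proof.
elim: d => [|d IH] in L n f *; first by case: n => -[].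
move=> bf; have [->|[m ->]] : n = ord0 \/ exists m, n = lift ord0 m.
- by case: (unliftP ord0 n) => [m|] ->; [right; exists m|left].
- move=> f0; rewrite /Rintegral (integral_leb_box_cons bf).2 integral0_eq// =>
  x Lx.
  have bx : itv_bounded (L ord0) (fun t => f (rV_cons (t, x))).
    have [mf [C fC]] := bf; split.
      apply: (measurableT_comp mf).
      by apply: (measurableT_comp (@measurable_rV_cons _ _));
        exact: measurable_pair2.
    by exists C => t t0; apply: fC; apply/box_cons.
  (* t0 completes x to a point of the box; its value is overwritten *)
  have [[t0 t0L]|Ln] := pselect (exists t0, t0 \in `]0, L ord0[%R); last first.
    rewrite integral0_eq// => t tL; exfalso; apply: Ln; by exists t.
  rewrite -[LHS]fineK; last first.
    by apply: integrable_fin_num => //; exact: itv_bounded_integrable.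
  congr EFin; rewrite -[RHS](f0 (rV_cons (t0, x))); last exact/box_cons.
  apply: eq_Rintegral => t _; congr f.
  apply/rowP => i; rewrite !mxE; case: (unliftP ord0 i) => [j ->|->].
    by rewrite (_ : (lift ord0 j == ord0) = false).
  by rewrite eqxx.
- move=> f0; rewrite Rintegral_cons// /Rintegral integral0_eq// => t tI;
  congr EFin.
  apply: (IH _ m); first exact: box_bounded_cons.
  move=> x Lx; rewrite -[RHS](f0 (rV_cons (t, x))); last exact/box_cons.
  apply: eq_Rintegral => s _; congr f.
  apply/rowP => i; rewrite !mxE; case: (unliftP ord0 i) => [j ->|->].
    by rewrite (inj_eq lift_inj) !mxE.
  by rewrite (_ : (ord0 == lift ord0 m) = false).
Qed.

Lemma Rintegral_tensor d (L : 'I_d -> R) f :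
  (forall n, itv_bounded (L n) (f n)) ->
  \int[leb_box L]_x tensor f x =
  \prod_(n < d) \int[lebesgue_measure]_(t in `]0, L n[) f n t.
Proof.
elim: d => [|d IH] in L f * => bf.
  rewrite big_ord0 /Rintegral integral_leb_box; last first.
    apply/measurable_EFinP. exact: (box_bounded_tensor bf).1.
  rewrite integral_dirac//; last 2 first.
    exact: measurable_box.
    apply/measurable_EFinP; apply: measurable_funTS;
      exact: (box_bounded_tensor bf).1.
  rewrite diracE mem_set; last by case.
  by rewrite mul1e /tensor big_ord0.
rewrite Rintegral_cons; last exact: box_bounded_tensor.
rewrite big_ord_recl -(IH _ (fun n => f (lift ord0 n))); last by move=> n;
  exact: bf.
rewrite -RintegralZr//; last exact: itv_bounded_integrable.
apply: eq_Rintegral => t _.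
rewrite -RintegralZl//; last first.
  by apply: box_bounded_integrable; apply: box_bounded_tensor => n; exact: bf.
apply: eq_Rintegral => x _; rewrite /tensor big_ord_recl !mxE unlift_none;
  congr (_ * _).
by apply: eq_bigr => n _; rewrite mxE liftK.
Qed.
End box_integrals.

(** * The inner product of square integrable functions *)

Section square_integrable.
Context {R : realType} (d : nat) (L : 'I_d -> R).
Implicit Types (u v f g : 'rV[R]_d -> R).

Lemma L2P u : L2 L u <-> measurable_fun setT u /\
  (leb_box L).-integrable setT (EFin \o (fun x => u x ^+ 2)).
Proof.
split=> [Lu|[mu iu]].
  split; last exact: Lfun2_integrable_sqr.
  by move: Lu; rewrite /L2 /= inE => /andP[]; rewrite inE.
rewrite /L2 /= inE; apply/andP; split; rewrite inE//=.
rewrite /finite_norm unlock poweR_lty//.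
under eq_integral do rewrite /= ?poweR_EFin powR_mulrn// -normrX ger0_norm
  ?sqr_ge0//.
exact: integrable_lty.
Qed.

Lemma L2_measurable u : L2 L u -> measurable_fun setT u.
Proof. by case/L2P. Qed.

Lemma L2_integrableM u v : L2 L u -> L2 L v ->
  (leb_box L).-integrable setT (EFin \o (fun x => u x * v x)).
Proof. by move=> Lu Lv; apply/Lfun1_integrable; exact: Lfun2_mul_Lfun1. Qed.

Lemma box_bounded_L2 u : box_bounded L u -> L2 L u.
Proof.
move=> bu; apply/L2P; split; first exact: bu.1.
by apply: box_bounded_integrable; exact: box_boundedM.
Qed.

Lemma L2_integrable u : L2 L u -> (leb_box L).-integrable setT (EFin \o u).
Proof.
move=> Lu; have := L2_integrableM Lu (box_bounded_L2 (box_bounded_cst L 1)).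
by congr (_.-integrable _ _); apply/funext => x /=; rewrite mulr1.
Qed.

Lemma L2Z c u : L2 L u -> L2 L (fun x => c * u x).
Proof.
move=> /L2P[mu iu]; apply/L2P; split; first exact: measurable_funM.
rewrite [X in _.-integrable _ X](_ : _ =
  (fun x => (c ^+ 2)%:E * (u x ^+ 2)%:E))%E.
  exact: integrableZl.
by apply/funext => x /=; rewrite exprMn.
Qed.

Lemma L2D u v : L2 L u -> L2 L v -> L2 L (u \+ v).
Proof.
move=> Lu Lv; have Luv := L2_integrableM Lu Lv.
move: Lu Lv => /L2P[mu iu] /L2P[mv iv]; apply/L2P; split;
  first exact: measurable_funD.
rewrite [X in _.-integrable _ X](_ : _ =
  (fun x => (u x ^+ 2)%:E + (v x ^+ 2)%:E +
  2%:E * (u x * v x)%:E))%E.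
  by apply: integrableD => //; [exact: integrableD|exact: integrableZl].
by apply/funext => x /=; rewrite -EFinM -!EFinD; congr EFin; ring.
Qed.

Lemma L2B u v : L2 L u -> L2 L v -> L2 L (u \- v).
Proof.
move=> Lu Lv; rewrite (_ : _ \- _ = u \+ (fun x => -1 * v x)).
  by apply: L2D => //; exact: L2Z.
by apply/funext => x /=; rewrite mulN1r.
Qed.

Lemma L2_sum (J : Type) (s : seq J) (f : J -> 'rV[R]_d -> R) :
  (forall j, L2 L (f j)) -> L2 L (fun x => \sum_(j <- s) f j x).
Proof.
move=> bf; elim: s => [|j s IH].
  by under eq_fun do rewrite big_nil;
    exact: box_bounded_L2 (box_bounded_cst _ _).
by under eq_fun do rewrite big_cons; exact: L2D.
Qed.

Lemma innerC u v : inner L u v = inner L v u.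
Proof. by apply: eq_Rintegral => x _; rewrite mulrC. Qed.

Lemma innerDl u v w : L2 L u -> L2 L v -> L2 L w ->
  inner L (u \+ v) w = inner L u w + inner L v w.
Proof.
move=> Lu Lv Lw; rewrite -RintegralD//; try exact: L2_integrableM.
by apply: eq_Rintegral => x _ /=; rewrite mulrDl.
Qed.

Lemma innerZl c u w : L2 L u -> L2 L w ->
  inner L (fun x => c * u x) w = c * inner L u w.
Proof.
move=> Lu Lw; rewrite -RintegralZl//; last exact: L2_integrableM.
by apply: eq_Rintegral => x _ /=; rewrite mulrA.
Qed.

Lemma innerZr c u w : L2 L u -> L2 L w ->
  inner L w (fun x => c * u x) = c * inner L w u.
Proof. by move=> Lu Lw; rewrite innerC innerZl// innerC. Qed.

Lemma innerBl u v w : L2 L u -> L2 L v -> L2 L w ->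
  inner L (u \- v) w = inner L u w - inner L v w.
Proof.
move=> Lu Lv Lw; rewrite -RintegralB//; try exact: L2_integrableM.
by apply: eq_Rintegral => x _ /=; rewrite mulrBl.
Qed.

Lemma innerBr u v w : L2 L u -> L2 L v -> L2 L w ->
  inner L w (u \- v) = inner L w u - inner L w v.
Proof. by move=> Lu Lv Lw; rewrite innerC innerBl// !(innerC w). Qed.

Lemma inner_suml (J : Type) (s : seq J) (f : J -> 'rV[R]_d -> R) w :
  (forall j, L2 L (f j)) -> L2 L w ->
  inner L (fun x => \sum_(j <- s) f j x) w = \sum_(j <- s) inner L (f j) w.
Proof.
move=> Lf Lw; elim: s => [|j s IH].
  rewrite big_nil /inner /Rintegral integral0_eq// => x _.
  by rewrite big_nil mul0r.
rewrite big_cons -IH -innerDl//; last exact: L2_sum.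
by apply: eq_Rintegral => x _; rewrite big_cons.
Qed.

Lemma inner_lincomb (J : finType) (c : J -> R) (f : J -> 'rV[R]_d -> R) w :
  (forall j, L2 L (f j)) -> L2 L w ->
  inner L (fun x => \sum_j c j * f j x) w = \sum_j c j * inner L (f j) w.
Proof.
move=> Lf Lw; rewrite (inner_suml _ (fun j => L2Z (c j) (Lf j)))//.
by apply: eq_bigr => j _; rewrite innerZl.
Qed.

Lemma inner_ae u v w : L2 L u -> L2 L v -> L2 L w ->
  u = v %[ae leb_box L] -> inner L u w = inner L v w.
Proof.
move=> Lu Lv Lw uv; congr fine; apply: ae_eq_integral => //.
- by apply/measurable_EFinP; apply: measurable_funM; exact: L2_measurable.
- by apply/measurable_EFinP; apply: measurable_funM; exact: L2_measurable.
- by apply: filterS uv => x /= + _ => -> //.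
Qed.

Lemma inner_ge0 u : 0 <= inner L u u.
Proof. by apply: Rintegral_ge0 => x _; rewrite -expr2 sqr_ge0. Qed.

Lemma inner_eq0 u : L2 L u -> inner L u u = 0 -> u = cst 0 %[ae leb_box L].
Proof.
move=> Lu u0.
have h : (\int[leb_box L]_x `|(u x * u x)%:E| = 0)%E.
  under eq_integral do rewrite gee0_abs ?lee_fin -?expr2 ?sqr_ge0//.
  rewrite -[LHS]fineK; first by congr EFin.
  by apply: integrable_fin_num => //; case/L2P : Lu.
move/ae_eq_integral_abs : h => /(_ measurableT).
have mm : measurable_fun setT (fun x => (u x * u x)%:E).
  by apply/measurable_EFinP; apply: measurable_funM; exact: L2_measurable.
move=> /(_ mm); apply: filterS => x /= /(_ Logic.I) [] /eqP.
by rewrite mulf_eq0 orbb => /eqP.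
Qed.

Lemma norm2E u : L2 L u -> norm2 L u = (Num.sqrt (inner L u u))%:E.
Proof.
move=> Lu; have iu := L2_integrableM Lu Lu.
rewrite /norm2 unlock.
under eq_integral do rewrite /= ?poweR_EFin powR_mulrn// -normrX ger0_norm
  ?sqr_ge0// expr2.
rewrite -[X in (X `^ _)%E]fineK; last exact: integrable_fin_num.
by rewrite poweR_EFin powR12_sqrt// inner_ge0.
Qed.

(** The quadratic polynomial <u - t v, u - t v> in [t] is nonnegative. *)
Lemma cauchy_schwarz u v : L2 L u -> L2 L v ->
  inner L u v ^+ 2 <= inner L u u * inner L v v.
Proof.
move=> Lu Lv.
have H t : 0 <= inner L u u - 2 * t * inner L u v + t ^+ 2 * inner L v v.
  have Ltv := L2Z t Lv.
  have := inner_ge0 (u \- (fun x => t * v x)).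
  have Lutv := L2B Lu Ltv.
  rewrite innerBl// !innerBr// !innerZl// !innerZr// (innerC v u).
  by move=> h; apply: le_trans h _; rewrite le_eqVlt; apply/orP; left;
    apply/eqP; ring.
move: H (inner_ge0 u) (inner_ge0 v); set a := inner L u u.
set b := inner L u v; set c := inner L v v => H a0 c0.
have [c00|cn0] := eqVneq c 0; last first.
  have {}c0 : 0 < c by rewrite lt_def cn0.
  have := H (b / c).
  rewrite -(pmulr_lge0 _ c0).
  rewrite (_ : (a - _ + _) * c = a * c - b ^+ 2); first by rewrite subr_ge0.
  by field.
rewrite c00 mulr0; have [->|b0] := eqVneq b 0; first by rewrite expr0n.
have := H ((a + 1) / (2 * b)); rewrite c00 mulr0 addr0.
rewrite (_ : 2 * _ * b = a + 1); first by lra.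
by field.
Qed.

Lemma inner_norm_le u v e : L2 L u -> L2 L v -> (norm2 L v < e%:E)%E ->
  `|inner L u v| <= Num.sqrt (inner L u u) * e.
Proof.
move=> Lu Lv; rewrite norm2E// lte_fin => ve.
have := cauchy_schwarz Lu Lv; rewrite -ler_sqrt ?mulr_ge0 ?inner_ge0//.
rewrite sqrtr_sqr sqrtrM ?inner_ge0// => /le_trans; apply.
by rewrite ler_wpM2l ?sqrtr_ge0// ltW.
Qed.

(** Dominated convergence: [v] is integrable because the box has finite
    measure. *)
Lemma inner_cvg (G : nat -> 'rV[R]_d -> R) g C v : L2 L v ->
  (forall k, measurable_fun setT (G k)) -> measurable_fun setT g ->
  (forall k x, box L x -> `|G k x| <= C) ->
  (forall x, box L x -> G ^~ x @ \oo --> g x) ->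
  (fun k => inner L v (G k)) @ \oo --> inner L v g.
Proof.
move=> Lv mG mg GC Gg.
have C0 : 0 <= Num.max C 0 by rewrite le_max lexx orbT.
have mv := L2_measurable Lv.
have [//| | | | |ivg _ cv] :=
  @dominated_convergence _ _ _ (leb_box L) setT measurableT
  (fun k x => (v x * G k x)%:E) (fun x => (v x * g x)%:E)
  (fun x => `|(v x)%:E| * (Num.max C 0)%:E)%E.
- by move=> k; apply/measurable_EFinP; exact: measurable_funM.
- by apply/measurable_EFinP; exact: measurable_funM.
- apply: ae_in_box => x Lx _; apply: cvg_EFin; first exact: nearW.
  by apply: cvgMl_tmp; exact: Gg.
- by apply: integrableZr => //; apply: integrable_abse; exact: L2_integrable.
- apply: ae_in_box => x Lx n _; rewrite -EFinM lee_fin normrM ler_wpM2l//.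
  by rewrite le_max GC.
apply/fine_cvg; rewrite fineK//.
exact: integrable_fin_num.
Qed.

End square_integrable.

(** * Orthogonality of waves on an interval and at its midpoints *)

Section waves.
Context {R : realType}.
Implicit Types (p l t : R) (bc : boundary_condition).

(** The [i]-th eigenfunction, counted from 0, is
    cos (m pi t / l - p) with m = [freq bc i] and p = [phase bc i]; the sines
    are cosines with phase pi / 2, which treats the three boundary conditions
    at once. *)
Definition freq bc (i : nat) : nat :=
  match bc with
  | BiDirichlet => i.+1
  | BiNeumann => i
  | Periodic => if odd i then i.+1 else i
  end.

Definition phase bc (i : nat) : R :=
  match bc with
  | BiDirichlet => pi / 2
  | BiNeumann => 0
  | Periodic => if odd i then pi / 2 else 0
  end.

Definition wavenumber bc l i : R := (freq bc i)%:R * pi / l.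

Lemma eigfun1E bc l i t :
  eigfun1 bc l i.+1 t = cos (wavenumber bc l i * t - phase bc i).
Proof.
rewrite /eigfun1 /wavenumber /phase /freq; case: bc => /=.
- by rewrite cosBpihalf mulrAC.
- by rewrite subr0 mulrAC.
- case: (odd i) => /=; first by rewrite cosBpihalf mulrAC.
  by rewrite subr0 mulrAC.
Qed.

Lemma cos_mul (a b : R) : cos a * cos b = (cos (a - b) + cos (a + b)) / 2.
Proof. by rewrite cosB cosD; field. Qed.

(** The condition under which cos (m pi t / l - p) has zero mean over ]0,l[, and
    under which its samples at the midpoints have zero sum. Both the integral
    and the sum are multiples of sin (m pi - p) + sin p. *)
Definition balanced (m : nat) p := ~~ odd m \/ sin p = 0.

Lemma sin_natpi (m : nat) x : sin (m%:R * pi + x) = (-1) ^+ m * sin x :> R.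
Proof.
elim: m x => [|m IH] x; first by rewrite mul0r add0r expr0 mul1r.
rewrite -natr1 mulrDl mul1r -addrA IH (addrC pi) sinDpi exprSr; ring.
Qed.

Lemma balanced_sin m p : balanced m p -> sin (m%:R * pi - p) + sin p = 0.
Proof.
rewrite sin_natpi sinN -signr_odd => -[/negbTE ->|->].
  by rewrite expr0 mul1r addNr.
by rewrite oppr0 mulr0 addr0.
Qed.

Lemma Rintegral_FTC (F f : R -> R) (a b : R) : a < b ->
  (forall x : R, is_derive x (1 : R) F (f x)) -> continuous f ->
  \int[lebesgue_measure]_(t in `]a, b[) f t = F b - F a.
Proof.
move=> ab dF cf.
have cF : continuous F.
  by move=> x; apply/differentiable_continuous/derivable1_diffP; case: (dF x).
have iab : lebesgue_measure.-integrable `[a, b] (EFin \o f).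
  apply: continuous_compact_integrable; first exact: segment_compact.
  exact: continuous_subspaceT.
rewrite Rintegral_itv_bndo_bndc; last first.
  by apply: integrableS iab => //=; exact: subset_itv_oo_cc.
rewrite Rintegral_itv_obnd_cbnd; last first.
  by apply: integrableS iab => //=; exact: subset_itv_oc_cc.
rewrite /Rintegral (@continuous_FTC2 _ f F a b)//.
- exact: continuous_subspaceT.
- split => [x _| |]; first by case: (dF x).
  + exact/cvg_at_right_filter/cF.
  + exact/cvg_at_left_filter/cF.
- by move=> x _; rewrite derive1E; case: (dF x).
Qed.

Lemma is_derive_sinlin (k p t : R) :
  is_derive t 1 (fun t => sin (k * t - p)) (k * cos (k * t - p)).
Proof.
have : is_derive t 1 (fun t => k * t - p) k.
  by apply: is_derive_eq; rewrite subr0 scaler1.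
move=> h; have :=
  @is_derive1_comp _ sin (fun t => k * t - p) t _ _ (is_derive_sin _) h.
by move=> h'; apply: is_derive_eq; rewrite mulrC.
Qed.

Lemma is_derive_coslin (k p t : R) :
  is_derive t 1 (fun t => cos (k * t - p)) (- k * sin (k * t - p)).
Proof.
have : is_derive t 1 (fun t => k * t - p) k.
  by apply: is_derive_eq; rewrite subr0 scaler1.
move=> h; have :=
  @is_derive1_comp _ cos (fun t => k * t - p) t _ _ (is_derive_cos _) h.
by move=> h'; apply: is_derive_eq; rewrite mulNr mulrC mulNr mulrC.
Qed.

Lemma continuous_coslin (k p : R) : continuous (fun t : R => cos (k * t - p)).
Proof.
move=> t; apply/differentiable_continuous/derivable1_diffP.
by case: (is_derive_coslin k p t).
Qed.

Lemma continuous_sinlin (k p : R) : continuous (fun t : R => sin (k * t - p)).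
Proof.
move=> t; apply/differentiable_continuous/derivable1_diffP.
by case: (is_derive_sinlin k p t).
Qed.

Lemma Rintegral_cos (k p a b : R) : k != 0 -> a < b ->
  \int[lebesgue_measure]_(t in `]a, b[) cos (k * t - p) =
  (sin (k * b - p) - sin (k * a - p)) / k.
Proof.
move=> k0 ab.
have dF (x : R) : is_derive x (1 : R) (fun t => k^-1 * sin (k * t - p))
  (cos (k * x - p)).
  have h := is_derive_sinlin k p x.
  apply: is_derive_eq; rewrite -[_ *: _]/(k^-1 * (k * cos (k * x - p))).
  by rewrite mulrA mulVf// mul1r.
by rewrite (Rintegral_FTC ab dF (@continuous_coslin k p)) -mulrBr mulrC.
Qed.

Lemma Rintegral_cst_itv (a b c : R) : a < b ->
  \int[lebesgue_measure]_(t in `]a, b[) c = c * (b - a).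
Proof.
move=> ab; rewrite Rintegral_cst//= lebesgue_measure_itv/= lte_fin ab.
by rewrite -EFinB.
Qed.

Lemma Rintegral_cos_period (m : nat) p l : 0 < l -> (0 < m)%N -> balanced m p ->
  \int[lebesgue_measure]_(t in `]0, l[) cos (m%:R * pi / l * t - p) = 0.
Proof.
move=> l0 m0 mp; rewrite Rintegral_cos//; last first.
  by rewrite !mulf_neq0// ?invr_neq0 ?gt_eqF ?pi_gt0 ?ltr0n.
rewrite mulfVK ?gt_eqF// mulr0 sub0r sinN opprK balanced_sin//.
by rewrite mul0r.
Qed.

Lemma itv_bounded_continuous l (f : R -> R) C : continuous f ->
  (forall t, `|f t| <= C) ->
  itv_bounded l f.
Proof.
by move=> cf fC; split; [exact: continuous_measurable_fun|exists C].
Qed.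

Lemma itv_bounded_coslin l (k p : R) : itv_bounded l (fun t => cos (k * t - p)).
Proof.
apply: (@itv_bounded_continuous _ _ 1); first exact: continuous_coslin.
by move=> t; exact: cos_max.
Qed.

Lemma Rintegral_cosM l (k k' p p' : R) :
  \int[lebesgue_measure]_(t in `]0, l[) (cos (k * t - p) * cos (k' * t - p')) =
  (\int[lebesgue_measure]_(t in `]0, l[) cos ((k - k') * t - (p - p')) +
   \int[lebesgue_measure]_(t in `]0, l[) cos ((k + k') * t - (p + p'))) / 2.
Proof.
rewrite -RintegralD//; try exact/itv_bounded_integrable/itv_bounded_coslin.
rewrite -RintegralZr//; last first.
  by apply/itv_bounded_integrable/itv_boundedD; exact: itv_bounded_coslin.
apply: eq_Rintegral => t _; rewrite cos_mul; congr ((cos _ + cos _) / 2); ring.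
Qed.

Lemma freq_le bc i : (freq bc i <= i.+1)%N.
Proof. by rewrite /freq; case: bc => //; case: odd. Qed.

Lemma freq_ge bc i : (i <= freq bc i)%N.
Proof. by rewrite /freq; case: bc => //; case: odd. Qed.

Lemma freq_homo bc : {homo freq bc : i j / (i <= j)%N}.
Proof.
move=> i j; rewrite leq_eqVlt => /predU1P[->//|ij].
exact: leq_trans (freq_le _ _) (leq_trans ij (freq_ge _ _)).
Qed.

Lemma freq_phase0 bc i : freq bc i = 0%N -> phase bc i = 0.
Proof. by rewrite /freq /phase; case: bc => //; case: odd. Qed.

Lemma odd_freq_periodic i : odd (freq Periodic i) = false.
Proof. by rewrite /freq; case: ifPn => [/= -> | /negbTE]. Qed.

Lemma balanced_add bc i k :
  balanced (freq bc i + freq bc k) (phase bc i + phase bc k).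
Proof.
case: bc; [right|right|left].
- by rewrite /phase -splitr sinpi.
- by rewrite addr0 sin0.
- by rewrite oddD !odd_freq_periodic.
Qed.

Lemma balanced_sub bc i k : (freq bc i <= freq bc k)%N ->
  balanced (freq bc k - freq bc i) (phase bc k - phase bc i).
Proof.
move=> ik; move: ik; case: bc => ik; [right|right|left].
- by rewrite subrr sin0.
- by rewrite subr0 sin0.
- by rewrite oddB// !odd_freq_periodic.
Qed.

Lemma freq_eq_phase bc i k : i <> k -> freq bc i = freq bc k ->
  cos (phase bc k - phase bc i) = 0.
Proof.
rewrite /freq /phase; case: bc => [ik [/ik]//|ik /ik//|ik].
case: ifPn => oi; case: ifPn => ok.
- by move=> [/ik].
- by rewrite sub0r cosN cos_pihalf.
- by rewrite subr0 cos_pihalf.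
- by move=> /ik.
Qed.

Lemma freq_max bc i M : (i < M)%N -> freq bc i = M -> phase bc i = pi / 2.
Proof.
rewrite /freq /phase; case: bc => // iM.
  by move=> iM'; rewrite iM' ltnn in iM.
by case: ifPn => // _ iM'; rewrite iM' ltnn in iM.
Qed.

Lemma freq_add_gt0 bc i k : i <> k -> (0 < freq bc i + freq bc k)%N.
Proof.
move=> ik; rewrite lt0n addn_eq0; apply/negP => /andP[/eqP a /eqP b].
have := freq_ge bc i; have := freq_ge bc k; rewrite a b !leqn0 =>
  /eqP kk /eqP ii.
by apply: ik; rewrite kk ii.
Qed.

(** Two distinct indices below [M] cannot both reach the Nyquist frequency [M],
    so their sum stays below the aliasing frequency 2 M. *)
Lemma freq_add_lt bc i k M : i <> k -> (i < M)%N -> (k < M)%N ->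
  (freq bc i + freq bc k < M + M)%N.
Proof.
move=> ik iM kM.
have fi : (freq bc i <= M)%N := leq_trans (freq_le _ _) iM.
have fk : (freq bc k <= M)%N := leq_trans (freq_le _ _) kM.
rewrite ltn_neqAle leq_add// andbT; apply/eqP => h.
have ei : freq bc i = M by lia.
have ek : freq bc k = M by lia.
have := freq_eq_phase ik (etrans ei (esym ek)).
rewrite (freq_max iM ei) (freq_max kM ek) subrr cos0 => /eqP.
by rewrite oner_eq0.
Qed.

(** The product of two waves is the half-sum of the waves at the difference and
    at the sum of the frequencies, both balanced. *)
Lemma eig_orth bc l i k : 0 < l -> i <> k ->
  \int[lebesgue_measure]_(t in `]0, l[)
    (eigfun1 bc l i.+1 t * eigfun1 bc l k.+1 t) = 0.
Proof.
move=> l0; wlog ik : i k / (freq bc i <= freq bc k)%N.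
  move=> H ik; case: (leqP (freq bc i) (freq bc k)) => h; first exact: H.
  under eq_Rintegral do rewrite mulrC.
  by apply: H; [exact: ltnW|exact: nesym].
move=> nik; under eq_Rintegral do rewrite !eigfun1E mulrC.
rewrite Rintegral_cosM /wavenumber -!mulrBl -!mulrDl -natrB// -natrD.
rewrite (Rintegral_cos_period l0 _ (balanced_add _ _ _)) ?freq_add_gt0//;
  last exact: nesym.
rewrite addr0; case: (posnP (freq bc k - freq bc i)) => [e|e]; last first.
  by rewrite (Rintegral_cos_period l0 e (balanced_sub ik)) mul0r.
rewrite e; under eq_Rintegral do rewrite !mul0r sub0r cosN.
rewrite Rintegral_cst_itv// (freq_eq_phase nik) ?mul0r//.
by apply/eqP; rewrite eqn_leq ik -subn_eq0 e.
Qed.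

Lemma eig_norm_bounds bc l i : 0 < l ->
  0 < \int[lebesgue_measure]_(t in `]0, l[)
    (eigfun1 bc l i.+1 t * eigfun1 bc l i.+1 t) <= l.
Proof.
move=> l0; under eq_Rintegral do rewrite !eigfun1E.
rewrite Rintegral_cosM !subrr; under eq_Rintegral do rewrite mul0r subr0 cos0.
rewrite Rintegral_cst_itv// mul1r subr0 /wavenumber -!mulrDl -natrD.
case: (posnP (freq bc i)) => [e|e]; last first.
  by rewrite (Rintegral_cos_period l0 _ (balanced_add _ _ _)) ?addn_gt0
    ?e// addr0; lra.
rewrite e (freq_phase0 e); under eq_Rintegral do rewrite !mul0r addr0 subr0
  cos0.
by rewrite Rintegral_cst_itv//; lra.
Qed.

(** Multiplying by 2 sin (m pi / (2 M)), which is nonzero since 0 < m < 2 M,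
    makes the sum telescope to sin (m pi - p) + sin p. *)
Lemma sum_cos_mid (m M : nat) p : (0 < M)%N -> (0 < m < M + M)%N ->
  balanced m p ->
  \sum_(j < M) cos (m%:R * pi * (2 * j%:R + 1) / (2 * M%:R) - p) = 0 :> R.
Proof.
move=> M0 /andP[m0 mM] mp.
have M0' : (0 : R) < M%:R by rewrite ltr0n.
pose s : R := m%:R * pi / (2 * M%:R).
have s0 : 2 * sin s != 0.
  rewrite mulf_neq0// gt_eqF// sin_gt0_pi//; apply/andP; split.
    by rewrite divr_gt0 ?mulr_gt0 ?pi_gt0 ?ltr0n.
  rewrite /s ltr_pdivrMr ?mulr_gt0// (mulrC pi) ltr_pM2r ?pi_gt0//.
  by rewrite -natrM ltr_nat mul2n -addnn.
apply/(mulfI s0); rewrite mulr0 mulr_sumr.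
pose g (j : nat) : R := sin (m%:R * pi / M%:R * j%:R - p).
have mM' : M%:R != 0 :> R by rewrite gt_eqF.
transitivity (\sum_(j < M) (g j.+1 - g j)).
  apply: eq_bigr => j _; rewrite /g.
  have -> : m%:R * pi / M%:R * j.+1%:R - p =
      (m%:R * pi * (2 * j%:R + 1) / (2 * M%:R) - p) + s.
    by rewrite /s -natr1; field.
  have -> : m%:R * pi / M%:R * j%:R - p =
      (m%:R * pi * (2 * j%:R + 1) / (2 * M%:R) - p) - s.
    by rewrite /s; field.
  by rewrite (sinD _ s) (sinB _ s); ring.
rewrite -(big_mkord xpredT (fun j => g j.+1 - g j)) telescope_sumr//.
by rewrite /g mulfVK// mulr0 sub0r sinN opprK balanced_sin.
Qed.

(** The [i]-th eigenfunction at the centre of the [j]-th actuator. *)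
Definition eig_midpoint bc (M i j : nat) : R :=
  cos ((freq bc i)%:R * pi * (2 * j%:R + 1) / (2 * M%:R) - phase bc i).

Lemma sum_eig_midpoint bc M i k : (freq bc i <= freq bc k)%N ->
  \sum_(j < M) (eig_midpoint bc M i j * eig_midpoint bc M k j) =
  (\sum_(j < M)
     cos ((freq bc k - freq bc i)%:R * pi * (2 * j%:R + 1) / (2 * M%:R)
       - (phase bc k - phase bc i))
   + \sum_(j < M)
     cos ((freq bc k + freq bc i)%:R * pi * (2 * j%:R + 1) / (2 * M%:R)
       - (phase bc k + phase bc i))) / 2.
Proof.
move=> ik; rewrite -big_split mulr_suml; apply: eq_bigr => j _.
rewrite mulrC cos_mul natrB// natrD; congr ((cos _ + cos _) / 2); ring.
Qed.

Lemma eig_midpoint_orth bc (M : nat) (i k : nat) : (i < M)%N -> (k < M)%N ->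
  i <> k ->
  \sum_(j < M) (eig_midpoint bc M i j * eig_midpoint bc M k j) = 0.
Proof.
wlog ik : i k / (freq bc i <= freq bc k)%N.
  move=> H iM kM ik; case: (leqP (freq bc i) (freq bc k)) => h; first exact: H.
  under eq_bigr do rewrite mulrC.
  by apply: H => //; [exact: ltnW|exact: nesym].
move=> iM kM nik; have M0 : (0 < M)%N by exact: leq_ltn_trans iM.
rewrite sum_eig_midpoint// (sum_cos_mid _ _ (balanced_add _ _ _))//; last first.
  by rewrite addnC freq_add_gt0//= freq_add_lt.
rewrite addr0; case: (posnP (freq bc k - freq bc i)) => [e|e]; last first.
  rewrite (sum_cos_mid M0 _ (balanced_sub ik)) ?mul0r// e/=.
  have := @freq_add_lt bc _ _ _ nik iM kM; apply: leq_ltn_trans.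
  by rewrite (leq_trans (leq_subr _ _))// leq_addl.
have ee : freq bc i = freq bc k by apply/eqP; rewrite eqn_leq ik -subn_eq0 e.
by rewrite big1 ?mul0r// => j _; rewrite e !mul0r sub0r cosN freq_eq_phase.
Qed.

(** The wave at twice the frequency has sum 0, except when it is constant: at
    frequency 0, or at the Nyquist frequency, where aliasing makes it equal to
    1 at every midpoint. In these cases the sum is even twice as large. *)
Lemma eig_midpoint_norm bc (M : nat) (i : nat) : (i < M)%N ->
  M%:R / 2 <= \sum_(j < M) (eig_midpoint bc M i j * eig_midpoint bc M i j).
Proof.
move=> iM; have M0 : (0 < M)%N by exact: leq_ltn_trans iM.
have M0' : (0 : R) < M%:R by rewrite ltr0n.
rewrite sum_eig_midpoint// subnn subrr ler_pM2r//.
under eq_bigr do rewrite !mul0r subr0 cos0.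
rewrite sumr_const card_ord lerDl.
case: (posnP (freq bc i)) => [e|e].
  rewrite e (freq_phase0 e); apply: sumr_ge0 => j _.
  by rewrite !mul0r addr0 subr0 cos0.
have := leq_trans (freq_le bc i) iM; rewrite leq_eqVlt => /predU1P[f|f].
  rewrite f (freq_max iM f); apply: sumr_ge0 => j _.
  have -> : (M + M)%:R * pi * (2 * j%:R + 1) / (2 * M%:R) - (pi / 2 + pi / 2) =
     (pi *+ 2) *+ j :> R.
    by rewrite natrD -mulr_natr -(mulr_natr pi); field; rewrite gt_eqF.
  by rewrite -[_ *+ j]add0r (periodicn (@cosD2pi R)) cos0.
rewrite (sum_cos_mid M0 _ (balanced_add _ _ _))//.
by rewrite addn_gt0 e/=; lia.
Qed.

(** The factor by which integration over an actuator multiplies the value of the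
    [i]-th eigenfunction at its centre. *)
Definition attenuation1 bc l r (M i : nat) : R :=
  if freq bc i == 0%N then r * l / M%:R
  else 2 * sin (wavenumber bc l i * (r * l / (2 * M%:R))) / wavenumber bc l i.

Lemma Rintegral_actuator bc l r (M i j : nat) : 0 < l -> (0 < M)%N -> 0 < r ->
  let c := (2 * j.+1%:R - 1) * l / (2 * M%:R) in
  let h := r * l / (2 * M%:R) in
  \int[lebesgue_measure]_(t in `]c - h, c + h[) eigfun1 bc l i.+1 t =
  attenuation1 bc l r M i * eig_midpoint bc M i j.
Proof.
move=> l0 M0 r0 c h.
have M0' : (0 : R) < M%:R by rewrite ltr0n.
have h0 : 0 < h by rewrite divr_gt0 ?mulr_gt0.
have ch : c - h < c + h by lra.
under eq_Rintegral do rewrite eigfun1E.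
have kc : wavenumber bc l i * c - phase bc i =
    (freq bc i)%:R * pi * (2 * j%:R + 1) / (2 * M%:R) - phase bc i.
  rewrite /wavenumber /c -natr1; congr (_ - _); field.
  by rewrite !gt_eqF.
rewrite /attenuation1 /eig_midpoint -kc; case: eqP => [e|/eqP e].
  rewrite /wavenumber e; under eq_Rintegral do rewrite !mul0r sub0r cosN.
  rewrite Rintegral_cst_itv// !mul0r sub0r cosN mulrC; congr (_ * _).
  by rewrite /h; field; rewrite gt_eqF.
have k0 : wavenumber bc l i != 0.
  by rewrite /wavenumber !mulf_neq0 ?pnatr_eq0// ?invr_neq0 ?gt_eqF ?pi_gt0.
rewrite Rintegral_cos// !(mulrDr, mulrBr).
rewrite [X in sin X - _](_ : _ = (wavenumber bc l i * c - phase bc i) +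
  wavenumber bc l i * h); last by ring.
rewrite [X in _ - sin X](_ : _ = (wavenumber bc l i * c - phase bc i) -
  wavenumber bc l i * h); last by ring.
rewrite -/h; move: (_ - phase bc i) => X; rewrite sinD sinB; by field.
Qed.

(** By the mean value theorem sin x = x cos z for some z in ]0,x[, and cos is
    decreasing. *)
Lemma sin_ge_lin (x y : R) : 0 <= x <= y -> y <= pi -> x * cos y <= sin x.
Proof.
move=> /andP[x0 xy] ypi.
have [->|xn0] := eqVneq x 0; first by rewrite mul0r sin0.
have {x0} x0 : 0 < x by rewrite lt_def xn0.
have [|z zI] := @MVT _ sin cos 0 x x0 (fun z _ => is_derive_sin z).
  by apply: continuous_subspaceT; exact: continuous_sin.
rewrite sin0 !subr0 => ->; rewrite mulrC ler_pM2r//.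
move: zI; rewrite in_itv /= => /andP[z0 zx].
rewrite le_eqVlt; apply/orP; right.
by rewrite ltr_cos ?in_itv/=; [lra|apply/andP; split; lra|apply/andP; split;
  lra].
Qed.

(** The half-width of an actuator times the wavenumber is at most pi r / 2, so
    the sinc factor is at least cos (pi r / 2), which is positive as r < 1. *)
Lemma attenuation1_ge bc l r (M i : nat) : 0 < l -> (i < M)%N -> 0 < r < 1 ->
  cos (pi * r / 2) * (r * l / M%:R) <= attenuation1 bc l r M i.
Proof.
move=> l0 iM /andP[r0 r1]; have M0 : (0 < M)%N by exact: leq_ltn_trans iM.
have M0' : (0 : R) < M%:R by rewrite ltr0n.
rewrite /attenuation1; case: eqP => [e|/eqP e].
  rewrite ler_piMl ?cos_le1// ltW// divr_gt0// mulr_gt0//.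
have k0 : 0 < wavenumber bc l i.
  by rewrite /wavenumber divr_gt0// mulr_gt0 ?pi_gt0// ltr0n lt0n.
rewrite ler_pdivlMr//.
set x := wavenumber bc l i * _.
have -> : cos (pi * r / 2) * (r * l / M%:R) * wavenumber bc l i =
   2 * (x * cos (pi * r / 2)).
  by rewrite /x; field; rewrite gt_eqF.
rewrite ler_pM2l// sin_ge_lin//.
  apply/andP; split; first by rewrite ltW// mulr_gt0// divr_gt0 ?mulr_gt0.
  rewrite /x /wavenumber.
  rewrite (_ : _ * _ = (pi * r / 2) * ((freq bc i)%:R / M%:R)); last first.
    by field; rewrite !gt_eqF.
  apply: ler_piMr; first by rewrite ltW// divr_gt0 ?mulr_gt0 ?pi_gt0.
  by rewrite ler_pdivrMr// mul1r ler_nat (leq_trans (freq_le _ _)).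
by have := pi_gt0 R => ?; nra.
Qed.

End waves.

(** * Integration by parts on a box *)

Section integration_by_parts.
Context {R : realType} (d : nat).
Implicit Types (L : 'I_d -> R) (F G : 'rV[R]_d -> R).

Lemma set_coordD (x : 'rV[R]_d) (n : 'I_d) (s t : R) :
  set_coord x n (s + t) = s *: delta_mx ord0 n + set_coord x n t.
Proof.
apply/rowP => m; rewrite !mxE /=; case: eqP => _;
  rewrite ?mulr1 ?mulr0 ?add0r//.
Qed.

Lemma set_coord_id (x : 'rV[R]_d) n : set_coord x n (x ord0 n) = x.
Proof. by apply/rowP => m; rewrite mxE; case: eqP => [->|]. Qed.

(** Difference quotients in the direction [n] are those of the restriction to a
    line, so partial derivatives reduce to one-variable ones. *)
Lemma quotient_set_coord F (x : 'rV[R]_d) n (t : R) :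
  (fun h : R => h^-1 *: (F (h *: delta_mx ord0 n + set_coord x n t)
    - F (set_coord x n t))) =
  (fun h : R => h^-1 *: (F (set_coord x n (h *: (1 : R) + t))
    - F (set_coord x n t))).
Proof. by apply/funext => h; rewrite -set_coordD /GRing.scale /= mulr1. Qed.

Lemma is_derive_set_coord F (x : 'rV[R]_d) n (t : R) :
  derivable F (set_coord x n t) (delta_mx ord0 n) ->
  is_derive t (1 : R) (fun s => F (set_coord x n s))
    (partial n F (set_coord x n t)).
Proof.
move=> dF; apply: DeriveDef.
  by move: dF; rewrite /derivable quotient_set_coord.
by rewrite /partial /derive quotient_set_coord.
Qed.

Lemma partial_set_coord F (x : 'rV[R]_d) n (c : R) :
  is_derive (x ord0 n) (1 : R) (fun s => F (set_coord x n s)) c ->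
  derivable F x (delta_mx ord0 n) /\ partial n F x = c.
Proof.
move=> [dF Fc]; split.
  by move: dF; rewrite /derivable -quotient_set_coord set_coord_id.
by rewrite -Fc /partial /derive -quotient_set_coord set_coord_id.
Qed.

Lemma continuous_set_coord (x : 'rV[R]_d) n :
  continuous (fun t : R => set_coord x n t).
Proof.
move=> t; apply/cvg_ballP => e e0.
have H : \forall s \near t, ball t e s by exact: nbhsx_ballx.
apply: filterS H => s ts; split => // i m; rewrite !mxE; case: eqP => // _.
exact: ballxx.
Qed.

Lemma continuous_box_bounded L F : continuous F -> box_bounded L F.
Proof.
move=> cF; split; first exact: continuous_measurable_rV.
pose K := [set x : 'rV[R]_d | forall n, [set` `[0, L n]%R] (x ord0 n)].
have cK : compact K.
  apply: (@rV_compact _ _ (fun n => [set` `[0, L n]%R])) => n.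
  exact: segment_compact.
have : compact (F @` K).
  by apply: continuous_compact => //; exact: continuous_subspaceT.
move=> /compact_bounded[M [_ MP]]; exists (M + 1) => x Lx.
apply: (MP (M + 1)); first by rewrite ltrDl.
exists x => // n; have := Lx n; rewrite /= !in_itv /= =>
  /andP[/ltW -> /ltW ->//].
Qed.

(** The fundamental theorem of calculus on each segment parallel to the axis
    [n]. *)
Lemma Rintegral_partial0 L F n : 0 < L n -> C1 F ->
  (forall x, box L x -> F (set_coord x n (L n)) = F (set_coord x n 0)) ->
  \int[leb_box L]_x partial n F x = 0.
Proof.
move=> Ln [cF dF] F0; have [dFn cFn] := dF n.
apply: (@Rintegral_slice0 _ _ L n); first exact: continuous_box_bounded.
move=> x Lx.
have dd (t : R) : is_derive t (1 : R) (fun s => F (set_coord x n s))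
  (partial n F (set_coord x n t)).
  by apply: is_derive_set_coord; exact: dFn.
rewrite (Rintegral_FTC Ln dd) ?F0 ?subrr// => t.
apply: (@continuous_comp _ _ _ (fun s => set_coord x n s) (partial n F)).
  exact: continuous_set_coord.
exact: cFn.
Qed.

Lemma C1M F G : C1 F -> C1 G -> C1 (F \* G) /\
  forall n, partial n (F \* G) =
    (fun x => F x * partial n G x + G x * partial n F x).
Proof.
move=> [cF dF] [cG dG].
have pE n : partial n (F \* G) = (fun x => F x * partial n G x + G x
  * partial n F x).
  apply/funext => x; rewrite /partial.
  by rewrite (@deriveM _ _ F G); [|exact: (dF n).1|exact: (dG n).1].
split => //; split => [x|n]; first by apply: continuousM; [exact: cF|exact: cG].
split => [x|].
  by apply: (@derivableM _ _ F G); [exact: (dF n).1|exact: (dG n).1].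
rewrite pE => x.
have h1 : {for x, continuous (F \* partial n G)}.
  by apply: continuousM; [exact: cF|exact: (dG n).2].
have h2 : {for x, continuous (G \* partial n F)}.
  by apply: continuousM; [exact: cG|exact: (dF n).2].
exact: (cvgD h1 h2).
Qed.

(** The boundary terms on the two faces orthogonal to the axis [n] need only
    cancel; both compact support and periodicity ensure this. *)
Lemma inner_parts L F G n : 0 < L n -> C1 F -> C1 G ->
  (forall x, box L x -> F (set_coord x n (L n)) * G (set_coord x n (L n)) =
                        F (set_coord x n 0) * G (set_coord x n 0)) ->
  inner L F (partial n G) = - inner L (partial n F) G.
Proof.
move=> Ln CF CG FG0; have [CFG pE] := C1M CF CG.
have := Rintegral_partial0 Ln CFG FG0; rewrite pE.
have bF := continuous_box_bounded L CF.1; have bG :=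
  continuous_box_bounded L CG.1.
have bdF := continuous_box_bounded L (CF.2 n).2; have bdG :=
  continuous_box_bounded L (CG.2 n).2.
rewrite RintegralD//; try by apply: box_bounded_integrable; exact: box_boundedM.
move/eqP; rewrite addr_eq0 => /eqP; rewrite -[LHS]/(inner L F (partial n G)) =>
  ->.
by rewrite -[X in - X = _]/(inner L G (partial n F)) innerC.
Qed.

Definition C1_pair (f f' : R -> R) :=
  (forall t : R, is_derive t (1 : R) f (f' t)) /\ continuous f'.

Lemma C1_pair_continuous f f' : C1_pair f f' -> continuous f.
Proof.
move=> [df _] t; apply/differentiable_continuous/derivable1_diffP.
by case: (df t).
Qed.

Lemma cvg_prod (T I : Type) (F : set_system T) {FF : Filter F} (s : seq I)
    (u : I -> T -> R) (a : I -> R) :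
  (forall i, u i @ F --> a i) ->
  (fun k => \prod_(i <- s) u i k) @ F --> \prod_(i <- s) a i.
Proof.
move=> ua; elim: s => [|i s IH].
  rewrite big_nil (_ : (fun k => _) = cst 1); first exact: cvg_cst.
  by apply/funext => k; rewrite big_nil.
rewrite big_cons (_ : (fun k => _) = (fun k => u i k * \prod_(j <- s) u j k)).
  by apply: cvgM.
by apply/funext => k; rewrite big_cons.
Qed.

Lemma continuous_tensor (f : 'I_d -> R -> R) : (forall n, continuous (f n)) ->
  continuous (tensor f).
Proof.
move=> cf x; apply: (@cvg_prod _ _ (nbhs x)) => n.
have cn : {for x, continuous (f n \o (fun y : 'rV[R]_d => y ord0 n))}.
  by apply: continuous_comp; [exact: coord_continuous|exact: cf].
exact: cn.
Qed.

Definition dtensor (f f' : 'I_d -> R -> R) (n : 'I_d) : 'rV[R]_d -> R :=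
  tensor (fun m => if m == n then f' m else f m).

Lemma partial_tensor (f f' : 'I_d -> R -> R) n (x : 'rV[R]_d) :
  (forall t : R, is_derive t (1 : R) (f n) (f' n t)) ->
  derivable (tensor f) x (delta_mx ord0 n) /\ partial n (tensor f) x =
    dtensor f f' n x.
Proof.
move=> df; apply: partial_set_coord.
pose c := \prod_(m < d | m != n) f m (x ord0 m).
rewrite (_ : (fun s => _) = (fun s => c * f n s)).
  have h := df (x ord0 n).
  apply: is_derive_eq; rewrite /dtensor /tensor (bigD1 n)//= eqxx mulrC;
    congr (_ * _).
  by apply: eq_bigr => m /negbTE ->.
apply/funext => s; rewrite /tensor (bigD1 n)//= mxE eqxx mulrC; congr (_ * _).
by apply: eq_bigr => m /negbTE mn; rewrite mxE mn.
Qed.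

Lemma C1_tensor (f f' : 'I_d -> R -> R) : (forall n, C1_pair (f n) (f' n)) ->
  C1 (tensor f) /\ forall n, partial n (tensor f) = dtensor f f' n.
Proof.
move=> Cf.
have pE n : partial n (tensor f) = dtensor f f' n.
  by apply/funext => x; have [_ ->] := partial_tensor x (Cf n).1.
split => //; split; first by apply: continuous_tensor => n;
  exact: C1_pair_continuous (Cf n).
move=> n; split => [x|]; first by have [] := partial_tensor x (Cf n).1.
rewrite pE; apply: continuous_tensor => m; case: eqP => _;
  first exact: (Cf m).2.
exact: C1_pair_continuous (Cf m).
Qed.

End integration_by_parts.

(** * Cutoffs with compact support *)

Section cutoffs.
Context {R : realType}.
Implicit Types (l t z : R).

Lemma is_derive_max0sq (z : R) :
  is_derive z (1 : R) (fun z => Num.max z 0 ^+ 2) (2 * Num.max z 0).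
Proof.
have [z0|z0|->] : [\/ z < 0, 0 < z | z = 0].
  by case: (ltgtP z 0) => H; [constructor 1|constructor 2|constructor 3].
- have h : is_derive z (1 : R) (cst 0 : R -> R) 0 by exact: is_derive_cst.
  apply: (@near_eq_is_derive _ _ _ (cst 0)) => //; last first.
    by rewrite max_r ?ltW// mulr0.
  have H : \forall y \near z, y < 0 by exact: lt_nbhsl.
  by apply: filterS H => y y0; rewrite max_r ?expr0n// ltW.
- have h : is_derive z (1 : R) (fun z => z ^+ 2 : R) (2 * z).
    by apply: is_derive_eq; rewrite /GRing.scale /= mulr1 mulr_natl mulr2n.
  apply: (@near_eq_is_derive _ _ _ (fun z => z ^+ 2)) => //.
    have H : \forall y \near z, 0 < y by exact: lt_nbhsr.
    by apply: filterS H => y y0; rewrite max_l// ltW.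
  by rewrite max_l// ltW.
- rewrite maxxx mulr0.
  have H : h^-1 *: ((fun z => Num.max z 0 ^+ 2) (h *: (1 : R) + 0) -
      (fun z => Num.max z 0 ^+ 2) (0 : R)) @[h --> (0 : R)^'] --> (0 : R).
    apply: (@squeeze_cvgr _ _ _ _ (fun h : R => - `|h|) (fun h => `|h|)).
    + apply: nearW => h; rewrite /GRing.scale /= mulr1 addr0 maxxx expr0n subr0.
      rewrite -ler_norml normrM; have [h0|h0] := ltP h 0.
        by rewrite expr0n normr0 mulr0.
      have [->|hn] := eqVneq h 0; first by rewrite invr0 normr0 mul0r.
      by rewrite normrX expr2 mulrA -normrM mulVf// normr1 mul1r.
    + rewrite -[X in _ --> X]oppr0; apply: cvgN.
      rewrite -[X in _ --> X](normr0 R); apply: cvg_norm; exact: nbhs_dnbhs.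
    + rewrite -[X in _ --> X](normr0 R); apply: cvg_norm; exact: nbhs_dnbhs.
  apply: DeriveDef; first by apply/cvg_ex; exists 0.
  exact: cvg_lim H.
Qed.

(** A C^1 step from 0, for z <= 1, to 1 at infinity. It is written
    1 - 1 / (1 + m^2) with m = max (z - 1) 0 so that z bump'(z) is at most
    4 (1 - bump z), which tends to 0. *)
Definition bump z : R := 1 - (1 + Num.max (z - 1) 0 ^+ 2)^-1.
Definition dbump z : R :=
  2 * Num.max (z - 1) 0 / (1 + Num.max (z - 1) 0 ^+ 2) ^+ 2.

Let den_gt0 z : 0 < 1 + Num.max (z - 1) 0 ^+ 2 :> R.
Proof. by rewrite ltr_pwDl// sqr_ge0. Qed.

Lemma C1_pair_bump : C1_pair bump dbump.
Proof.
split=> [z|].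
  have h1 : is_derive z (1 : R) (fun z => z - 1 : R) 1.
    by apply: is_derive_eq; rewrite subr0.
  have h2 : is_derive z (1 : R) (fun z => Num.max (z - 1) 0 ^+ 2 : R)
      (2 * Num.max (z - 1) 0).
    rewrite -[X in is_derive _ _ _ X]mulr1.
    exact: (@is_derive1_comp _ (fun z => Num.max z 0 ^+ 2) (fun z =>
      z - 1 : R) z _ _
      (is_derive_max0sq _) h1).
  have h3 : is_derive z (1 : R) (fun z => 1 + Num.max (z - 1) 0 ^+ 2 : R)
    (2 * Num.max (z - 1) 0).
    by apply: is_derive_eq; rewrite add0r mul1r.
  have n0 : 1 + Num.max (z - 1) 0 ^+ 2 != 0 by rewrite gt_eqF.
  have h4 := @realfun.is_deriveV _ (fun z => 1 + Num.max (z - 1) 0 ^+ 2 : R) z _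
    1 n0 h3.
  apply: is_derive_eq; rewrite add0r mul1r /dbump /GRing.scale /=.
  by rewrite mulNr opprK mulrC.
have cm : continuous (fun z => Num.max (z - 1) 0 : R).
  rewrite (_ : (fun z => _) = (fun z => (z - 1 + 0 + `|z - 1 - 0|) / 2));
    last first.
    by apply/funext => z; rewrite maxr_absE.
  move=> z; apply: cvgM; last exact: cvg_cst.
  have h : (fun z => z - 1 : R) @ z --> z - 1.
    by apply: cvgB; [exact: cvg_id|exact: cvg_cst].
  apply: cvgD; first by apply: cvgD; [exact: h|exact: cvg_cst].
  by apply: cvg_norm; apply: cvgB; [exact: h|exact: cvg_cst].
move=> z; apply: cvgM; first by apply: cvgM; [exact: cvg_cst|exact: cm].
apply: cvgV; first by rewrite gt_eqF// exprn_gt0.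
by rewrite !expr2; do ?[apply: cvgM|apply: cvgD|exact: cvg_cst|exact: cm].
Qed.

Lemma bump0 z : z <= 1 -> bump z = 0.
Proof.
by move=> z1; rewrite /bump max_r ?subr_le0// expr0n addr0 invr1 subrr.
Qed.

Lemma bump_ge0le1 z : 0 <= bump z <= 1.
Proof.
apply/andP; split; last by rewrite gerBl invr_ge0 ltW.
by rewrite subr_ge0 invf_le1// lerDl sqr_ge0.
Qed.

(** With z = m + 1, this is 2 m (m + 1) <= 4 (1 + m^2). *)
Lemma dbump_le z : 1 < z -> `|z * dbump z| <= 4 * (1 - bump z).
Proof.
move=> z1; rewrite /dbump /bump opprB addrCA subrr addr0 max_l; last lra.
set m := z - 1; have m0 : 0 < m by rewrite subr_gt0.
have -> : z = m + 1 by rewrite /m subrK.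
have d0 : 0 < 1 + m ^+ 2 by rewrite ltr_pwDl// sqr_ge0.
rewrite ger0_norm; last first.
  by apply: mulr_ge0; [lra|apply: divr_ge0; [lra|exact: sqr_ge0]].
rewrite -subr_ge0 (_ : _ - _ = (4 * (1 + m ^+ 2) - 2 * m * (m + 1)) / (1
  + m ^+ 2) ^+ 2).
  by rewrite divr_ge0 ?sqr_ge0//; have := sqr_ge0 (m - 1); nra.
by field; rewrite gt_eqF.
Qed.

Lemma dbump0 z : z <= 1 -> dbump z = 0.
Proof. by move=> z1; rewrite /dbump max_r ?subr_le0// mulr0 mul0r. Qed.

Lemma bump_cvg1 y : 0 < y -> (fun k : nat => bump (k%:R * y)) @ \oo --> (1 : R).
Proof.
move=> y0; apply/cvgrPdist_le => e e0.
have H : \forall k \near \oo, (2 + e^-1) / y <= k%:R by exact: nbhs_infty_ger.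
apply: filterS H => k; rewrite ler_pdivrMr// => kH.
have ei : 0 < e^-1 by rewrite invr_gt0.
rewrite /bump opprB addrCA subrr addr0 max_l; last by lra.
set m := k%:R * y - 1; have hm : 1 + e^-1 <= m by rewrite /m; lra.
rewrite ger0_norm ?invr_ge0 ?addr_ge0 ?sqr_ge0//.
rewrite -[leRHS]invrK lef_pV2 ?posrE ?ltr_pwDl ?sqr_ge0//.
nra.
Qed.

(** The sets where k t (l - t) >= 1 are compact in ]0,l[ and exhaust it. *)
Definition cutoff (f : R -> R) l (k : nat) t : R :=
  bump (k%:R * (t * (l - t))) * f t.
Definition dcutoff (f f' : R -> R) l (k : nat) t : R :=
  dbump (k%:R * (t * (l - t))) * (k%:R * (l - t - t)) * f t +
  bump (k%:R * (t * (l - t))) * f' t.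

Lemma C1_pair_cutoff f f' l k : C1_pair f f' ->
  C1_pair (cutoff f l k) (dcutoff f f' l k).
Proof.
move=> [df cf'].
have cf := C1_pair_continuous (conj df cf').
have [db cb'] := C1_pair_bump; have cb := C1_pair_continuous C1_pair_bump.
have cq : continuous (fun t => k%:R * (t * (l - t)) : R).
  move=> t; apply: cvgM; first exact: cvg_cst.
  by apply: cvgM; [exact: cvg_id|apply: cvgB; [exact: cvg_cst|exact: cvg_id]].
split => [t|].
  have h1 : is_derive t (1 : R) (fun t => k%:R * (t * (l - t)) : R) (k%:R
    * (l - t - t)).
    apply: is_derive_eq; rewrite /GRing.scale /=; ring.
  have h2 : is_derive t (1 : R) (fun t => bump (k%:R * (t * (l - t))))
      (dbump (k%:R * (t * (l - t))) * (k%:R * (l - t - t))).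
    exact: (@is_derive1_comp _ bump _ t _ _ (db _) h1).
  have h3 := df t.
  rewrite /cutoff; apply: is_derive_eq; rewrite /dcutoff /GRing.scale /= addrC.
  by congr (_ + _); rewrite mulrC.
pose q t : R := k%:R * (t * (l - t)).
have hb : continuous (bump \o q).
  by move=> t; apply: continuous_comp; [exact: cq|exact: cb].
have hb' : continuous (dbump \o q).
  by move=> t; apply: continuous_comp; [exact: cq|exact: cb'].
move=> t; apply: cvgD; last by apply: cvgM; [exact: hb|exact: cf'].
apply: cvgM; last exact: cf.
apply: cvgM; first exact: hb'.
apply: cvgM; first exact: cvg_cst.
by apply: cvgB; [apply: cvgB; [exact: cvg_cst|exact: cvg_id]|exact: cvg_id].
Qed.

Lemma cutoff_le (f : R -> R) l k t : `|cutoff f l k t| <= `|f t|.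
Proof.
rewrite /cutoff normrM ler_piMl//.
by have /andP[b0 b1] := bump_ge0le1 (k%:R * (t * (l - t))); rewrite ger0_norm.
Qed.

Lemma cutoff_cvg f l t : t \in `]0, l[%R ->
  (fun k => cutoff f l k t) @ \oo --> f t.
Proof.
rewrite in_itv /= => /andP[t0 tl]; rewrite -[X in _ --> X]mul1r;
  apply: cvgMr_tmp.
by apply: bump_cvg1; rewrite mulr_gt0// subr_gt0.
Qed.

(** The derivative of the cutoff grows like [k] near the ends; the zeros of [f]
    there compensate, since |f t| <= C t (l - t) turns the term into
    z bump'(z) at z = k t (l - t). *)
Lemma dcutoff_dist (f : R -> R) l C (k : nat) t : 0 <= C ->
  t \in `]0, l[%R -> `|f t| <= C * (t * (l - t)) ->
  `|dbump (k%:R * (t * (l - t))) * (k%:R * (l - t - t)) * f t| <=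
  C * l * (4 * (1 - bump (k%:R * (t * (l - t))))).
Proof.
rewrite in_itv /= => C0 /andP[t0 tl] ft.
have y0 : 0 < t * (l - t) by rewrite mulr_gt0// subr_gt0.
set z := k%:R * (t * (l - t)).
have /andP[b0 b1] := bump_ge0le1 z.
have [z1|z1] := leP z 1.
  by rewrite dbump0// !mul0r normr0 ?mulr_ge0// ?subr_ge0//; lra.
have lt : `|l - t - t| <= l by rewrite ler_norml; apply/andP; split; lra.
have := dbump_le z1.
rewrite (normrM z) (normrM (dbump z * _)) (normrM (dbump z)) => H.
apply: (@le_trans _ _ (`|dbump z| * (`|k%:R| * l) * (C * (t * (l - t))))).
  apply: ler_pM => //.
  by apply: ler_wpM2l => //; rewrite normrM ler_wpM2l.
rewrite (_ : `|dbump z| * _ * _ = C * l * (`|z| * `|dbump z|)).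
  by rewrite ler_wpM2l// mulr_ge0//; lra.
by rewrite /z (ger0_norm (ler0n _ _)) [`|_ * (t * _)|]ger0_norm;
  [ring|rewrite mulr_ge0// ltW].
Qed.

Lemma dcutoff_le (f f' : R -> R) l C k t : 0 <= C ->
  t \in `]0, l[%R -> `|f t| <= C * (t * (l - t)) ->
  `|dcutoff f f' l k t| <= C * l * 4 + `|f' t|.
Proof.
move=> C0 tI ft; rewrite /dcutoff (le_trans (ler_normD _ _))// lerD//;
  last first.
  exact: (cutoff_le f').
have /andP[t0 tl] : 0 < t < l by rewrite in_itv /= in tI.
apply: le_trans (dcutoff_dist _ C0 tI ft) _ => //.
have /andP[b0 b1] := bump_ge0le1 (k%:R * (t * (l - t))).
rewrite ler_wpM2l// ?mulr_ge0//; lra.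
Qed.

Lemma dcutoff_cvg (f f' : R -> R) l C t : 0 <= C ->
  t \in `]0, l[%R -> `|f t| <= C * (t * (l - t)) ->
  (fun k => dcutoff f f' l k t) @ \oo --> f' t.
Proof.
move=> C0 tI ft.
have /andP[t0 tl] : 0 < t < l by rewrite in_itv /= in tI.
have y0 : 0 < t * (l - t) by rewrite mulr_gt0// subr_gt0.
have H : (fun k : nat => C * l * (4 * (1 - bump (k%:R * (t * (l - t)))))) @ \oo
  --> (0 : R).
  rewrite -[X in _ --> X](mulr0 (C * l)); apply: cvgMl_tmp.
  rewrite -[X in _ --> X](mulr0 4); apply: cvgMl_tmp.
  rewrite -[X in _ --> X](subrr 1); apply: cvgB; first exact: cvg_cst.
  exact: bump_cvg1.
have H1 : (fun k : nat => dbump (k%:R * (t * (l - t))) * (k%:R * (l - t - t))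
  * f t)
    @ \oo --> (0 : R).
  apply: (@squeeze_cvgr _ _ _ _
     (fun k : nat => - (C * l * (4 * (1 - bump (k%:R * (t * (l - t)))))))
     (fun k : nat => C * l * (4 * (1 - bump (k%:R * (t * (l - t))))))) => //.
    by apply: nearW => k; rewrite -ler_norml; exact: dcutoff_dist.
  by rewrite -[X in _ --> X]oppr0; apply: cvgN.
have H2 := @cutoff_cvg f' _ _ tI.
by rewrite -[X in _ --> X]add0r; exact: (cvgD H1 H2).
Qed.

Lemma cutoff_outside f l k t : k%:R * (t * (l - t)) <= 1 -> cutoff f l k t = 0.
Proof. by move=> h; rewrite /cutoff bump0// mul0r. Qed.

End cutoffs.

Section bounded_cvg.
Context {R : realType} (d : nat) (L : 'I_d -> R) (hL : forall n, 0 < L n).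

Definition itv_bounded_cvg l (G : nat -> R -> R) (g : R -> R) :=
  [/\ forall k, measurable_fun setT (G k), measurable_fun setT g,
    exists C : R, forall k t, t \in `]0, l[%R -> `|G k t| <= C &
    forall t, t \in `]0, l[%R -> G ^~ t @ \oo --> g t].

(** The hypotheses of the bounded convergence theorem on the box; they pass to
    tensor products. *)
Definition bounded_cvg (G : nat -> 'rV[R]_d -> R) (g : 'rV[R]_d -> R) :=
  [/\ forall k, measurable_fun setT (G k), measurable_fun setT g,
    exists C : R, forall k x, box L x -> `|G k x| <= C &
    forall x, box L x -> G ^~ x @ \oo --> g x].

Lemma bounded_cvg_inner G g v : bounded_cvg G g -> L2 L v ->
  (fun k => inner L v (G k)) @ \oo --> inner L v g.
Proof. by move=> [mG mg [C GC] Gg] Lv; exact: (@inner_cvg _ _ _ G g C). Qed.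

Lemma bounded_cvg_dist G g : bounded_cvg G g -> box_bounded L g ->
  (fun k => inner L (g \- G k) (g \- G k)) @ \oo --> (0 : R).
Proof.
move=> [mG mg [C GC] Gg] [_ [D gD]].
rewrite (_ : (fun k => _) =
  (fun k => inner L (cst 1) ((g \- G k) \* (g \- G k)))); last first.
  by apply/funext => k; apply: eq_Rintegral => x _; rewrite mul1r.
have -> : (0 : R) = inner L (cst 1) (cst 0).
  by rewrite /inner /Rintegral integral0_eq// => x _; rewrite mulr0.
apply: (@inner_cvg _ _ _ _ _ ((D + C) * (D + C))).
- exact: box_bounded_L2 (box_bounded_cst L 1).
- by move=> k; apply: measurable_funM; apply: measurable_funB.
- exact: measurable_cst.
- move=> k x Lx; rewrite normrM.
  have h : `|g x - G k x| <= D + C.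
    by rewrite (le_trans (ler_normB _ _))// lerD// ?gD ?GC.
  by rewrite ler_pM.
- move=> x Lx.
  have h : (fun k => g x - G k x) @ \oo --> (0 : R).
    by rewrite -[X in _ --> X](subrr (g x)); apply: cvgB;
      [exact: cvg_cst|exact: Gg].
  by rewrite -[X in _ --> X](mulr0 0); exact: (cvgM h h).
Qed.

Lemma bounded_cvg_tensor (G : nat -> 'I_d -> R -> R) (g : 'I_d -> R -> R) :
  (forall n, itv_bounded_cvg (L n) (fun k => G k n) (g n)) ->
  bounded_cvg (fun k => tensor (G k)) (tensor g).
Proof.
move=> H; split.
- move=> k; apply: measurable_prod => n _; have [mG _ _ _] := H n.
  by apply: (measurableT_comp (mG k)); exact: measurable_rV_coord.
- apply: measurable_prod => n _; have [_ mg _ _] := H n.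
  by apply: (measurableT_comp mg); exact: measurable_rV_coord.
- have bd n : exists C : R, forall k t, t \in `]0, L n[%R -> `|G k n t| <= C.
    by case: (H n).
  have [C CP] := choice bd; exists (\prod_(n < d) C n) => k x Lx.
  rewrite normr_prod; apply: ler_prod => n _.
  by rewrite normr_ge0 CP//; exact: Lx.
- move=> x Lx; apply: cvg_prod => n; have [_ _ _ Gg] := H n.
  by apply: Gg; exact: Lx.
Qed.

Lemma itv_bounded_cvg_cutoff l (f f' : R -> R) : C1_pair f f' ->
  itv_bounded l f -> itv_bounded_cvg l (cutoff f l) f.
Proof.
move=> Cf [mf [C fC]]; split => //.
- move=> k; apply: continuous_measurable_fun.
  exact: C1_pair_continuous (C1_pair_cutoff l k Cf).
- by exists C => k t tI; apply: le_trans (cutoff_le _ _ _ _) _; exact: fC.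
- by move=> t; exact: cutoff_cvg.
Qed.

Lemma itv_bounded_cvg_dcutoff l (f f' : R -> R) C : 0 <= C -> C1_pair f f' ->
  itv_bounded l f' ->
  (forall t, t \in `]0, l[%R -> `|f t| <= C * (t * (l - t))) ->
  itv_bounded_cvg l (dcutoff f f' l) f'.
Proof.
move=> C0 Cf [mf' [D f'D]] fC; split => //.
- by move=> k; apply: continuous_measurable_fun;
  exact: (C1_pair_cutoff l k Cf).2.
- exists (C * l * 4 + D) => k t tI;
  apply: le_trans (dcutoff_le f' k C0 tI (fC _ tI)) _.
  by rewrite lerD2l f'D.
- by move=> t tI; exact: (@dcutoff_cvg _ f f' l C t C0 tI (fC _ tI)).
Qed.

Definition cutoff_tensor (f : 'I_d -> R -> R) k :=
  tensor (fun m => cutoff (f m) (L m) k).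

Lemma C1_cutoff_tensor (f f' : 'I_d -> R -> R) k :
  (forall m, C1_pair (f m) (f' m)) ->
  C1_compact L (cutoff_tensor f k) /\
  forall n, partial n (cutoff_tensor f k) =
    tensor (fun m => if m == n then dcutoff (f m) (f' m) (L m) k
                     else cutoff (f m) (L m) k).
Proof.
move=> Cf.
have [CF pF] := C1_tensor (fun m => C1_pair_cutoff (L m) k (Cf m)).
split=> //; split=> //.
pose A n := [set t : R | 1 <= k%:R * (t * (L n - t))].
have Asub n t : A n t -> 0 < t < L n.
  rewrite /A /= => h.
  have k0 : (0 : R) <= k%:R by [].
  have h1 : 0 < t * (L n - t).
    by rewrite ltNge; apply/negP => h2; have := mulr_ge0_le0 k0 h2; lra.
  have Ln := hL n; apply/andP; split.
    by rewrite ltNge; apply/negP => t0; nra.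
  by rewrite ltNge; apply/negP => t0; nra.
exists [set x : 'rV[R]_d | forall n, A n (x ord0 n)]; split.
- apply: (@rV_compact _ _ A) => n.
  apply: (@subclosed_compact _ _ `[0, L n]%classic); last 2 first.
  + exact: segment_compact.
  + by move=> t /Asub /andP[a b]; rewrite /= in_itv /= !ltW.
  rewrite (_ : A n = (fun t : R => k%:R * (t * (L n - t))) @^-1` [set y | 1 <=
    y]); last by [].
  apply: closed_comp => [t _|]; last exact: closed_ge.
  apply: cvgM; first exact: cvg_cst.
  by apply: cvgM; [exact: cvg_id|apply: cvgB; [exact: cvg_cst|exact: cvg_id]].
- by move=> x Kx n; rewrite in_itv /=; exact: Asub.
- move=> x /existsNP[n nA];
  rewrite /cutoff_tensor /tensor (bigD1 n)//= cutoff_outside ?mul0r//.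
  by rewrite leNgt; apply/negP => h; apply: nA; rewrite /A /= ltW.
Qed.

Lemma bounded_cvg_cutoff (f f' : 'I_d -> R -> R) :
  (forall m, C1_pair (f m) (f' m)) ->
  (forall m, itv_bounded (L m) (f m)) ->
  bounded_cvg (cutoff_tensor f) (tensor f).
Proof.
move=> Cf bf; apply: (@bounded_cvg_tensor (fun k m => cutoff (f m) (L m) k)) =>
  m.
exact: itv_bounded_cvg_cutoff (Cf m) (bf m).
Qed.

(** Only the factor [f n] has to vanish at the ends: the others are not
    differentiated. *)
Lemma bounded_cvg_partial_cutoff (f f' : 'I_d -> R -> R) n C :
  (forall m, C1_pair (f m) (f' m)) ->
  (forall m, itv_bounded (L m) (f m)) -> itv_bounded (L n) (f' n) -> 0 <= C ->
  (forall t, t \in `]0, L n[%R -> `|f n t| <= C * (t * (L n - t))) ->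
  bounded_cvg (fun k => partial n (cutoff_tensor f k)) (dtensor f f' n).
Proof.
move=> Cf bf bf' C0 fC.
rewrite (_ : (fun k => _) = fun k =>
  tensor (fun m => if m == n then dcutoff (f m) (f' m) (L m) k
   else cutoff (f m) (L m) k)); last by apply/funext => k;
     have [_ ->] := C1_cutoff_tensor k Cf.
apply: (@bounded_cvg_tensor (fun k m =>
  if m == n then dcutoff (f m) (f' m) (L m) k
   else cutoff (f m) (L m) k) (fun m => if m == n then f' m else f m)) => m.
case: eqP => [->|_]; first exact: (@itv_bounded_cvg_dcutoff _ _ _ C).
exact: itv_bounded_cvg_cutoff (Cf m) (bf m).
Qed.

End bounded_cvg.

(** * Tensor products of waves as weak eigenfunctions *)

Section eigenwaves.
Context {R : realType}.
Implicit Types (bc : boundary_condition) (l t : R).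

Definition eigwave bc l i t : R := eigfun1 bc l i.+1 t.
Definition deigwave bc l i t : R :=
  - wavenumber bc l i * sin (wavenumber bc l i * t - phase bc i).

Lemma eigwaveE bc l i : eigwave bc l i =
  (fun t => cos (wavenumber bc l i * t - phase bc i)).
Proof. by apply/funext => t; exact: eigfun1E. Qed.

Lemma C1_pair_eigwave bc l i : C1_pair (eigwave bc l i) (deigwave bc l i).
Proof.
rewrite eigwaveE; split=> [t|t]; first exact: is_derive_coslin.
by apply: cvgM; [exact: cvg_cst|exact: continuous_sinlin].
Qed.

Lemma C1_pair_deigwave bc l i :
  C1_pair (deigwave bc l i)
    (fun t => - wavenumber bc l i ^+ 2 * eigwave bc l i t).
Proof.
rewrite eigwaveE; split=> [t|t].
  have h := is_derive_sinlin (wavenumber bc l i) (phase bc i) t.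
  rewrite /deigwave; apply: is_derive_eq; rewrite /GRing.scale /=; ring.
by apply: cvgM; [exact: cvg_cst|exact: continuous_coslin].
Qed.

Lemma itv_bounded_eigwave bc l i l' : itv_bounded l' (eigwave bc l i).
Proof. by rewrite eigwaveE; exact: itv_bounded_coslin. Qed.

Lemma itv_bounded_deigwave bc l i l' : itv_bounded l' (deigwave bc l i).
Proof.
apply: itv_boundedZ; apply: (@itv_bounded_continuous _ _ _ 1);
  first exact: continuous_sinlin.
by move=> t; exact: sin_max.
Qed.

Lemma sin_abs_le (x : R) : `|sin x| <= `|x|.
Proof.
wlog x0 : x / 0 < x.
  move=> H; have [x0|x0|->] : [\/ x < 0, 0 < x | x = 0].
    by case: (ltgtP x 0) => h; [constructor 1|constructor 2|constructor 3].
  - by rewrite -(normrN x) -(normrN (sin x)) -sinN H// oppr_gt0.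
  - exact: H.
  - by rewrite sin0.
have [|z zI] := @MVT _ sin cos 0 x x0 (fun z _ => is_derive_sin z).
  by apply: continuous_subspaceT; exact: continuous_sin.
by rewrite sin0 !subr0 => ->; rewrite normrM ler_piMl// cos_max.
Qed.

(** By symmetry |sin| is at most m pi / l times the distance to the nearest end,
    and min t (l - t) <= 2 t (l - t) / l. *)
Lemma sin_natpi_le (m : nat) l t : 0 < l -> 0 < t < l ->
  `|sin (m%:R * pi / l * t)| <= (2 * m%:R * pi / l ^+ 2) * (t * (l - t)).
Proof.
move=> l0 /andP[t0 tl].
have p0 := pi_gt0 R.
have c0 : 0 <= m%:R * pi / l by rewrite divr_ge0// ?mulr_ge0// ltW.
have h1 : `|sin (m%:R * pi / l * t)| <= m%:R * pi / l * t.
  by apply: le_trans (sin_abs_le _) _; rewrite ger0_norm// mulr_ge0// ltW.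
have h2 : `|sin (m%:R * pi / l * t)| <= m%:R * pi / l * (l - t).
  have -> : m%:R * pi / l * t = m%:R * pi + (- (m%:R * pi / l * (l - t))).
    by field; rewrite gt_eqF.
  rewrite sin_natpi normrM normrX normrN1 expr1n mul1r.
  by apply: le_trans (sin_abs_le _) _; rewrite normrN ger0_norm// mulr_ge0//;
    lra.
have -> : 2 * m%:R * pi / l ^+ 2 * (t * (l - t)) = m%:R * pi / l
  * (2 * t * (l - t) / l).
  by field; rewrite gt_eqF.
have [tm|tm] := leP t (l - t).
  apply: le_trans h1 _; rewrite ler_wpM2l// ler_pdivlMr//; nra.
apply: le_trans h2 _; rewrite ler_wpM2l// ler_pdivlMr//; nra.
Qed.

Lemma eigwave_dirichlet_le l i : 0 < l -> exists2 C : R, 0 <= C &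
  forall t, t \in `]0, l[%R ->
    `|eigwave BiDirichlet l i t| <= C * (t * (l - t)).
Proof.
move=> l0; exists (2 * i.+1%:R * pi / l ^+ 2).
  by rewrite divr_ge0 ?sqr_ge0 ?mulr_ge0 ?pi_ge0.
move=> t; rewrite in_itv /= => tI; rewrite /eigwave /eigfun1 mulrAC.
exact: sin_natpi_le.
Qed.

Lemma deigwave_neumann_le l i : 0 < l -> exists2 C : R, 0 <= C &
  forall t, t \in `]0, l[%R -> `|deigwave BiNeumann l i t| <= C * (t * (l - t)).
Proof.
move=> l0; exists (`|wavenumber BiNeumann l i| * (2 * i%:R * pi / l ^+ 2)).
  by rewrite mulr_ge0// divr_ge0 ?sqr_ge0 ?mulr_ge0 ?pi_ge0.
move=> t; rewrite in_itv /= => tI;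
  rewrite /deigwave normrM normrN subr0 -[leRHS]mulrA.
by rewrite ler_wpM2l//; exact: sin_natpi_le.
Qed.

Lemma eigwave_periodic l i t : 0 < l ->
  eigwave Periodic l i (t + l) = eigwave Periodic l i t.
Proof.
move=> l0; rewrite !eigwaveE /wavenumber.
have [k ->] : exists k, freq Periodic i = k.*2.
  by exists (freq Periodic i)./2; rewrite even_halfK// odd_freq_periodic.
have -> : k.*2%:R * pi / l * (t + l) - phase Periodic i =
  (k.*2%:R * pi / l * t - phase Periodic i) + (pi *+ 2) *+ k :> R.
  by rewrite -muln2 natrM -(mulr_natr (pi *+ 2)) -(mulr_natr pi); field;
    rewrite gt_eqF.
by rewrite (periodicn (@cosD2pi R)).
Qed.

Lemma deigwave_periodic l i t : 0 < l ->
  deigwave Periodic l i (t + l) = deigwave Periodic l i t.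
Proof.
move=> l0; rewrite /deigwave /wavenumber.
have [k ->] : exists k, freq Periodic i = k.*2.
  by exists (freq Periodic i)./2; rewrite even_halfK// odd_freq_periodic.
have -> : k.*2%:R * pi / l * (t + l) - phase Periodic i =
  (k.*2%:R * pi / l * t - phase Periodic i) + (pi *+ 2) *+ k :> R.
  by rewrite -muln2 natrM -(mulr_natr (pi *+ 2)) -(mulr_natr pi); field;
    rewrite gt_eqF.
by rewrite (periodicn (@sinD2pi R)).
Qed.

End eigenwaves.

Section weak_eigenfunctions.
Context {R : realType} (d : nat) (L : 'I_d -> R) (hL : forall n, 0 < L n).
Implicit Types (bc : boundary_condition) (j : 'I_d -> nat).

(** The function [eigfun] for indices in N^d instead of {0,...,M-1}^d. *)
Definition eigtensor bc j : 'rV[R]_d -> R :=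
  tensor (fun n => eigwave bc (L n) (j n)).
Definition eigwavenumber bc j (n : 'I_d) : R := wavenumber bc (L n) (j n).
(** The eigenvalue of -Delta + 1 at [eigtensor bc j]. *)
Definition shifted_eigenvalue bc j : R :=
  1 + \sum_(n < d) eigwavenumber bc j n ^+ 2.

(** The factors of the partial derivative in direction [n]; the primed version
    lists their derivatives, which [C1_tensor] needs. *)
Let partial_factor bc j n m :=
  if m == n then deigwave bc (L m) (j m) else eigwave bc (L m) (j m).
Let partial_factor' bc j n m : R -> R := if m == n
   then (fun t => - wavenumber bc (L m) (j m) ^+ 2 * eigwave bc (L m) (j m) t)
   else deigwave bc (L m) (j m).

Lemma C1_eigtensor bc j : C1 (eigtensor bc j).
Proof. by have [] := C1_tensor (fun n => C1_pair_eigwave bc (L n) (j n)). Qed.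

Lemma partial_eigtensor bc j n : partial n (eigtensor bc j) =
  tensor (partial_factor bc j n).
Proof.
by have [_ ->] := C1_tensor (fun n => C1_pair_eigwave bc (L n) (j n)).
Qed.

Lemma C1_pair_partial_factor bc j n m :
  C1_pair (partial_factor bc j n m) (partial_factor' bc j n m).
Proof.
by rewrite /partial_factor /partial_factor'; case: eqP => _;
  [exact: C1_pair_deigwave|exact: C1_pair_eigwave].
Qed.

Lemma itv_bounded_partial_factor bc j n m :
  itv_bounded (L m) (partial_factor bc j n m).
Proof.
by rewrite /partial_factor; case: eqP => _;
  [exact: itv_bounded_deigwave|exact: itv_bounded_eigwave].
Qed.

Lemma C1_partial_eigtensor bc j n : C1 (partial n (eigtensor bc j)).
Proof. by rewrite partial_eigtensor; have [] :=
  C1_tensor (C1_pair_partial_factor bc j n). Qed.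

Lemma dtensor_partial_factor bc j n :
  dtensor (partial_factor bc j n) (partial_factor' bc j n) n =
  (fun x => - eigwavenumber bc j n ^+ 2 * eigtensor bc j x).
Proof.
apply/funext => x.
rewrite /dtensor /eigtensor /tensor (bigD1 n)//= [in RHS](bigD1 n)//= mulrA
  /partial_factor' !eqxx.
congr (_ * _); apply: eq_bigr => m /negbTE mn.
by rewrite mn /partial_factor mn.
Qed.

Lemma partial2_eigtensor bc j n : partial n (partial n (eigtensor bc j)) =
  (fun x => - eigwavenumber bc j n ^+ 2 * eigtensor bc j x).
Proof.
by rewrite partial_eigtensor; have [_ ->] :=
  C1_tensor (C1_pair_partial_factor bc j n); exact: dtensor_partial_factor.
Qed.

Lemma eigtensor_box_bounded bc j : box_bounded L (eigtensor bc j).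
Proof. by apply: box_bounded_tensor => n; exact: itv_bounded_eigwave. Qed.

Lemma partial_eigtensor_box_bounded bc j n :
  box_bounded L (partial n (eigtensor bc j)).
Proof. by rewrite partial_eigtensor; apply: box_bounded_tensor => m;
  exact: itv_bounded_partial_factor. Qed.

Lemma eigtensor_L2 bc j : L2 L (eigtensor bc j).
Proof. exact/box_bounded_L2/eigtensor_box_bounded. Qed.

Lemma partial_eigtensor_L2 bc j n : L2 L (partial n (eigtensor bc j)).
Proof. exact/box_bounded_L2/partial_eigtensor_box_bounded. Qed.

Lemma tensor_shift (f : 'I_d -> R -> R) (n : 'I_d) x :
  (forall t : R, f n (t + L n) = f n t) ->
  tensor f (x + L n *: delta_mx ord0 n) = tensor f x.
Proof.
move=> fn; apply: eq_bigr => m _; rewrite !mxE /=.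
by have [->|_] := eqVneq m n; rewrite ?mulr1 ?mulr0 ?addr0.
Qed.

Lemma eigtensor_C1_periodic j : C1_periodic L (eigtensor Periodic j).
Proof.
split; first exact: C1_eigtensor.
by move=> x n; apply: tensor_shift => t; exact: eigwave_periodic.
Qed.

Lemma partial_eigtensor_C1_periodic j n :
  C1_periodic L (partial n (eigtensor Periodic j)).
Proof.
split; first exact: C1_partial_eigtensor.
move=> x m; rewrite partial_eigtensor; apply: tensor_shift => t.
by rewrite /partial_factor; case: eqP => _;
  [exact: deigwave_periodic|exact: eigwave_periodic].
Qed.

Lemma C1_compact_face phi n x : C1_compact L phi -> box L x ->
  phi (set_coord x n (L n)) = 0 /\ phi (set_coord x n 0) = 0.
Proof.
move=> [_ [K [_ KL K0]]] Lx; split; apply: K0 => /KL /(_ n);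
  by rewrite mxE eqxx in_itv /= ltxx ?andbF.
Qed.

Lemma C1_periodic_face phi n x : C1_periodic L phi ->
  phi (set_coord x n (L n)) = phi (set_coord x n 0).
Proof.
by move=> [_ P]; rewrite -[L n]addr0 set_coordD addrC P.
Qed.

Definition test_space bc : set ('rV[R]_d -> R) :=
  if bc is Periodic then C1_periodic L else C1_compact L.

Lemma test_C1 bc phi : test_space bc phi -> C1 phi.
Proof. by case: bc => -[]. Qed.

Lemma inner_parts_compact (F phi : 'rV[R]_d -> R) n : C1 F ->
  C1_compact L phi ->
  inner L F (partial n phi) = - inner L (partial n F) phi.
Proof.
move=> CF Cphi; apply: inner_parts => //; first exact: Cphi.1.
by move=> x Lx; have [-> ->] := C1_compact_face n Cphi Lx; rewrite !mulr0.
Qed.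

Lemma inner_parts_eigtensor bc j n phi : test_space bc phi ->
  inner L (eigtensor bc j) (partial n phi) =
    - inner L (partial n (eigtensor bc j)) phi.
Proof.
case: bc => tphi; try by apply: inner_parts_compact => //; exact: C1_eigtensor.
apply: inner_parts => //; [exact: C1_eigtensor|exact: tphi.1|move=> x Lx].
by rewrite (C1_periodic_face _ _ (eigtensor_C1_periodic j))
  (C1_periodic_face _ _ tphi).
Qed.

Lemma weak_gradient_eigtensor bc j (c : R) :
  weak_gradient L (test_space bc) (fun x => c * eigtensor bc j x)
    (fun n x => c * partial n (eigtensor bc j) x).
Proof.
split=> [|n|phi n tphi];
  [exact/L2Z/eigtensor_L2|exact/L2Z/partial_eigtensor_L2|].
have Cphi := test_C1 tphi.
have Lphi : L2 L phi by apply/box_bounded_L2/continuous_box_bounded;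
  exact: Cphi.1.
have Ldphi : L2 L (partial n phi).
  by apply/box_bounded_L2/continuous_box_bounded; exact: (Cphi.2 n).2.
rewrite innerZl//; last exact: eigtensor_L2.
rewrite innerZl//; last exact: partial_eigtensor_L2.
by rewrite inner_parts_eigtensor// mulrN.
Qed.

Lemma inner_cvg_lt (u : nat -> R) (e : R) : u @ \oo --> (0 : R) -> 0 < e ->
  \forall k \near \oo, u k < e.
Proof.
move=> u0 e0; have /cvgrPdist_lt /(_ e e0) := u0.
by apply: filterS => k; rewrite sub0r normrN; exact/le_lt_trans/ler_norm.
Qed.

(** The Neumann and periodic cases only ask for a weak gradient. In the
    Dirichlet case the cutoffs of the eigenfunction approximate it in H^1,
    because every factor vanishes at the ends. The scalar [c] serves to iterate
    -Delta + 1 in [opA_eigtensor]. *)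
Lemma form_domain_eigtensor bc j (c : R) :
  form_domain bc L (fun x => c * eigtensor bc j x)
    (fun n x => c * partial n (eigtensor bc j) x).
Proof.
case: bc; [split|exact: (weak_gradient_eigtensor BiNeumann)|exact:
  (weak_gradient_eigtensor Periodic)].
  exact: (weak_gradient_eigtensor BiDirichlet).
move=> e e0.
pose f n := eigwave BiDirichlet (L n) (j n).
pose f' n := deigwave BiDirichlet (L n) (j n).
have Cf m : C1_pair (f m) (f' m) by exact: C1_pair_eigwave.
have bf m : itv_bounded (L m) (f m) by exact: itv_bounded_eigwave.
have c0 : 0 < c ^+ 2 + 1 by rewrite ltr_wpDl// sqr_ge0.
have e1 : 0 < e ^+ 2 / (c ^+ 2 + 1) by rewrite divr_gt0// exprn_gt0.
have H0 : \forall k \near \oo, inner L (tensor f \- cutoff_tensor L f k)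
  (tensor f \- cutoff_tensor L f k) <
    e ^+ 2 / (c ^+ 2 + 1).
  apply: inner_cvg_lt => //; apply: bounded_cvg_dist;
    first exact: bounded_cvg_cutoff Cf bf.
  exact: eigtensor_box_bounded.
have H1 n : \forall k \near \oo,
    inner L (dtensor f f' n \- partial n (cutoff_tensor L f k))
      (dtensor f f' n \- partial n (cutoff_tensor L f k)) <
    e ^+ 2 / (c ^+ 2 + 1).
  have [C C0 fC] := eigwave_dirichlet_le (j n) (hL n).
  apply: inner_cvg_lt => //; apply: bounded_cvg_dist.
    by apply: (bounded_cvg_partial_cutoff hL Cf bf _ C0 fC);
      exact: itv_bounded_deigwave.
  have := partial_eigtensor_box_bounded BiDirichlet j n;
    rewrite partial_eigtensor; exact.
have H2 : \forall k \near \oo, forall n : 'I_d,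
    inner L (dtensor f f' n \- partial n (cutoff_tensor L f k))
      (dtensor f f' n \- partial n (cutoff_tensor L f k)) <
    e ^+ 2 / (c ^+ 2 + 1).
  exact: filter_forall.
have [k [h0 h1]] := @filter_ex _ _ _ _ (filterI H0 H2).
have [CF pF] := C1_cutoff_tensor hL k Cf.
have small u v : L2 L u -> L2 L v -> inner L (u \- v) (u \- v) <
  e ^+ 2 / (c ^+ 2 + 1) ->
    (norm2 L ((fun x => c * u x) \- (fun x => c * v x))%R < e%:E)%E.
  move=> Lu Lv uv.
  rewrite (_ : _ \- _ = (fun x => c * (u \- v) x)); last first.
    by apply/funext => x /=; rewrite mulrBr.
  have Luv := L2B Lu Lv; rewrite norm2E; last exact: L2Z.
  rewrite lte_fin innerZl//; last exact: L2Z.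
  rewrite innerZr// -(ltr_pXn2r (n := 2))// ?nnegrE ?sqrtr_ge0 ?ltW//.
  rewrite sqr_sqrtr; last by rewrite mulrA mulr_ge0 ?inner_ge0// -expr2 sqr_ge0.
  rewrite ltr_pdivlMr// in uv; have i0 := inner_ge0 L (u \- v).
  move: uv i0; set q := inner _ _ _; nra.
have LF : L2 L
  (cutoff_tensor L f k) by apply/box_bounded_L2/continuous_box_bounded;
  exact: CF.1.1.
have LdF n : L2 L (partial n (cutoff_tensor L f k)).
  by apply/box_bounded_L2/continuous_box_bounded; exact: (CF.1.2 n).2.
have pZ n : partial n (fun x => c * cutoff_tensor L f k x) =
  (fun x => c * partial n (cutoff_tensor L f k) x).
  apply/funext => x; rewrite /partial.
  by rewrite (@deriveZ _ _ _ (cutoff_tensor L f k) c)//; exact: (CF.1.2 n).1.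
exists (fun x => c * cutoff_tensor L f k x); split.
- split; last first.
    have [K [cK KL K0]] := CF.2; exists K; split => // x Kx.
    by rewrite K0// mulr0.
  have cZ (F : 'rV[R]_d -> R) : continuous F -> continuous (fun x => c * F x).
    by move=> cF x; apply: (@continuousM _ _ (cst c) F);
      [exact: cst_continuous|exact: cF].
  split; first by apply: cZ; exact: CF.1.1.
  move=> n; split.
    by move=> x; apply: (@derivableZ _ _ _ (cutoff_tensor L f k) c);
      exact: (CF.1.2 n).1.
  by rewrite pZ; apply: cZ; exact: (CF.1.2 n).2.
- by apply: small => //; exact: eigtensor_L2.
- move=> n; rewrite pZ; apply: small => //; first exact: partial_eigtensor_L2.
  by rewrite partial_eigtensor; exact: h1.
Qed.

(** The weak form of -d_n^2 e_j = k^2 e_j against any [v] in the form domain.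
    Dirichlet: integrate by parts against the test functions that approximate
    [v]. Neumann: use cutoffs of d_n e_j as test functions for the weak gradient
    of [v]; d_n e_j is a sine in x_n, so the cutoffs are harmless. Periodic:
    d_n e_j is itself a test function. *)
Lemma form_domain_inner_eigtensor bc j v h n : form_domain bc L v h ->
  inner L (partial n (eigtensor bc j)) (h n) =
    eigwavenumber bc j n ^+ 2 * inner L (eigtensor bc j) v.
Proof.
case: bc.
- move=> [[Lv Lh _] app].
  have Le := eigtensor_L2 BiDirichlet j; have Lpe :=
    partial_eigtensor_L2 BiDirichlet j n.
  pose A := inner L (partial n (eigtensor BiDirichlet j)) (h n) -
    eigwavenumber BiDirichlet j n ^+ 2 * inner L (eigtensor BiDirichlet j) v.
  pose B := Num.sqrt (inner L (partial n (eigtensor BiDirichlet j))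
    (partial n (eigtensor BiDirichlet j)))
    + eigwavenumber BiDirichlet j n ^+ 2
      * Num.sqrt (inner L (eigtensor BiDirichlet j) (eigtensor BiDirichlet j)).
  have B0 : 0 <= B.
    by apply: addr_ge0; [exact: sqrtr_ge0|apply: mulr_ge0;
      [exact: sqr_ge0|exact: sqrtr_ge0]].
  suff A0 : forall e : R, 0 < e -> `|A| <= B * e.
    have : `|A| <= 0.
      apply/ler_addgt0Pr => e e0; rewrite add0r.
      have B1 : 0 < B + 1 by rewrite ltr_wpDl.
      apply: le_trans (A0 (e / (B + 1)) _) _; first by rewrite divr_gt0.
      rewrite mulrA ler_pdivrMr//; nra.
    by rewrite normr_le0 subr_eq0 => /eqP.
  move=> e e0; have [phi [Cphi v_phi h_phi]] := app e e0.
  have Lphi : L2 L phi by apply/box_bounded_L2/continuous_box_bounded;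
    exact: Cphi.1.1.
  have Ldphi : L2 L (partial n phi).
    by apply/box_bounded_L2/continuous_box_bounded; exact: (Cphi.1.2 n).2.
  have E0 : inner L (partial n (eigtensor BiDirichlet j)) (partial n phi) =
      eigwavenumber BiDirichlet j n ^+ 2 * inner L (eigtensor BiDirichlet j)
        phi.
    rewrite inner_parts_compact//; last exact: C1_partial_eigtensor.
    by rewrite partial2_eigtensor innerZl// mulNr opprK.
  have -> : A = inner L (partial n (eigtensor BiDirichlet j))
    (h n \- partial n phi) -
      eigwavenumber BiDirichlet j n ^+ 2 * inner L (eigtensor BiDirichlet j)
        (v \- phi).
    by rewrite !innerBr// E0 /A; ring.
  rewrite (le_trans (ler_normB _ _))// mulrDl lerD//.
    by apply: inner_norm_le => //; exact: L2B.
  rewrite normrM (ger0_norm (sqr_ge0 _)) -[leRHS]mulrA ler_wpM2l ?sqr_ge0//.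
  by apply: inner_norm_le => //; exact: L2B.
- move=> [Lv Lh wg].
  pose f := partial_factor BiNeumann j n; pose f' :=
    partial_factor' BiNeumann j n.
  have Cf := C1_pair_partial_factor BiNeumann j n; have bf :=
    itv_bounded_partial_factor BiNeumann j n.
  have [C C0 fC] := deigwave_neumann_le (j n) (hL n).
  have cv1 := bounded_cvg_inner (bounded_cvg_cutoff Cf bf) (Lh n).
  have bf' : itv_bounded (L n) (f' n).
    by rewrite /f' /partial_factor' eqxx; apply: itv_boundedZ;
      exact: itv_bounded_eigwave.
  have fnC : forall t, t \in `]0, L n[%R -> `|f n t| <= C * (t * (L n - t)).
    by rewrite /f /partial_factor eqxx.
  have cv2 := bounded_cvg_inner (bounded_cvg_partial_cutoff hL Cf bf bf' C0 fnC)
    Lv.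
  have cv3 : (fun k => inner L v (partial n (cutoff_tensor L f k))) @ \oo -->
      - inner L (h n) (tensor f).
    rewrite (_ : (fun k => _) =
      (fun k => - inner L (h n) (cutoff_tensor L f k))).
      exact: cvgN.
    by apply/funext => k; apply: wg; have [] := C1_cutoff_tensor hL k Cf.
  have : inner L v (dtensor f f' n) = - inner L (h n) (tensor f).
    by rewrite -(cvg_lim (@Rhausdorff R) cv2); apply: cvg_lim.
  rewrite dtensor_partial_factor innerZr//; last exact: eigtensor_L2.
  rewrite -partial_eigtensor mulNr => /oppr_inj E.
  by rewrite innerC -E (innerC L v).
- move=> [Lv Lh wg].
  have := wg _ n (partial_eigtensor_C1_periodic j n).
  rewrite partial2_eigtensor innerZr//; last exact: eigtensor_L2.
  rewrite mulNr => /oppr_inj E.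
  by rewrite innerC -E (innerC L v).
Qed.

Lemma form_domain_L2 bc v h : form_domain bc L v h ->
  L2 L v /\ forall n, L2 L (h n).
Proof. by case: bc => [[[]]|[]|[]]. Qed.

Lemma shifted_laplacian_eigtensor bc j (c : R) :
  shifted_laplacian bc L (fun x => c * eigtensor bc j x)
    (fun x => c * shifted_eigenvalue bc j * eigtensor bc j x).
Proof.
split; first exact/L2Z/eigtensor_L2.
exists (fun n x => c * partial n (eigtensor bc j) x);
  first exact: form_domain_eigtensor.
move=> v h vh; have [Lv Lh] := form_domain_L2 vh.
rewrite !innerZl//; try exact: eigtensor_L2.
rewrite (eq_bigr (fun n =>
  c * (eigwavenumber bc j n ^+ 2 * inner L (eigtensor bc j) v))).
  by rewrite -mulr_sumr -mulr_suml /shifted_eigenvalue; ring.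
by move=> n _; rewrite innerZl// ?(form_domain_inner_eigtensor _ _ vh)//;
  exact: partial_eigtensor_L2.
Qed.

(** Symmetry of -Delta + 1, in the form in which [u] need only belong to the
    domain. *)
Lemma shifted_laplacian_inner bc j u w : shifted_laplacian bc L u w ->
  inner L w (eigtensor bc j) =
    shifted_eigenvalue bc j * inner L u (eigtensor bc j).
Proof.
move=> [Lw [g ug H]]; have [Lu Lg] := form_domain_L2 ug.
have fe : form_domain bc L (eigtensor bc j) (fun n =>
  partial n (eigtensor bc j)).
  have := form_domain_eigtensor bc j 1.
  by congr form_domain; [apply/funext => x|apply/funext => n; apply/funext =>
    x]; rewrite mul1r.
rewrite -(H _ _ fe).
rewrite (eq_bigr (fun n => eigwavenumber bc j n ^+ 2
  * inner L (eigtensor bc j) u)).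
  by rewrite -mulr_suml (innerC L (eigtensor bc j)) /shifted_eigenvalue; ring.
by move=> n _; rewrite innerC (form_domain_inner_eigtensor _ _ ug).
Qed.

Lemma opA_eigtensor nu2 bc j (c : R) : c = nu2 * shifted_eigenvalue bc j ^+ 2 ->
  opA nu2 bc L (eigtensor bc j) (fun x => c * eigtensor bc j x).
Proof.
move=> ->; split; first exact/L2Z/eigtensor_L2.
exists (fun x => 1 * shifted_eigenvalue bc j * eigtensor bc j x).
exists (fun x => (1 * shifted_eigenvalue bc j) * shifted_eigenvalue bc j
  * eigtensor bc j x); split.
- have := shifted_laplacian_eigtensor bc j 1.
  by congr (shifted_laplacian _ _ _ _); apply/funext => x; rewrite mul1r.
- exact: shifted_laplacian_eigtensor.
- by apply: aeW => x _; ring.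
Qed.

Lemma opA_inner nu2 bc j u f : opA nu2 bc L u f ->
  inner L f (eigtensor bc j) =
    nu2 * shifted_eigenvalue bc j ^+ 2 * inner L u (eigtensor bc j).
Proof.
move=> [Lf [w [z [uw wz fz]]]].
have Lz : L2 L z by case: wz.
rewrite (inner_ae Lf (L2Z nu2 Lz) (eigtensor_L2 bc j) fz) innerZl//;
  last exact: eigtensor_L2.
by rewrite (shifted_laplacian_inner j wz) (shifted_laplacian_inner j uw); ring.
Qed.

Lemma eigen_coef nu2 bc j u (alpha : R) : L2 L u ->
  opA nu2 bc L u (fun x => alpha * u x) -> inner L u (eigtensor bc j) != 0 ->
  alpha = nu2 * shifted_eigenvalue bc j ^+ 2.
Proof.
move=> Lu /(opA_inner j); rewrite innerZl//; last exact: eigtensor_L2.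
by move=> + u0 => /(mulIf u0).
Qed.

End weak_eigenfunctions.

(** * Completeness of the eigenfunctions *)

Section steps.
Context {R : realType}.

(** With exponents n and 2^n this sequence converges to the indicator of
    [0, 1/2[ except at 1/2; the extra factor n makes it converge to 0 there. *)
Definition stepseq (n : nat) (x : R) : R := (1 - x ^+ n) ^+ (n * 2 ^ n).

Lemma bernoulli_ge (y : R) m : 0 <= y <= 1 -> 1 - m%:R * y <= (1 - y) ^+ m.
Proof.
move=> /andP[y0 y1]; elim: m => [|m IH]; first by rewrite expr0 mul0r subr0.
rewrite exprS -natr1.
have h : 0 <= (m%:R : R) by [].
have : (1 - y) * (1 - m%:R * y) <= (1 - y) * (1 - y) ^+ m.
  by rewrite ler_wpM2l// subr_ge0.
apply: le_trans; have : 0 <= m%:R * (y * y) by rewrite mulr_ge0// mulr_ge0.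
nra.
Qed.

Lemma bernoulli_le (y : R) m : 0 <= y <= 1 ->
  (1 - y) ^+ m * (1 + m%:R * y) <= 1.
Proof.
move=> /andP[y0 y1]; elim: m => [|m IH];
  first by rewrite expr0 mul0r addr0 mulr1.
apply: le_trans IH; rewrite exprSr -natr1 -mulrA ler_wpM2l ?exprn_ge0
  ?subr_ge0//.
have h : 0 <= m%:R * (y * y) by rewrite mulr_ge0// mulr_ge0.
nra.
Qed.

Lemma stepseq01 n x : 0 <= x <= 1 -> 0 <= stepseq n x <= 1.
Proof.
move=> /andP[x0 x1]; have xn : 0 <= x ^+ n <=
  1 by rewrite exprn_ge0//= exprn_ile1.
rewrite exprn_ge0//=; last by rewrite subr_ge0; case/andP: xn.
by rewrite exprn_ile1// ?subr_ge0 ?gerBl//; case/andP: xn.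
Qed.

(** With z = sqrt y, n y^n = (n z^n) z^n and n z^n is bounded by Bernoulli. *)
Lemma cvg_natr_expr (y : R) : 0 <= y < 1 ->
  (fun n : nat => n%:R * y ^+ n) @ \oo --> (0 : R).
Proof.
move=> /andP[y0 y1]; have [->|yn0] := eqVneq y 0.
  rewrite (_ : (fun n => _) = cst 0); first exact: cvg_cst.
  by apply/funext => -[|n]; rewrite ?mul0r// exprS mul0r mulr0.
pose z := Num.sqrt y.
have z0 : 0 < z by rewrite sqrtr_gt0 lt_def yn0.
have z1 : z < 1 by rewrite -[ltRHS]sqrtr1 ltr_sqrt.
have zz : y = z * z by rewrite -expr2 sqr_sqrtr.
have bd (n : nat) : n%:R * z ^+ n <= (1 - z)^-1.
  have := @bernoulli_le (1 - z) n; rewrite subKr => /(_ _) H.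
  have {}H : z ^+ n * (1 + n%:R * (1 - z)) <= 1 by apply: H; apply/andP; split;
    lra.
  rewrite -[leRHS]mul1r ler_pdivlMr ?subr_gt0//.
  by have := exprn_ge0 n (ltW z0); nra.
have H : (fun n : nat => (1 - z)^-1 * z ^+ n) @ \oo --> (0 : R).
  rewrite -[X in _ --> X](mulr0 (1 - z)^-1); apply: cvgMl_tmp.
  by apply: cvg_expr; rewrite gtr0_norm.
apply: (@squeeze_cvgr _ _ _ _ (fun=> 0) (fun n : nat => (1 - z)^-1 * z ^+ n)) =>
  //.
  apply: nearW => n; rewrite mulr_ge0 ?exprn_ge0//= zz exprMn mulrA.
  by rewrite ler_wpM2r// exprn_ge0// ltW.
exact: cvg_cst.
Qed.

(** Bernoulli's inequality from below for x < 1/2, where n (2 x)^n tends to 0,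
    and from above for x >= 1/2, where n (2 x)^n >= n. *)
Lemma stepseq_cvg x : 0 <= x <= 1 ->
  (fun n => stepseq n x) @ \oo --> (if x < 2^-1 then 1 else 0 : R).
Proof.
move=> /[dup] x01 /andP[x0 x1]; have [xh|xh] := ltP x 2^-1.
  have H : (fun n : nat => 1 - n%:R * (2 * x) ^+ n) @ \oo --> (1 : R).
    rewrite -[X in _ --> X]subr0; apply: cvgB; first exact: cvg_cst.
    by apply: cvg_natr_expr; apply/andP; split; lra.
  apply: (@squeeze_cvgr _ _ _ _ (fun n : nat => 1 - n%:R * (2 * x) ^+ n) (fun=>
    1)) => //.
    apply: nearW => n; have /andP[_ ->] := stepseq01 n x01.
    rewrite andbT; apply: le_trans (bernoulli_ge _ _).
      by rewrite exprMn natrM natrX mulrA.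
    by rewrite exprn_ge0//= exprn_ile1.
  exact: cvg_cst.
have H : (fun n : nat => n.+1%:R^-1 : R) @ \oo -->
  (0 : R) by exact: cvg_harmonic.
have bd n : 0 <= stepseq n.+1 x <= n.+1%:R^-1.
  have /andP[-> _] := stepseq01 n.+1 x01 => /=.
  have xn : 0 <= x ^+ n.+1 <= 1 by rewrite exprn_ge0//= exprn_ile1.
  have := @bernoulli_le _ (n.+1 * 2 ^ n.+1)%N xn.
  rewrite -/(stepseq n.+1 x) => h.
  have s0 : 0 <= stepseq n.+1 x by case/andP: (stepseq01 n.+1 x01).
  rewrite -[leRHS]mul1r ler_pdivlMr//; apply: le_trans h; rewrite ler_wpM2l//.
  rewrite natrM natrX -mulrA -exprMn.
  have : 1 <= (2 * x) ^+ n.+1 by rewrite exprn_ege1//; lra.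
  have : 0 < n.+1%:R :> R by [].
  nra.
have : (fun n => stepseq n.+1 x) @ \oo --> (0 : R).
  apply: (@squeeze_cvgr _ _ _ _ (fun=> 0) (fun n : nat => n.+1%:R^-1 : R)) =>
    //.
    by apply: nearW => n; exact: bd.
  exact: cvg_cst.
by rewrite (cvg_shiftS (fun n => stepseq n x)).
Qed.

End steps.

Section trigspan.
Context {R : realType} (bc : boundary_condition) (l : R) (l0 : 0 < l).

(** The span of the one-dimensional eigenfunctions, as an inductive predicate
    so that linearity arguments are inductions. *)
Inductive trigspan : (R -> R) -> Prop :=
| trigspan_eigwave i : trigspan (eigwave bc l i)
| trigspan_comb c f g : trigspan f -> trigspan g ->
  trigspan (fun t => c * f t + g t).

Lemma trigspan_ext f g : f =1 g -> trigspan f -> trigspan g.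
Proof. by move=> /funext ->. Qed.

Lemma trigspan0 : trigspan (fun=> 0).
Proof.
apply: (@trigspan_ext (fun t => (-1) * eigwave bc l 0 t + eigwave bc l 0 t)).
  by move=> t; rewrite mulN1r addNr.
by apply: trigspan_comb; exact: trigspan_eigwave.
Qed.

Lemma trigspanZ c f : trigspan f -> trigspan (fun t => c * f t).
Proof.
move=> tf; apply: (@trigspan_ext (fun t => c * f t + 0)); first by move=> t;
  rewrite addr0.
by apply: trigspan_comb => //; exact: trigspan0.
Qed.

Lemma trigspanD f g : trigspan f -> trigspan g -> trigspan (fun t => f t + g t).
Proof.
move=> tf tg; apply: (@trigspan_ext (fun t => 1 * f t + g t));
  first by move=> t; rewrite mul1r.
exact: trigspan_comb.
Qed.

Lemma trigspan_itv_bounded f : trigspan f -> itv_bounded l f.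
Proof.
elim=> [i|c {}f g _ bf _ bg]; first exact: itv_bounded_eigwave.
by apply: itv_boundedD => //; exact: itv_boundedZ.
Qed.

(** Multipliers form an algebra, so polynomials in a multiplier are multipliers
    again. *)
Definition multiplier f := forall g, trigspan g ->
  trigspan (fun t => f t * g t).

Lemma multiplier_cst c : multiplier (fun=> c).
Proof. by move=> g; exact: trigspanZ. Qed.

Lemma multiplierD f g : multiplier f -> multiplier g ->
  multiplier (fun t => f t + g t).
Proof.
move=> mf mg h th; apply: (@trigspan_ext (fun t => f t * h t + g t * h t)).
  by move=> t; rewrite mulrDl.
by apply: trigspanD; [exact: mf|exact: mg].
Qed.

Lemma multiplierM f g : multiplier f -> multiplier g ->
  multiplier (fun t => f t * g t).
Proof.
move=> mf mg h th; apply: (@trigspan_ext (fun t => f t * (g t * h t))).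
  by move=> t; rewrite mulrA.
by apply: mf; exact: mg.
Qed.

Lemma multiplierX f n : multiplier f -> multiplier (fun t => f t ^+ n).
Proof.
move=> mf; elim: n => [|n IH]; first exact: multiplier_cst.
by move=> g tg; apply: (trigspan_ext _ (multiplierM mf IH tg)) => t;
  rewrite exprS.
Qed.

Lemma multiplier_eigwave f :
  (forall i, trigspan (fun t => f t * eigwave bc l i t)) -> multiplier f.
Proof.
move=> H g; elim=> [i|c {}g h _ IHg _ IHh]; first exact: H.
apply: (trigspan_ext _ (trigspan_comb c IHg IHh)) => t; ring.
Qed.

End trigspan.

Section separating.
Context {R : realType} (l : R) (l0 : 0 < l).
Local Notation w := (pi / l).

Definition wave (m : nat) (p t : R) : R := cos (m%:R * (pi / l) * t - p).

Lemma waveM a m p q t : (a <= m)%N ->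
  wave a q t * wave m p t =
    2^-1 * wave (m - a) (p - q) t + 2^-1 * wave (m + a) (p + q) t.
Proof.
move=> am; rewrite mulrC /wave cos_mul natrB// natrD -mulrDr mulrC.
by congr (_ * (cos _ + cos _)); ring.
Qed.

Lemma eigwave_wave bc i : eigwave bc l i = wave (freq bc i) (phase bc i).
Proof. by rewrite eigwaveE; apply/funext => t;
  rewrite /wave /wavenumber mulrA. Qed.

Lemma trigspan_dirichlet m p : p = pi / 2 -> trigspan BiDirichlet l (wave m p).
Proof.
move=> ->; case: m => [|i].
  apply: (trigspan_ext _ (trigspan0 _ _)) => t; rewrite /wave !mul0r sub0r cosN.
  by rewrite cos_pihalf.
by have := trigspan_eigwave BiDirichlet l i; rewrite eigwave_wave.
Qed.

Lemma trigspan_neumann m : trigspan BiNeumann l (wave m 0).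
Proof. by have := trigspan_eigwave BiNeumann l m; rewrite eigwave_wave. Qed.

Lemma wave_phase m p t :
  wave m p t = cos p * wave m 0 t + sin p * wave m (pi / 2) t.
Proof. by rewrite /wave subr0 cosBpihalf cosB; ring. Qed.

Lemma trigspan_periodic k p : trigspan Periodic l (wave k.*2 p).
Proof.
have h0 : trigspan Periodic l (wave k.*2 0).
  by have := trigspan_eigwave Periodic l k.*2;
    rewrite eigwave_wave /freq /phase odd_double.
have h1 : trigspan Periodic l (wave k.*2 (pi / 2)).
  case: k {h0} => [|k].
    apply: (trigspan_ext _ (trigspan0 _ _)) => t;
      rewrite /wave !mul0r sub0r cosN.
    by rewrite cos_pihalf.
  by have := trigspan_eigwave Periodic l k.*2.+1;
    rewrite eigwave_wave /freq /phase /= odd_double.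
apply: (trigspan_ext _ (trigspan_comb (cos p) h0 (trigspanZ (sin p) h1))) => t.
by rewrite (wave_phase _ p).
Qed.

(** cos t sin (m t) is the half-sum of sin ((m - 1) t) and sin ((m + 1) t). *)
Lemma multiplier_dirichlet : multiplier BiDirichlet l (wave 1 0).
Proof.
apply: multiplier_eigwave => i; rewrite eigwave_wave.
apply: (@trigspan_ext _ _ _ (fun t => 2^-1 * wave (i.+1 - 1) (pi / 2) t + 2^-1
  * wave (i.+1 + 1) (pi / 2) t)).
  by move=> t; rewrite waveM//= subr0 addr0.
by apply: trigspan_comb; [|apply: trigspanZ]; exact: trigspan_dirichlet.
Qed.

Lemma multiplier_neumann : multiplier BiNeumann l (wave 1 0).
Proof.
apply: multiplier_eigwave => -[|i]; rewrite eigwave_wave.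
  apply: (trigspan_ext _ (trigspan_neumann 1)) => t.
  by rewrite {3}/wave /= !mul0r subr0 cos0 mulr1.
apply: (@trigspan_ext _ _ _ (fun t => 2^-1 * wave (i.+1 - 1) 0 t + 2^-1
  * wave (i.+1 + 1) 0 t)).
  by move=> t; rewrite waveM//= subr0 addr0.
by apply: trigspan_comb; [|apply: trigspanZ]; exact: trigspan_neumann.
Qed.

Lemma multiplier_periodic q : multiplier Periodic l (wave 2 q).
Proof.
apply: multiplier_eigwave => i; rewrite eigwave_wave.
have [k ->] : exists k, freq Periodic i = k.*2.
  by exists (freq Periodic i)./2; rewrite even_halfK// odd_freq_periodic.
move: (phase Periodic i) => p; case: k => [|k].
  apply: (trigspan_ext _ (trigspanZ (cos p) (trigspan_periodic 1 q))) => t.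
  by rewrite {3}/wave !mul0r sub0r cosN mulrC.
apply: (@trigspan_ext _ _ _ (fun t => 2^-1 * wave k.*2 (p - q) t + 2^-1
  * wave k.+2.*2 (p + q) t)).
  move=> t; rewrite waveM//; congr (_ * wave _ _ _ + _ * wave _ _ _); lia.
by apply: trigspan_comb; [|apply: trigspanZ]; exact: trigspan_periodic.
Qed.

(** Away from the periodic case this is cos (pi t / l) - cos (pi b / l). In the
    periodic case it is cos (u - v / 2) - cos (v / 2) with u = 2 pi t / l and
    v = 2 pi b / l, which is 2 sin (u / 2) sin ((v - u) / 2). *)
Definition sepfun bc (b t : R) : R :=
  if bc is Periodic then wave 2 (pi / l * b) t - cos (pi / l * b)
  else wave 1 0 t - cos (pi / l * b).

Lemma multiplier_sepfun bc b : multiplier bc l (sepfun bc b).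
Proof.
case: bc; apply: multiplierD; try exact: multiplier_cst.
- exact: multiplier_dirichlet.
- exact: multiplier_neumann.
- exact: multiplier_periodic.
Qed.

Lemma sepfun_gt0 bc b t : 0 < t < l -> 0 < b < l ->
  (0 < sepfun bc b t) = (t < b).
Proof.
move=> /andP[t0 tl] /andP[b0 bl]; have p0 := pi_gt0 R.
have h (y : R) : 0 < y -> y < l -> 0 < pi / l * y < pi.
  move=> y0 yl; rewrite mulr_gt0 ?divr_gt0//=.
  by rewrite mulrAC ltr_pdivrMr// ltr_pM2l.
have /andP[t1 t2] := h t t0 tl; have /andP[b1 b2] := h b b0 bl.
have mono x : 0 < x -> x < l -> pi / l * x \in `[0, pi].
  by move=> x0 xl; have /andP[a c] := h x x0 xl; rewrite in_itv /= !ltW.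
have DN : (0 < wave 1 0 t - cos (pi / l * b)) = (t < b).
  by rewrite /wave subr0 mul1r subr_gt0 ltr_cos ?mono// ltr_pM2l// divr_gt0.
have P : (0 < wave 2 (pi / l * b) t - cos (pi / l * b)) = (t < b).
  have -> : wave 2 (pi / l * b) t - cos (pi / l * b) =
     2 * sin (pi / l * t) * sin (pi / l * (b - t)).
    have -> : pi / l * (b - t) = pi / l * b - pi / l * t by ring.
    rewrite /wave; have -> : 2 * (pi / l) * t - pi / l * b = pi / l * t
      - (pi / l * b - pi / l * t) by ring.
    rewrite [X in _ - cos X](_ : _ = pi / l * t + (pi / l * b - pi / l * t));
      last by ring.
    move: (pi / l * b - pi / l * t) => Y; rewrite cosB cosD; ring.
  rewrite pmulr_rgt0; last by rewrite mulr_gt0// sin_gt0_pi// t1.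
  have [tb|bt|->] : [\/ t < b, b < t | t = b].
    by case: (ltgtP t b) => H; [constructor 1|constructor 2|constructor 3].
  - rewrite tb sin_gt0_pi//; apply: h; lra.
  - rewrite [RHS]ltNge (ltW bt) /=; apply/negbTE;
    rewrite -leNgt -oppr_ge0 -sinN.
    rewrite -mulrN opprB sin_ge0_pi//.
    have /andP[c1 c2] : 0 < pi / l * (t - b) < pi by apply: h; lra.
    by rewrite !ltW.
  - by rewrite subrr mulr0 sin0 !ltxx.
by case: bc.
Qed.

Lemma sepfun_bound bc b t : - 2 <= sepfun bc b t <= 2.
Proof.
have H (x y : R) : - 2 <= cos x - cos y <= 2.
  have := cos_geN1 x; have := cos_le1 x; have := cos_geN1 y; have := cos_le1 y.
  by move=> *; apply/andP; split; lra.
by case: bc; exact: H.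
Qed.

Lemma eigwave0_gt0 bc t : 0 < t < l -> 0 < eigwave bc l 0 t.
Proof.
move=> /andP[t0 tl]; rewrite /eigwave /eigfun1; case: bc => /=.
- rewrite mul1r sin_gt0_pi//; have p0 := pi_gt0 R.
  by rewrite divr_gt0 ?mulr_gt0//= ltr_pdivrMr// ltr_pM2l.
- by rewrite !mul0r cos0.
- by rewrite !mul0r cos0.
Qed.

Definition below (b : R) (f : R -> R) t : R := if t < b then f t else 0.

Lemma measurable_below b f : measurable_fun setT f ->
  measurable_fun setT (below b f).
Proof.
move=> mf; rewrite (_ : below b f = (fun t => \1_([set` `]-oo, b[%R]) t * f t)).
  by apply: measurable_funM => //; apply: measurable_indic;
    exact: measurable_itv.
apply/funext => t; rewrite /below indicE mem_setE in_itv /=.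
by case: ifP => _; rewrite ?mul1r ?mul0r.
Qed.

(** In the Dirichlet case the span does not contain the constants, so the
    indicator of ]0,b[ is approximated only after multiplication by the positive
    weight sin (pi t / l). In the other cases the weight [eigwave bc l 0] is
    1. *)
Lemma trig_approx bc b : exists G : nat -> R -> R,
  (forall k, trigspan bc l (G k)) /\
    itv_bounded_cvg l G (below b (eigwave bc l 0)).
Proof.
have [me [C eC]] := itv_bounded_eigwave bc l 0 l.
have mb := measurable_below b me.
have [b0|b0] := leP b 0.
  exists (fun _ _ => 0); split; first by move=> _; exact: trigspan0.
  split => //; first by exists 0 => k t _; rewrite normr0.
  move=> t; rewrite in_itv /= => /andP[t0 _].
  by rewrite /below ltNge (le_trans b0 (ltW t0)) /=; exact: cvg_cst.
have [lb|bl] := leP l b.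
  exists (fun _ => eigwave bc l 0); split; first by move=> _;
    exact: trigspan_eigwave.
  split => //; first by exists C => k t; exact: eC.
  move=> t; rewrite in_itv /= => /andP[_ tl].
  by rewrite /below (lt_le_trans tl lb) /=; exact: cvg_cst.
pose x t := 2^-1 + - (4^-1) * sepfun bc b t.
have mx : multiplier bc l x.
  by apply: multiplierD; [exact: multiplier_cst|apply: multiplierM;
    [exact: multiplier_cst|exact: multiplier_sepfun]].
have x01 t : 0 <= x t <= 1.
  by rewrite /x; have /andP[h1 h2] := sepfun_bound bc b t; apply/andP; split;
    lra.
exists (fun k t => stepseq k (x t) * eigwave bc l 0 t).
have tG k : trigspan bc l (fun t => stepseq k (x t) * eigwave bc l 0 t).
  rewrite /stepseq; apply: (multiplierX _ _ (trigspan_eigwave bc l 0)).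
  apply: (@multiplierD _ _ _ (fun=> 1) (fun t => - x t ^+ k));
    first exact: multiplier_cst.
  move=> g tg; apply: (trigspan_ext _ (trigspanZ (-1) (multiplierX k mx tg))) =>
    t; ring.
split=> //; split => //.
- by move=> k; have [] := trigspan_itv_bounded (tG k).
- exists C => k t tI; rewrite normrM; apply: le_trans (eC t tI).
  rewrite ler_piMl//; have /andP[s0 s1] := stepseq01 k (x01 t).
  by rewrite ger0_norm.
- move=> t; rewrite in_itv /= => tI.
  have -> : below b (eigwave bc l 0) t = (if x t < 2^-1 then 1 else 0)
    * eigwave bc l 0 t.
    rewrite /below -(sepfun_gt0 bc tI); last by rewrite b0.
    rewrite (_ : (x t < 2^-1) = (0 < sepfun bc b t)).
      by case: ifP => _; rewrite ?mul1r ?mul0r.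
    by rewrite /x; apply/idP/idP => h; lra.
  by apply: cvgMr_tmp; exact: stepseq_cvg.
Qed.

End separating.

Section completeness.
Context {R : realType} (d : nat) (L : 'I_d -> R) (hL : forall n, 0 < L n).
Context (bc : boundary_condition).

(** Replaces the factors one coordinate at a time, by linearity. *)
Lemma inner_tensor_trigspan phi : L2 L phi ->
  (forall j : 'I_d -> nat, inner L phi (eigtensor L bc j) = 0) ->
  forall f : 'I_d -> R -> R, (forall n, trigspan bc (L n) (f n)) ->
  inner L phi (tensor f) = 0.
Proof.
move=> Lphi phi0 f tf.
have H (k : nat) : (k <= d)%N -> forall f : 'I_d -> R -> R,
    (forall n : 'I_d, (n < k)%N -> trigspan bc (L n) (f n)) ->
    (forall n : 'I_d, (k <= n)%N -> exists i, f n = eigwave bc (L n) i) ->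
    inner L phi (tensor f) = 0.
  elim: k => [_ g _ ge|k IH kd g gt ge].
    have [j jP] := choice (fun n => ge n (leq0n n)).
    rewrite (_ : tensor g = eigtensor L bc j)//.
    by apply/funext => x; apply: eq_bigr => n _; rewrite jP.
  pose n0 := Ordinal kd.
  pose g' h := fun n => if n == n0 then h else g n.
  have E : g = g' (g n0) by apply/funext => n; rewrite /g'; case: eqP => [->|].
  have bg h n : itv_bounded (L n0) h -> itv_bounded (L n) (g' h n).
    rewrite /g'; case: eqP => [->//|_ _].
    have [nk|nk] := ltnP n k.+1; first exact: trigspan_itv_bounded (gt n nk).
    by have [i ->] := ge n nk; exact: itv_bounded_eigwave.
  rewrite E; have := gt n0 (ltnSn k); elim=> [i|c f1 f2 t1 IH1 t2 IH2].
    apply: IH; first exact: ltnW.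
      move=> n nk; rewrite /g'; case: eqP => [nn|_]; last by apply: gt;
        exact: ltnW.
      by rewrite nn ltnn in nk.
    move=> n nk; rewrite /g'; case: eqP => [->|nn]; first by exists i.
    apply: ge; rewrite ltn_neqAle nk andbT; apply/eqP => kn; apply: nn.
    exact/val_inj.
  rewrite (_ : tensor _ = (fun x => c * tensor (g' f1) x) \+ tensor (g' f2)).
    have L1 : L2 L (tensor (g' f1)).
      by apply/box_bounded_L2/box_bounded_tensor => n; apply: bg;
        exact: trigspan_itv_bounded t1.
    have L2' : L2 L (tensor (g' f2)).
      by apply/box_bounded_L2/box_bounded_tensor => n; apply: bg;
        exact: trigspan_itv_bounded t2.
    rewrite innerC innerDl//; last exact: L2Z.
    by rewrite innerZl// !(innerC L _ phi) IH1 IH2 mulr0 addr0.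
  have tE h x : tensor (g' h) x = h (x ord0 n0) *
      \prod_(n < d | n != n0) g n (x ord0 n).
    rewrite /tensor (bigD1 n0)//= /g' eqxx; congr (_ * _).
    by apply: eq_bigr => n /negbTE ->.
  by apply/funext => x /=; rewrite !tE mulrDl mulrA.
apply: (H d) => // n.
by rewrite leqNgt ltn_ord.
Qed.

(** A pi-system that generates the sigma-algebra. *)
Definition lower_boxes : set (set 'rV[R]_d) :=
  [set A | exists b : 'I_d -> R,
     A = [set x : 'rV[R]_d | forall n, x ord0 n < b n]].

Lemma lower_boxes_setI : setI_closed lower_boxes.
Proof.
move=> _ _ [b ->] [c ->]; exists (fun n => Num.min (b n) (c n)).
apply/seteqP; split => [x [xb xc] n|x H]; first by rewrite lt_min xb xc.
by split => n; have := H n; rewrite lt_min => /andP[].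
Qed.

Lemma measurable_lower_boxes (A : set 'rV[R]_d) :
  measurable A -> <<s lower_boxes >> A.
Proof.
have := @smallest_sub _ (sigma_algebra [set: 'rV[R]_d])
  (\big[setU/set0]_(i < d) preimage_set_system setT (@rV_coord R d i)
    measurable)
  <<s lower_boxes >>.
apply; first exact: smallest_sigma_algebra.
move=> B; rewrite -bigcup_seq => -[i _ [Y mY <-]] /=; rewrite setTI.
have sB := smallest_sigma_algebra setT lower_boxes.
have : measurable Y by exact: mY.
rewrite RGenInftyO.measurableE.
have := @smallest_sub _ (sigma_algebra [set: R]) (@RGenInftyO.G R)
  [set Y | <<s lower_boxes >> (rV_coord i @^-1` Y)].
apply; first split => /=.
- by rewrite preimage_set0; case: sB.
- by move=> Z sZ; rewrite setTD preimage_setC -setTD; case: sB => _ + _; apply.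
- by move=> F sF; rewrite preimage_bigcup; case: sB => _ _; apply.
move=> _ [b ->] /=.
rewrite (_ : _ @^-1` _ = \bigcup_k [set x : 'rV[R]_d | forall n, x ord0 n <
   (if n == i then b else k%:R)]).
  case: sB => _ _; apply => k; apply: sub_gen_smallest.
  by exists (fun n => if n == i then b else k%:R).
apply/seteqP; split => [x|x [k _ /(_ i)]]; last first.
  by rewrite eqxx /= in_itv.
rewrite /= in_itv /= => xb.
exists (\max_(n < d) (Num.bound `|x ord0 n|))%N => // n.
case: eqP => [->//|_].
apply: le_lt_trans (ler_norm _) _;
  apply: lt_le_trans (archi_boundP (normr_ge0 _)) _.
by rewrite ler_nat; exact: leq_bigmax.
Qed.

(** The sets over which [phi] times the positive weight [W] has zero integral
    form a Dynkin system. It contains the lower boxes because their indicators,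
    times [W], are bounded limits of tensor products in the span. *)
Theorem eigtensor_complete phi : L2 L phi ->
  (forall j : 'I_d -> nat, inner L phi (eigtensor L bc j) = 0) ->
  phi = cst 0 %[ae leb_box L].
Proof.
move=> Lphi phi0.
pose W := tensor (fun n => eigwave bc (L n) 0).
have bW : box_bounded L W by apply: box_bounded_tensor => n;
  exact: itv_bounded_eigwave.
have iW := L2_integrableM Lphi (box_bounded_L2 bW).
pose psi x := phi x * W x.
have ipsi A : measurable A -> (leb_box L).-integrable A (EFin \o psi).
  by move=> mA; apply: integrableS iW.
have psi_inner v : L2 L v -> inner L phi v = 0 ->
    (\int[leb_box L]_x (phi x * v x)%:E = 0)%E.
  move=> Lv v0; rewrite -[LHS]fineK; first by congr EFin.
  by apply: integrable_fin_num => //; exact: L2_integrableM.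
pose H : set (set 'rV[R]_d) :=
  [set A | measurable A /\ (\int[leb_box L]_(x in A) (psi x)%:E = 0)%E].
have dH : dynkin H.
  split=> /=.
  - split=> //; apply: psi_inner; first exact: box_bounded_L2.
    by apply: inner_tensor_trigspan => // n; exact: trigspan_eigwave.
  - move=> A [mA A0]; split; first exact: measurableC.
    have : (\int[leb_box L]_(x in A `|` ~` A) (psi x)%:E = 0)%E.
      rewrite setUv; apply: psi_inner; first exact: box_bounded_L2.
      by apply: inner_tensor_trigspan => // n; exact: trigspan_eigwave.
    rewrite integral_setU ?A0 ?add0e//; first exact: measurableC.
      rewrite setUv; exact: (measurable_int _ (ipsi _ measurableT)).
    exact/disj_setPCl.
  - move=> F tF HF; have mF k : measurable (F k) by case: (HF k).
    split; first exact: bigcupT_measurable.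
    rewrite integral_bigcup//; last by apply: ipsi; exact: bigcupT_measurable.
    by rewrite eseries0// => k _ _; case: (HF k).
have bH : lower_boxes `<=` H.
  move=> _ [b ->].
  have mB : measurable [set x : 'rV[R]_d | forall n, x ord0 n < b n].
    have := @measurable_rV_box R d (fun n => [set` `]-oo, b n[%R]) (fun n =>
      measurable_itv _).
    congr measurable; apply/seteqP; split => x h n; have :=
      h n; by rewrite /= in_itv.
  split => //.
  have [G GP] := choice (fun n => trig_approx (hL n) bc (b n)).
  pose f n := below (b n) (eigwave bc (L n) 0).
  have cf : bounded_cvg L (fun k => tensor (fun n => G n k)) (tensor f).
    by apply: (@bounded_cvg_tensor _ _ L (fun k n => G n k)) => n; have [_] :=
      GP n.
  have f0 : inner L phi (tensor f) = 0.
    have := bounded_cvg_inner cf Lphi.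
    rewrite (_ : (fun k => _) = cst 0).
      by move=> h; rewrite -(cvg_lim (@Rhausdorff R) h); apply: cvg_lim => //;
        exact: cvg_cst.
    by apply/funext => k; apply: inner_tensor_trigspan => // n; have [] := GP n.
  have bf : box_bounded L (tensor f).
    apply: box_bounded_tensor => n; have [mw [C wC]] :=
      itv_bounded_eigwave bc (L n) 0 (L n).
    split; first exact: measurable_below.
    exists C => t tI; rewrite /f /below; case: ifP => _; first exact: wC.
    by rewrite normr0; apply: le_trans (wC _ tI).
  rewrite integral_mkcond -[RHS](psi_inner _ (box_bounded_L2 bf) f0).
  apply: eq_integral => x _; rewrite patchE; case: ifPn => [|].
    rewrite inE /= => xb; congr EFin; congr (_ * _); apply: eq_bigr => n _.
    by rewrite /f /below xb.
  rewrite notin_setE => /existsNP[n /negP]; rewrite -leNgt => xb.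
  by rewrite /tensor (bigD1 n)//= /f /below ltNge xb /= mul0r mulr0.
have allH A : measurable A -> H A.
  move=> mA; have := measurable_lower_boxes mA.
  by apply: (lambda_system_subset lower_boxes_setI
    ((dynkin_lambda_system _).1 dH) bH).
have psi0 : ae_eq (leb_box L) setT (EFin \o psi) (cst 0%E).
  apply: integral_ae_eq => //.
  by move=> E _ mE; rewrite integral0; case: (allH E mE).
have boxae : {ae leb_box L, forall x, box L x} by exact: ae_in_box.
apply: filterS2 psi0 boxae => x /= + Lx _ => /(_ Logic.I) [] /eqP.
rewrite mulf_eq0 => /orP[/eqP//|].
rewrite gt_eqF//; apply: prodr_gt0 => n _; apply: eigwave0_gt0 => //.
by have := Lx n; rewrite in_itv.
Qed.

End completeness.

(** * The oblique projection *)

Section span_facts.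
Context {R : realType} (d : nat) (L : 'I_d -> R).

Lemma inner_tensor (f g : 'I_d -> R -> R) :
  (forall n, itv_bounded (L n) (f n)) -> (forall n, itv_bounded (L n) (g n)) ->
  inner L (tensor f) (tensor g) =
  \prod_(n < d) \int[lebesgue_measure]_(t in `]0, L n[) (f n t * g n t).
Proof.
move=> bf bg; rewrite -Rintegral_tensor; last by move=> n; exact: itv_boundedM.
by apply: eq_Rintegral => x _; rewrite /tensor -big_split.
Qed.

Lemma itv_bounded_eigfun1 bc l i :
  itv_bounded l (fun t : R => eigfun1 bc l i.+1 t).
Proof.
rewrite (_ : (fun _ => _) = fun t => cos (wavenumber bc l i * t - phase bc i)).
  exact: itv_bounded_coslin.
by apply/funext => t; exact: eigfun1E.
Qed.

Lemma eigfunE bc M (j : {ffun 'I_d -> 'I_M}) :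
  eigfun bc L j = tensor (fun n => eigfun1 bc (L n) (j n).+1).
Proof. by []. Qed.

Lemma box_bounded_eigfun bc M (j : {ffun 'I_d -> 'I_M}) :
  box_bounded L (eigfun bc L j).
Proof. by rewrite eigfunE; apply: box_bounded_tensor => n;
  exact: itv_bounded_eigfun1. Qed.

Lemma L2_eigfun bc M (j : {ffun 'I_d -> 'I_M}) : L2 L (eigfun bc L j).
Proof. exact/box_bounded_L2/box_bounded_eigfun. Qed.

Lemma span_orth (J : finType) (b : J -> 'rV[R]_d -> R) v :
  (forall j, L2 L (b j)) -> L2 L v -> (forall j, inner L (b j) v = 0) ->
  orthogonal_complement L (Defs.span L b) v.
Proof.
move=> Lb Lv bv; split => // u [Lu [c uc]].
have Ls : L2 L (fun x => \sum_j c j * b j x) by apply: L2_sum => j; exact: L2Z.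
by rewrite (inner_ae Lu Ls Lv uc) inner_lincomb// big1// => j _;
  rewrite bv mulr0.
Qed.

Lemma span_gen (J : finType) (b : J -> 'rV[R]_d -> R) j :
  L2 L (b j) -> Defs.span L b (b j).
Proof.
move=> Lb; split => //; exists (fun k => (k == j)%:R); apply: aeW => x _.
rewrite (bigD1 j)//= eqxx mul1r big1 ?addr0// => k /negbTE ->.
by rewrite mul0r.
Qed.

End span_facts.

Section projection.
Context {R : realType} (d : nat) (L : 'I_d -> R) (hL : forall n, 0 < L n).
Context (r : R) (hr : 0 < r < 1) (bc : boundary_condition) (M : nat).
Context (M0 : (0 < M)%N).
Local Notation J := {ffun 'I_d -> 'I_M}.

Let M0' : (0 : R) < M%:R. Proof. by rewrite ltr0n. Qed.
Let r0 : 0 < r. Proof. by case/andP: hr. Qed.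
Let r1 : r < 1. Proof. by case/andP: hr. Qed.

Definition actuator1 (n : 'I_d) (q : 'I_M) : set R :=
  [set` `]Defs.center L M n q.+1 - r * L n / (2 * M%:R),
          Defs.center L M n q.+1 + r * L n / (2 * M%:R)[%R].

Lemma actuatorE (j : J) : \1_(actuator L r j) =
  tensor (fun n => \1_(actuator1 n (j n))) :> (_ -> R).
Proof.
apply/funext => x; rewrite /tensor indicE;
  case: (boolP (x \in actuator L r j)) => h.
  rewrite big1// => n _; rewrite indicE mem_set//.
  by move: h; rewrite inE => /(_ n).
have [n hn] : exists n, ~ actuator1 n (j n) (x ord0 n).
  by apply/existsNP => h'; move/negP : h; apply; rewrite inE => n; exact: h'.
by rewrite (bigD1 n)//= indicE memNset// mul0r.
Qed.

Lemma itv_bounded_actuator1 n q : itv_bounded (L n) \1_(actuator1 n q).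
Proof.
split; first by apply: measurable_indic; exact: measurable_itv.
by exists 1 => t _; rewrite indicE; case: (_ \in _); rewrite ?normr1 ?normr0.
Qed.

Lemma box_bounded_actuator (j : J) : box_bounded L \1_(actuator L r j).
Proof. by rewrite actuatorE; apply: box_bounded_tensor => n;
  exact: itv_bounded_actuator1. Qed.

(** Each actuator lies in its own cell of length L_n / M, since r < 1;
    disjointness and inclusion in the box follow. *)
Lemma actuator1_lt n (q : 'I_M) (t : R) : actuator1 n q t ->
  q%:R * L n / M%:R < t < q.+1%:R * L n / M%:R.
Proof.
rewrite /actuator1 /= in_itv /= => /andP[a b].
have rL : r * L n / (2 * M%:R) < L n / (2 * M%:R).
  by rewrite ltr_pM2r ?invr_gt0 ?mulr_gt0// -[ltRHS]mul1r ltr_pM2r.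
have c1 : Defs.center L M n q.+1 - L n / (2 * M%:R) = q%:R * L n / M%:R.
  by rewrite /Defs.center -natr1; field; rewrite gt_eqF.
have c2 : Defs.center L M n q.+1 + L n / (2 * M%:R) = q.+1%:R * L n / M%:R.
  by rewrite /Defs.center -natr1; field; rewrite gt_eqF.
by rewrite -c1 -c2; apply/andP; split; lra.
Qed.

Lemma actuator1_sub n q : actuator1 n q `<=` [set` `]0, L n[%R].
Proof.
move=> t /actuator1_lt /andP[a b]; rewrite /= in_itv /=; apply/andP; split.
  by apply: le_lt_trans a; rewrite divr_ge0// mulr_ge0// ltW.
apply: lt_le_trans b _; rewrite ler_pdivrMr// mulrC ler_pM2l//.
by rewrite ler_nat.
Qed.

Lemma actuator1_disj n q q' : q != q' ->
  actuator1 n q `&` actuator1 n q' = set0.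
Proof.
wlog qq : q q' / (q < q')%N.
  move=> H nq; case: (ltngtP q q') => h; first exact: H.
    by rewrite setIC; apply: H => //; rewrite eq_sym.
  by move/negP: nq; case; apply/eqP/val_inj.
move=> _; rewrite -subset0 =>
  t [/actuator1_lt /andP[_ a] /actuator1_lt /andP[b _]].
have := lt_trans b a; rewrite ltr_pM2r ?invr_gt0// ltr_pM2r// ltr_nat.
by rewrite ltnNge qq.
Qed.

Lemma Rintegral_indic_mul l (A : set R) (f : R -> R) :
  A `<=` [set` `]0, l[%R] ->
  \int[lebesgue_measure]_(t in `]0, l[) (\1_A t * f t) =
  \int[lebesgue_measure]_(t in A) f t.
Proof.
move=> Al; rewrite [LHS]Rintegral_mkcond [RHS]Rintegral_mkcond.
apply: eq_Rintegral => t _; rewrite !patchE indicE.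
have [tA|tA] := boolP (t \in A); last by rewrite mul0r if_same.
by rewrite mul1r mem_set//; apply: Al; rewrite inE in tA.
Qed.

Lemma halfwidth_gt0 n : 0 < r * L n / (2 * M%:R).
Proof. by rewrite divr_gt0 ?mulr_gt0. Qed.

Lemma actuator1_orth n q q' :
  \int[lebesgue_measure]_(t in `]0, L n[)
    (\1_(actuator1 n q) t * \1_(actuator1 n q') t) =
  (q == q')%:R * (r * L n / M%:R).
Proof.
rewrite Rintegral_indic_mul; last exact: actuator1_sub.
have h0 := halfwidth_gt0 n.
have [->|qq] := eqVneq q q'; last first.
  rewrite mul0r;
    transitivity (\int[lebesgue_measure]_(t in actuator1 n q) (0 : R)).
    apply: eq_Rintegral => t; rewrite inE => tq; rewrite indicE memNset// =>
      tq'.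
    by have : (actuator1 n q `&` actuator1 n q') t by [];
      rewrite actuator1_disj.
  by rewrite Rintegral_cst_itv ?mul0r//; lra.
transitivity (\int[lebesgue_measure]_(t in actuator1 n q') (1 : R)).
  by apply: eq_Rintegral => t tq; rewrite indicE tq.
rewrite Rintegral_cst_itv; last lra.
by rewrite !mul1r; field; rewrite gt_eqF.
Qed.

Lemma ffun_neq (i k : J) : i != k -> exists n, i n != k n.
Proof.
move=> ik; apply/existsP; apply: contraNT ik => /existsPn h; apply/eqP/ffunP =>
  n.
by apply/eqP; have := h n; rewrite negbK.
Qed.

Lemma inner_actuator (i k : J) :
  inner L \1_(actuator L r i) \1_(actuator L r k) =
  (i == k)%:R * \prod_(n < d) (r * L n / M%:R).
Proof.
rewrite !actuatorE inner_tensor; try by move=> n; exact: itv_bounded_actuator1.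
under eq_bigr do rewrite actuator1_orth.
have [->|ik] := eqVneq i k.
  by rewrite mul1r; apply: eq_bigr => n _; rewrite eqxx mul1r.
have [n nik] := ffun_neq ik.
by rewrite mul0r (bigD1 n)//= (negbTE nik) !mul0r.
Qed.

(** With [midpoint_value], the factors D and V of the matrix of inner products
    of actuators and eigenfunctions. *)
Definition attenuation (j : J) := \prod_(n < d) attenuation1 bc (L n) r M (j n).
Definition midpoint_value (i j : J) : R :=
  \prod_(n < d) eig_midpoint bc M (j n) (i n).
(** The squared norm of a column of V. *)
Definition midpoint_norm (j : J) : R :=
  \prod_(n < d) \sum_(q < M)
    (eig_midpoint bc M (j n) q * eig_midpoint bc M (j n) q).
Definition eig_sqnorm (j : J) : R := inner L (eigfun bc L j) (eigfun bc L j).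

Lemma inner_actuator_eig (i j : J) :
  inner L \1_(actuator L r i) (eigfun bc L j) =
    attenuation j * midpoint_value i j.
Proof.
rewrite actuatorE [eigfun _ _ _](_ : _ =
  tensor (fun n => eigfun1 bc (L n) (j n).+1))//.
rewrite inner_tensor; [|by move=> n; exact: itv_bounded_actuator1|by move=> n;
  exact: itv_bounded_eigfun1].
rewrite /attenuation /midpoint_value -big_split; apply: eq_bigr => n _.
by rewrite Rintegral_indic_mul;
  [exact: Rintegral_actuator|exact: actuator1_sub].
Qed.

Lemma inner_eig (j k : J) : inner L (eigfun bc L j) (eigfun bc L k) =
  (j == k)%:R * eig_sqnorm j.
Proof.
have [->|/ffun_neq[n jk]] := eqVneq j k; first by rewrite mul1r.
rewrite mul0r [LHS](@inner_tensor _ _ L (fun n => eigfun1 bc (L n) (j n).+1)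
  (fun n => eigfun1 bc (L n) (k n).+1)); try by move=> m;
    exact: itv_bounded_eigfun1.
rewrite (bigD1 n)//= eig_orth ?mul0r// => h; move/negP: jk; apply.
exact/eqP/val_inj.
Qed.

Lemma eig_sqnorm_bounds j : 0 < eig_sqnorm j <= \prod_(n < d) L n.
Proof.
rewrite /eig_sqnorm [X in _ < X](@inner_tensor _ _ L (fun n =>
  eigfun1 bc (L n) (j n).+1)
  (fun n => eigfun1 bc (L n) (j n).+1)); try by move=> m;
    exact: itv_bounded_eigfun1.
rewrite [X in _ && (X <= _)](@inner_tensor _ _ L (fun n =>
  eigfun1 bc (L n) (j n).+1)
  (fun n => eigfun1 bc (L n) (j n).+1)); try by move=> m;
    exact: itv_bounded_eigfun1.
apply/andP; split.
  by apply: prodr_gt0 => n _; have /andP[] := eig_norm_bounds bc (j n) (hL n).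
apply: ler_prod => n _; have /andP[a ->] := eig_norm_bounds bc (j n) (hL n).
by rewrite ltW.
Qed.

Lemma midpoint_value_orth (j k : J) :
  \sum_i midpoint_value i j * midpoint_value i k =
  (j == k)%:R * midpoint_norm j.
Proof.
under eq_bigr do rewrite /midpoint_value -big_split.
rewrite -(bigA_distr_bigA (fun (n : 'I_d) (q : 'I_M) =>
  eig_midpoint bc M (j n) q * eig_midpoint bc M (k n) q)) /=.
have [->|/ffun_neq[n jk]] := eqVneq j k; first by rewrite mul1r.
rewrite mul0r (bigD1 n)//= eig_midpoint_orth ?mul0r// => h; move/negP: jk;
  apply.
exact/eqP/val_inj.
Qed.

Lemma eig_midpoint_gt0 (q : 'I_M) :
  0 < \sum_(p < M) (eig_midpoint bc M q p * eig_midpoint bc M q p) :> R.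
Proof. by apply: lt_le_trans (eig_midpoint_norm _ (ltn_ord q));
  rewrite divr_gt0. Qed.

Lemma midpoint_norm_gt0 j : 0 < midpoint_norm j.
Proof. by apply: prodr_gt0 => n _; exact: eig_midpoint_gt0. Qed.

Lemma cosr_gt0 : 0 < cos (pi * r / 2).
Proof.
have p0 := pi_gt0 R; have pr0 : 0 < pi * r by rewrite mulr_gt0.
have pr1 : pi * r < pi by rewrite gtr_pMr.
by rewrite cos_gt0_pihalf//; apply/andP; split; lra.
Qed.

Lemma attenuation_gt0 j : 0 < attenuation j.
Proof.
apply: prodr_gt0 => n _;
  apply: lt_le_trans (attenuation1_ge bc (hL n) (ltn_ord (j n)) hr).
by rewrite mulr_gt0 ?divr_gt0 ?mulr_gt0// cosr_gt0.
Qed.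

(** Orthogonality of the columns of a square matrix gives that of its rows. *)
Lemma eig_midpoint_dual (p q : 'I_M) :
  \sum_(j < M) (eig_midpoint bc M j p * eig_midpoint bc M j q /
     \sum_(s < M) (eig_midpoint bc M j s * eig_midpoint bc M j s)) =
       (p == q)%:R :> R.
Proof.
pose A : 'M[R]_M := \matrix_(p, j) eig_midpoint bc M j p.
pose B : 'M[R]_M :=
  \matrix_(j, p) (eig_midpoint bc M j p / \sum_(s < M) (eig_midpoint bc M j s
  * eig_midpoint bc M j s)).
have BA : B *m A = 1%:M.
  apply/matrixP => j k; rewrite !mxE.
  under eq_bigr do rewrite !mxE mulrAC.
  rewrite -mulr_suml; have [->|jk] := eqVneq j k.
    by rewrite divff// gt_eqF// eig_midpoint_gt0.
  by rewrite (@eig_midpoint_orth _ bc M j k) ?mul0r// => h; move/negP: jk;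
    apply; exact/eqP/val_inj.
have := mulmx1C BA => /matrixP/(_ p q); rewrite !mxE => <-.
by apply: eq_bigr => j _; rewrite !mxE mulrA.
Qed.

(** V G^-1 V^T = 1, with G the diagonal matrix of the squared norms of the
    columns; this makes the actuators independent modulo E_M^perp. *)
Lemma midpoint_value_dual (i k : J) :
  \sum_j midpoint_value i j * midpoint_value k j / midpoint_norm j =
  (i == k)%:R.
Proof.
under eq_bigr do rewrite /midpoint_value -big_split /midpoint_norm -prodfV
  -big_split.
rewrite -(bigA_distr_bigA (fun (n : 'I_d) (q : 'I_M) =>
  eig_midpoint bc M q (i n) * eig_midpoint bc M q (k n) /
   \sum_(s < M) (eig_midpoint bc M q s * eig_midpoint bc M q s))) /=.
under eq_bigr do rewrite eig_midpoint_dual.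
have [->|/ffun_neq[n jk]] := eqVneq i k;
  last by rewrite (bigD1 n)//= (negbTE jk) mul0r.
by rewrite big1// => n _; rewrite eqxx.
Qed.

(** The coefficients a = V G^-1 D^-1 b solve (V D)^T a = b, where b lists the
    inner products of [h] with the eigenfunctions. *)
Definition actuator_coef (h : 'rV[R]_d -> R) (i : J) : R :=
  \sum_(j : J) midpoint_value i j
    * (inner L h (eigfun bc L j) / (attenuation j * midpoint_norm j)).

(** The projection onto U_M along E_M^perp. *)
Definition actuator_proj (h : 'rV[R]_d -> R) (x : 'rV[R]_d) : R :=
  \sum_(i : J) actuator_coef h i * \1_(actuator L r i) x.

Lemma L2_actuator (i : J) : L2 L \1_(actuator L r i).
Proof. exact/box_bounded_L2/box_bounded_actuator. Qed.

Lemma L2_actuator_proj h : L2 L (actuator_proj h).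
Proof. by apply: L2_sum => i; apply: L2Z; exact: L2_actuator. Qed.

(** This is what places [h - actuator_proj h] in E_M^perp. *)
Lemma inner_actuator_proj h (k : J) :
  inner L (actuator_proj h) (eigfun bc L k) = inner L h (eigfun bc L k).
Proof.
rewrite /actuator_proj inner_lincomb; [|exact: L2_actuator|exact: L2_eigfun].
under eq_bigr do rewrite inner_actuator_eig /actuator_coef mulr_suml.
rewrite exchange_big /= (bigD1 k)//= [X in _ + X]big1 ?addr0.
  rewrite (eq_bigr (fun i => (midpoint_value i k * midpoint_value i k)
    * (inner L h (eigfun bc L k) / midpoint_norm k))).
    rewrite -mulr_suml midpoint_value_orth eqxx mul1r mulrC mulfVK// gt_eqF//.
    exact: midpoint_norm_gt0.
  move=> i _; field.
  by rewrite !gt_eqF ?midpoint_norm_gt0 ?attenuation_gt0.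
move=> j jk.
rewrite (eq_bigr (fun i => (midpoint_value i j * midpoint_value i k) *
   (inner L h (eigfun bc L j) / (attenuation j * midpoint_norm j)
     * attenuation k))).
  by rewrite -mulr_suml midpoint_value_orth (negbTE jk) !mul0r.
by move=> i _; ring.
Qed.

(** Disjoint actuators are orthogonal, and V G^-1 V^T = 1 turns |a|^2 into a
    weighted sum of squares of the inner products. *)
Lemma norm_actuator_proj h : inner L (actuator_proj h) (actuator_proj h) =
  \prod_(n < d) (r * L n / M%:R) *
  \sum_(j : J)
    (inner L h (eigfun bc L j) / attenuation j) ^+ 2 / midpoint_norm j.
Proof.
rewrite {1}/actuator_proj inner_lincomb;
  [|exact: L2_actuator|exact: L2_actuator_proj].
have -> : \sum_i actuator_coef h i
  * inner L \1_(actuator L r i) (actuator_proj h) =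
    \prod_(n < d) (r * L n / M%:R) * \sum_i actuator_coef h i ^+ 2.
  rewrite mulr_sumr; apply: eq_bigr => i _; rewrite innerC {1}/actuator_proj.
  rewrite inner_lincomb; [|exact: L2_actuator|exact: L2_actuator].
  rewrite (bigD1 i)//= inner_actuator eqxx [X in _ + X]big1;
    first by rewrite mul1r addr0 expr2 mulrA mulrC.
  by move=> k /negbTE ki; rewrite inner_actuator ki mul0r mulr0.
congr (_ * _).
under eq_bigr do rewrite expr2 {1}/actuator_coef mulr_suml.
rewrite exchange_big /=; apply: eq_bigr => j _.
under eq_bigr do rewrite /actuator_coef mulr_sumr.
rewrite exchange_big /= (bigD1 j)//= [X in _ + X]big1 ?addr0.
  rewrite (eq_bigr (fun i => (midpoint_value i j * midpoint_value i j) *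
    (inner L h (eigfun bc L j) / (attenuation j * midpoint_norm j)) ^+ 2)).
    rewrite -mulr_suml midpoint_value_orth eqxx mul1r; field.
    by rewrite !gt_eqF ?midpoint_norm_gt0 ?attenuation_gt0.
  by move=> i _; ring.
move=> k kj.
rewrite (eq_bigr (fun i => (midpoint_value i j * midpoint_value i k) *
   (inner L h (eigfun bc L j) / (attenuation j * midpoint_norm j) *
    (inner L h (eigfun bc L k) / (attenuation k * midpoint_norm k))))).
  by rewrite -mulr_suml midpoint_value_orth eq_sym (negbTE kj) !mul0r.
by move=> i _; ring.
Qed.

Lemma bessel h : L2 L h ->
  \sum_(j : J) inner L h (eigfun bc L j) ^+ 2 / eig_sqnorm j <= inner L h h.
Proof.
move=> Lh; pose c (j : J) := inner L h (eigfun bc L j) / eig_sqnorm j.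
pose s := fun x => \sum_(j : J) c j * eigfun bc L j x.
have Ls : L2 L s by apply: L2_sum => j; apply: L2Z; exact: L2_eigfun.
have := inner_ge0 L (h \- s).
rewrite innerBl ?innerBr//; try exact: L2B.
have hs : inner L h s = \sum_(j : J) inner L h (eigfun bc L j) ^+ 2 / eig_sqnorm
  j.
  rewrite innerC inner_lincomb; [|exact: L2_eigfun|by []].
  by apply: eq_bigr => j _; rewrite innerC /c; ring.
have ss : inner L s s = inner L h s.
  rewrite (innerC L h s) {1}/s inner_lincomb; [|exact: L2_eigfun|by []].
  rewrite [in RHS]/s inner_lincomb; [|exact: L2_eigfun|by []].
  apply: eq_bigr => j _; congr (_ * _).
  rewrite innerC /s inner_lincomb; [|exact: L2_eigfun|exact: L2_eigfun].
  rewrite (bigD1 j)//= inner_eig eqxx mul1r big1 ?addr0.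
    have /andP[n0 _] := eig_sqnorm_bounds j.
    by rewrite /c mulfVK ?gt_eqF// innerC.
  by move=> k /negbTE kj; rewrite inner_eig kj mul0r mulr0.
by rewrite (innerC L s) ss hs; lra.
Qed.

Definition projection_bound := \prod_(n < d) (2 / (cos (pi * r / 2) ^+ 2 * r)).

(** In each coordinate: r L / M * L <= 2 / (c^2 r) * (c r L / M)^2 * (M / 2),
    with c = cos (pi r / 2); the powers of M cancel. *)
Lemma coef_bound j : \prod_(n < d) (r * L n / M%:R) * eig_sqnorm j <=
  projection_bound * (attenuation j ^+ 2 * midpoint_norm j).
Proof.
rewrite (expr2 (attenuation j)) /projection_bound /attenuation /midpoint_norm
  -!big_split.
rewrite [eig_sqnorm j](@inner_tensor _ _ L (fun n => eigfun1 bc (L n) (j n).+1)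
  (fun n => eigfun1 bc (L n) (j n).+1)); try by move=> m;
    exact: itv_bounded_eigfun1.
rewrite -big_split; apply: ler_prod => n _ /=.
have /andP[a b] := eig_norm_bounds bc (j n) (hL n).
have a0 : 0 < r * L n / M%:R by rewrite divr_gt0 ?mulr_gt0.
apply/andP; split; first by rewrite mulr_ge0 ?ltW.
have := attenuation1_ge bc (hL n) (ltn_ord (j n)) hr.
have := eig_midpoint_norm bc (ltn_ord (j n)).
set D := attenuation1 _ _ _ _ _; set G := \sum_(_ < _) _ => hG hD.
have c0 := cosr_gt0.
set c := cos _ in hD c0 *.
apply: (@le_trans _ _ (r * L n / M%:R * L n)); first by rewrite ler_pM2l.
apply: (@le_trans _ _ (2 / (c ^+ 2 * r) * ((c * (r * L n / M%:R)) *
    (c * (r * L n / M%:R)) * (M%:R / 2)))).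
  rewrite le_eqVlt; apply/orP; left; apply/eqP; field.
  by rewrite !gt_eqF.
rewrite ler_pM2l ?divr_gt0 ?mulr_gt0 ?exprn_gt0//.
have e0 : 0 <= c * (r * L n / M%:R) by rewrite mulr_ge0 ?ltW.
by rewrite !ler_pM// mulr_ge0.
Qed.

Lemma projection_bound_ge0 : 0 <= projection_bound.
Proof.
apply: prodr_ge0 => n _; apply: divr_ge0 => //.
by apply: mulr_ge0; [exact: sqr_ge0|exact: ltW].
Qed.

Lemma actuator_proj_bound h : L2 L h ->
  inner L (actuator_proj h) (actuator_proj h) <= projection_bound * inner L h h.
Proof.
move=> Lh; rewrite norm_actuator_proj.
have K0 := projection_bound_ge0.
apply: le_trans (ler_wpM2l K0 (bessel Lh)).
rewrite !mulr_sumr; apply: ler_sum => j _.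
have := coef_bound j; have /andP[n0 _] := eig_sqnorm_bounds j.
have d0 := attenuation_gt0 j; have g0 := midpoint_norm_gt0 j.
set w := \prod_(n < d) _; set s := inner _ _ _ => H.
rewrite -subr_ge0.
have -> : projection_bound * (s ^+ 2 / eig_sqnorm j) - w
  * ((s / attenuation j) ^+ 2 / midpoint_norm j) =
  s ^+ 2 * (projection_bound * (attenuation j ^+ 2 * midpoint_norm j) - w
    * eig_sqnorm j) /
   (eig_sqnorm j * (attenuation j ^+ 2 * midpoint_norm j)).
  by field; rewrite !gt_eqF.
apply: divr_ge0; first by apply: mulr_ge0; [exact: sqr_ge0|rewrite subr_ge0].
apply: mulr_ge0; first exact: ltW.
by apply: mulr_ge0; [exact: sqr_ge0|exact: ltW].
Qed.

Lemma oblique_actuator_proj :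
  oblique_projection L (calU L r M) (calE_perp bc L M)
  (fun h => h \- actuator_proj h).
Proof.
split => [h Lh|w [Lw [c wc]] [_ wE]].
  have Lu := L2_actuator_proj h; split.
    apply: span_orth; [exact: L2_eigfun|exact: L2B|move=> j].
    by rewrite innerC innerBl ?inner_actuator_proj ?subrr//; exact: L2_eigfun.
  rewrite (_ : _ \- _ = actuator_proj h); last by apply/funext => x /=;
    rewrite opprB addrC subrK.
  by split => //; exists (actuator_coef h); exact: aeW.
have Ls : L2 L (fun x => \sum_j c j * \1_(actuator L r j) x).
  by apply: L2_sum => i; apply: L2Z; exact: L2_actuator.
have c0 k : \sum_i c i * midpoint_value i k = 0.
  have : inner L (eigfun bc L k) w = 0 by apply: wE; apply: span_gen;
    exact: L2_eigfun.
  rewrite innerC (inner_ae Lw Ls (L2_eigfun _ _ _) wc) inner_lincomb;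
    [|exact: L2_actuator|exact: L2_eigfun].
  under eq_bigr do rewrite inner_actuator_eig mulrCA.
  rewrite -mulr_sumr => /eqP; rewrite mulf_eq0 gt_eqF ?attenuation_gt0//= =>
    /eqP.
  by [].
have {}c0 i : c i = 0.
  transitivity (\sum_k c k * (i == k)%:R).
    rewrite (bigD1 i)//= eqxx mulr1 big1 ?addr0// => k; rewrite eq_sym =>
      /negbTE ->.
    by rewrite mulr0.
  under eq_bigr do rewrite -midpoint_value_dual mulr_sumr.
  rewrite exchange_big big1// => j _.
  rewrite (eq_bigr (fun k => (c k * midpoint_value k j)
    * (midpoint_value i j / midpoint_norm j))).
    by rewrite -mulr_suml c0 mul0r.
  by move=> k _; ring.
apply: filterS wc => x /= + _ => -> //.
by rewrite big1// => j _; rewrite c0 mul0r.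
Qed.

(** |h - u|^2 <= 2 |h|^2 + 2 |u|^2. *)
Lemma operator_norm_actuator_proj :
  (operator_norm L (fun h => h \- actuator_proj h)%R <=
    (Num.sqrt (2 + 2 * projection_bound))%:E)%E.
Proof.
apply: ge_ereal_sup => _ [h [Lh h1] <-].
have Lu := L2_actuator_proj h.
rewrite norm2E; last exact: L2B.
move: h1; rewrite norm2E// !lee_fin => h1.
have {}h1 : inner L h h <= 1.
  by rewrite -[leRHS]sqrtr1 ler_sqrt in h1.
have K0 := projection_bound_ge0.
have ub := actuator_proj_bound Lh.
apply: ler_wsqrtr.
have := inner_ge0 L (h \+ actuator_proj h).
rewrite innerBl ?innerBr//; try exact: L2B.
rewrite innerDl//; last exact: L2D.
rewrite (innerC L h (h \+ _)) (innerC L (actuator_proj h) (h \+ _))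
  !innerDl// (innerC L (actuator_proj h) h).
by nra.
Qed.

End projection.

Theorem projection_part (R : realType) (d : nat)
    (L : 'I_d -> R) (hL : forall n, 0 < L n)
    (r : R) (hr : 0 < r < 1) (bc : boundary_condition) :
  exists P : nat -> ('rV[R]_d -> R) -> ('rV[R]_d -> R),
    (forall M, (0 < M)%N ->
       oblique_projection L (calU L r M) (calE_perp bc L M) (P M)) /\
    (ereal_sup [set operator_norm L (P M) | M in [set M | (0 < M)%N]]
       < +oo)%E.
Proof.
exists (fun M h => h \- actuator_proj L r bc M h); split => [M M0|].
  exact: oblique_actuator_proj.
apply: le_lt_trans (ltry (Num.sqrt (2 + 2 * @projection_bound R d r))).
apply: ge_ereal_sup => _ [M M0 <-].
exact: operator_norm_actuator_proj.
Qed.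

(** * The eigenvalues of A on the two subspaces *)

Section eigenvalues.
Context {R : realType} (d : nat) (L : 'I_d -> R) (hL : forall n, 0 < L n).
Context (nu2 : R) (hnu2 : 0 < nu2) (bc : boundary_condition).

Lemma eigtensor_inner_orth (j k : 'I_d -> nat) n : j n <> k n ->
  inner L (eigtensor L bc j) (eigtensor L bc k) = 0.
Proof.
move=> jk; rewrite inner_tensor; try by move=> m; exact: itv_bounded_eigwave.
by rewrite (bigD1 n)//= [X in X * _]eig_orth ?mul0r.
Qed.

Lemma eigtensor_norm_gt0 (j : 'I_d -> nat) :
  0 < inner L (eigtensor L bc j) (eigtensor L bc j).
Proof.
rewrite inner_tensor; try by move=> m; exact: itv_bounded_eigwave.
by apply: prodr_gt0 => n _; have /andP[] := eig_norm_bounds bc (j n) (hL n).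
Qed.

Lemma ae0_inner u v : L2 L u -> L2 L v ->
  u = cst 0 %[ae leb_box L] -> inner L u v = 0.
Proof.
move=> Lu Lv u0;
  rewrite (inner_ae Lu (box_bounded_L2 (box_bounded_cst L 0)) Lv u0).
by rewrite /inner /Rintegral integral0_eq// => x _; rewrite mul0r.
Qed.

Lemma eigtensor_neq0 j : ~ (eigtensor L bc j = cst 0 %[ae leb_box L]).
Proof.
move=> /(ae0_inner (eigtensor_L2 L bc j) (eigtensor_L2 L bc j)) h.
by have := eigtensor_norm_gt0 j; rewrite h ltxx.
Qed.

Lemma eigwavenumber_ge0 j n : 0 <= eigwavenumber L bc j n.
Proof. by rewrite divr_ge0 ?mulr_ge0 ?pi_ge0// ltW. Qed.

Lemma shifted_eigenvalue_ge1 j : 1 <= shifted_eigenvalue L bc j.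
Proof. by rewrite lerDl; apply: sumr_ge0 => n _; exact: sqr_ge0. Qed.

Lemma shifted_eigenvalue_homo (j k : 'I_d -> nat) :
  (forall n, (j n <= k n)%N) ->
  shifted_eigenvalue L bc j <= shifted_eigenvalue L bc k.
Proof.
move=> jk; rewrite lerD2l; apply: ler_sum => n _.
rewrite ler_sqr ?nnegrE ?eigwavenumber_ge0// ler_pM2r ?invr_gt0// ler_pM2r
  ?pi_gt0//.
by rewrite ler_nat freq_homo.
Qed.

Lemma eigenvalue_homo (a b : R) : 1 <= a -> a <= b ->
  nu2 * a ^+ 2 <= nu2 * b ^+ 2.
Proof.
move=> a1 ab; rewrite ler_pM2l// ler_sqr// nnegrE; lra.
Qed.

Lemma eigenvalue_calE_max M : (0 < M)%N ->
  is_max (eigenvalues_on nu2 bc L (calE bc L M))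
    (nu2 * shifted_eigenvalue L bc (fun=> M.-1) ^+ 2).
Proof.
move=> M0; have M1 : (M.-1 < M)%N by rewrite prednK.
split.
  pose j : {ffun 'I_d -> 'I_M} := [ffun=> Ordinal M1].
  have E : eigfun bc L j = eigtensor L bc (fun=> M.-1).
    by apply/funext => x; apply: eq_bigr => n _; rewrite ffunE.
  exists (eigtensor L bc (fun=> M.-1)); split.
  - by rewrite -E; apply: span_gen; exact: L2_eigfun.
  - exact: eigtensor_neq0.
  - exact: opA_eigtensor.
move=> alpha [phi [[Lphi [c phic]] phi0 Aphi]].
have [j jphi] : exists j : {ffun 'I_d -> 'I_M}, inner L phi (eigfun bc L j) !=
  0.
  apply: contrapT => /forallNP H; apply: phi0; apply: inner_eq0 => //.
  have Ls : L2 L (fun x => \sum_j c j * eigfun bc L j x).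
    by apply: L2_sum => j; apply: L2Z; exact: L2_eigfun.
  rewrite (inner_ae Lphi Ls Lphi phic) inner_lincomb//; last exact: L2_eigfun.
  apply: big1 => j _; rewrite innerC.
  by have /negP := H j; rewrite negbK => /eqP ->; rewrite mulr0.
rewrite (eigen_coef hL Lphi Aphi jphi) eigenvalue_homo
  ?shifted_eigenvalue_ge1//.
by apply: shifted_eigenvalue_homo => n; rewrite -ltnS prednK.
Qed.

(** The smallest indices outside of {0,...,M-1}^d: any other one dominates one
    of these. *)
Definition spike M (n m : 'I_d) : nat := if m == n then M else 0%N.

(** Which coordinate [n] gives the minimum depends on the side lengths. *)
Lemma eigenvalue_calE_perp M (n0 : 'I_d) : (0 < M)%N ->
  exists n, is_min (eigenvalues_on nu2 bc L (calE_perp bc L M))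
    (nu2 * shifted_eigenvalue L bc (spike M n) ^+ 2).
Proof.
move=> M0; pose n := [arg min_(n < n0) shifted_eigenvalue L bc (spike M n)]%O.
have nmin m : shifted_eigenvalue L bc (spike M n) <=
  shifted_eigenvalue L bc (spike M m).
  by rewrite /n; case: arg_minP => // i _; apply.
exists n; split.
  exists (eigtensor L bc (spike M n)); split.
  - apply: span_orth; [exact: L2_eigfun|exact: eigtensor_L2|move=> j].
    apply: (@eigtensor_inner_orth (fun m => j m) _ n).
    by rewrite /spike eqxx => jM; have := ltn_ord (j n); rewrite jM ltnn.
  - exact: eigtensor_neq0.
  - exact: opA_eigtensor.
move=> alpha [phi [[Lphi phiE] phi0 Aphi]].
have [j jphi] : exists j : 'I_d -> nat, inner L phi (eigtensor L bc j) != 0.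
  apply: contrapT => /forallNP H; apply: phi0;
    apply: (eigtensor_complete hL Lphi (bc := bc)) => j.
  by have /negP := H j; rewrite negbK => /eqP.
rewrite (eigen_coef hL Lphi Aphi jphi) eigenvalue_homo
  ?shifted_eigenvalue_ge1//.
have [m jm] : exists m, (M <= j m)%N.
  apply: contrapT => /forallNP H; have {}H m : (j m < M)%N.
    by rewrite ltnNge; apply/negP; exact: H.
  pose k : {ffun 'I_d -> 'I_M} := [ffun m => Ordinal (H m)].
  have E : eigfun bc L k = eigtensor L bc j.
    by apply/funext => x; apply: eq_bigr => m _; rewrite ffunE.
  move/negP : jphi; apply; rewrite innerC -E; apply/eqP; apply: phiE.
  by apply: span_gen; exact: L2_eigfun.
apply: le_trans (nmin m) _; apply: shifted_eigenvalue_homo => p.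
by rewrite /spike; case: eqP => [->|].
Qed.

Definition ratio_bound : R := 1 + \sum_(n < d) \sum_(m < d) (L n / L m) ^+ 2.

(** [freq] lies between [i] and [i + 1], so every wavenumber on the left is at
    most M pi / L_m, while on the right coordinate [n] contributes at least
    (M pi / L_n)^2. *)
Lemma shifted_eigenvalue_ratio M n : (0 < M)%N ->
  shifted_eigenvalue L bc (fun=> M.-1) <=
    ratio_bound * shifted_eigenvalue L bc (spike M n).
Proof.
move=> M0; have l1 := shifted_eigenvalue_ge1 (spike M n).
have kn : eigwavenumber L bc (spike M n) n ^+ 2 <=
  shifted_eigenvalue L bc (spike M n).
  rewrite /shifted_eigenvalue (bigD1 n)//= addrCA lerDl addr_ge0//.
  by apply: sumr_ge0 => m _; exact: sqr_ge0.
rewrite /ratio_bound mulrDl mul1r lerD//.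
apply: (@le_trans _ _ ((\sum_(m < d) (L n / L m) ^+ 2)
  * shifted_eigenvalue L bc (spike M n))).
  rewrite mulr_suml; apply: ler_sum => m _.
  apply: (@le_trans _ _ ((L n / L m) ^+ 2 * eigwavenumber L bc (spike M n) n
    ^+ 2)); last first.
    by rewrite ler_wpM2l// sqr_ge0.
  rewrite -exprMn ler_sqr ?nnegrE ?eigwavenumber_ge0//; last first.
    by rewrite mulr_ge0 ?eigwavenumber_ge0// divr_ge0// ltW.
  rewrite /eigwavenumber /wavenumber /spike eqxx.
  rewrite (_ : L n / L m * _ = (freq bc M)%:R * pi / L m); last first.
    by field; rewrite !gt_eqF.
  rewrite ler_pM2r ?invr_gt0// ler_pM2r ?pi_gt0// ler_nat.
  by rewrite (leq_trans (freq_le _ _))// prednK// freq_ge.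
rewrite ler_wpM2r//; first lra.
rewrite [leRHS](bigD1 n)//= lerDl; apply: sumr_ge0 => p _; apply: sumr_ge0 =>
  m _.
exact: sqr_ge0.
Qed.

Lemma eigenvalue_ratio M n : (0 < M)%N ->
  nu2 * shifted_eigenvalue L bc (fun=> M.-1) ^+ 2 /
    (nu2 * shifted_eigenvalue L bc (spike M n) ^+ 2) <=
  ratio_bound ^+ 2.
Proof.
move=> M0; have l1 := shifted_eigenvalue_ge1 (spike M n); have m1 :=
  shifted_eigenvalue_ge1 (fun=> M.-1).
have r := shifted_eigenvalue_ratio n M0.
have s0 : 0 < nu2 * shifted_eigenvalue L bc (spike M n) ^+ 2.
  by rewrite mulr_gt0// exprn_gt0//; lra.
rewrite ler_pdivrMr// [leRHS]mulrCA ler_pM2l// -exprMn ler_sqr// nnegrE; lra.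
Qed.

End eigenvalues.

Theorem eigenvalue_part (R : realType) (d : nat) (hd : (0 < d)%N)
    (L : 'I_d -> R) (hL : forall n, 0 < L n) (nu2 : R) (hnu2 : 0 < nu2)
    (bc : boundary_condition) :
  exists alpha alphap : nat -> R,
    [/\ forall M, (0 < M)%N ->
          is_max (eigenvalues_on nu2 bc L (calE bc L M)) (alpha M),
        forall M, (0 < M)%N ->
          is_min (eigenvalues_on nu2 bc L (calE_perp bc L M)) (alphap M) &
        (ereal_sup [set (alpha M / alphap M)%:E
                   | M in [set M | (0 < M)%N]] < +oo)%E].
Proof.
have H M : exists n, (0 < M)%N ->
  is_min (eigenvalues_on nu2 bc L (calE_perp bc L M))
    (nu2 * shifted_eigenvalue L bc (spike M n) ^+ 2).
  case: (posnP M) => [->|M0]; first by exists (Ordinal hd).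
  by have [n nP] := eigenvalue_calE_perp hL hnu2 bc (Ordinal hd) M0; exists n.
have [s sP] := choice H.
exists (fun M => nu2 * shifted_eigenvalue L bc (fun=> M.-1) ^+ 2).
exists (fun M => nu2 * shifted_eigenvalue L bc (spike M (s M)) ^+ 2); split =>
  //.
  by move=> M M0; exact: eigenvalue_calE_max.
apply: le_lt_trans (ltry (ratio_bound L ^+ 2)).
apply: ge_ereal_sup => _ [M M0 <-].
by rewrite lee_fin; exact: eigenvalue_ratio.
Qed.

Theorem lemma2p10 (R : realType) (d : nat) (hd : (1 <= d <= 3)%N)
    (L : 'I_d -> R) (hL : forall n, 0 < L n) (nu2 : R) (hnu2 : 0 < nu2)
    (r : R) (hr : 0 < r < 1) (bc : boundary_condition) :
  (exists alpha alphap : nat -> R,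
    [/\ forall M, (0 < M)%N ->
          is_max (eigenvalues_on nu2 bc L (calE bc L M)) (alpha M),
        forall M, (0 < M)%N ->
          is_min (eigenvalues_on nu2 bc L (calE_perp bc L M)) (alphap M) &
        (ereal_sup [set (alpha M / alphap M)%:E
                   | M in [set M | (0 < M)%N]] < +oo)%E]) /\
  (exists P : nat -> ('rV[R]_d -> R) -> ('rV[R]_d -> R),
    (forall M, (0 < M)%N ->
       oblique_projection L (calU L r M) (calE_perp bc L M) (P M)) /\
    (ereal_sup [set operator_norm L (P M) | M in [set M | (0 < M)%N]]
       < +oo)%E).
Proof.
case/andP: hd => d0 _; split; first exact: eigenvalue_part.
exact: projection_part.
Qed.
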